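(* For every $\rho>0$ and $d\ge1$ there is a positive constant $C_{\rho,d}$ depending only on $\rho$ and $d$ such that the following holds for every $1\le s\le d$, $V>0$, $\sigma>0$ and all positive integers $N_1,\dots,N_d$. Suppose the design points form a lattice $$\{x^{(1)},\dots,x^{(n)}\}=\prod_{k=1}^d\big\{u^{(k)}_{i_k}:\ i_k\in\{0,1,\dots,n_k-1\}\big\},\qquad n=n_1\cdots n_d,$$ where for every $k\in[d]$, $n_k\ge2$, $0=u^{(k)}_0<u^{(k)}_1<\dots<u^{(k)}_{n_k-1}\le1$, and $u^{(k)}_{i_k}-u^{(k)}_{i_k-1}\ge\rho/n_k$ for all $i_k\in\{1,\dots,n_k-1\}$. Suppose $y_i=f^*(x^{(i)})+\xi_i$ for $i\in[n]$, where $\xi_1,\dots,\xi_n$ are independent mean-zero sub-Gaussian errors with parameter $\sigma$, i.e. $\mathbb{E}[e^{\lambda\xi_i}]\le e^{\sigma^2\lambda^2/2}$ for all $\lambda\in\mathbb{R}$. If $f^*\in\mathcal{F}^{d,s}_{\infty\text{-mars}}$ and $V_{\text{mars}}(f^* )\le V$, then the approximate estimator $\tilde f^{d,s}_{n,V}$ (defined in the context from $N_1,\dots,N_d$) satisfies $$\mathcal{R}_F\big(\tilde f^{d,s}_{n,V},f^*\big)\le\frac{8V^2}{N^2}+C_{\rho,d}\Big(\frac{\sigma^2V^{1/2}}{n}\Big)^{4/5}\Big[\log\Big(2+\frac{Vn^{1/2}}{\sigma}\Big)\Big]^{\frac{3(2s-1)}{5}}+C_{\rho,d}\frac{\sigma^2}{n}[\log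 n]^2,$$ where $N=\min_kN_k$.
   Context: $[m]=\{1,\dots,m\}$, $u_+=\max\{u,0\}$, $\mathbf 0=(0,\dots,0)$. The risk is $\mathcal{R}_F(\hat f_n,f^* )=\mathbb{E}\big[\frac1n\sum_{i=1}^n(\hat f_n(x^{(i)})-f^*(x^{(i)}))^2\big]$, the expectation being over $y_1,\dots,y_n$. For $\alpha\in\{0,1\}^d$ put $S(\alpha)=\{j\in[d]:\alpha_j=1\}$ and $|\alpha|=|S(\alpha)|$; $t^{(\alpha)}=(t_j,\ j\in S(\alpha))$. For $a_{\mathbf 0}\in\mathbb{R}$ and a collection $\{\nu_\alpha\}$ in which, for each $\alpha\in\{0,1\}^d\setminus\{\mathbf 0\}$ with $|\alpha|\le s$, $\nu_\alpha$ is a finite (Borel) signed measure on $[0,1)^{|\alpha|}$ (coordinates indexed by $S(\alpha)$), define on $[0,1]^d$ $$f_{a_{\mathbf 0},\{\nu_\alpha\}}(x_1,\dots,x_d)=a_{\mathbf 0}+\sum_{\substack{\alpha\in\{0,1\}^d\setminus\{\mathbf 0\}\\|\alpha|\le s}}\int_{[0,1)^{|\alpha|}}\prod_{j\in S(\alpha)}(x_j-t_j)_+\,d\nu_\alpha(t^{(\alpha)}).$$ $\mathcal{F}^{d,s}_{\infty\text{-mars}}$ is the class of all such functions. The complexity of $f=f_{a_{\mathbf 0},\{\nu_\alpha\}}$ is $$V_{\text{mars}}(f)=\sum_{\substack{\alpha\in\{0,1\}^d\setminus\{\mathbf 0\}\\|\alpha|\le s}}|\nu_\alpha|\big([0,1)^{|\alpha|}\setminus\{\mathbf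 0\}\big),$$ where $|\nu|$ is the (total) variation measure of $\nu$; this is well defined because $a_{\mathbf 0}$ and the $\nu_\alpha$ are uniquely determined by $f$. Approximate estimator. For positive integers $N_1,\dots,N_d$ let $\tilde{\mathcal{U}}_k=\{0,\frac1{N_k},\frac2{N_k},\dots,1\}$. $\tilde f^{d,s}_{n,V}$ is a minimizer of $\sum_{i=1}^n(y_i-f(x^{(i)}))^2$ over all $f=f_{a_{\mathbf 0},\{\nu_\alpha\}}\in\mathcal{F}^{d,s}_{\infty\text{-mars}}$ with $V_{\text{mars}}(f)\le V$ such that each $\nu_\alpha$ is concentrated on the finite set $\big(\prod_{k\in S(\alpha)}\tilde{\mathcal{U}}_k\big)\cap[0,1)^{|\alpha|}$. *)

(* Defs.v *)
From HB Require Import structures.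
From mathcomp Require Import all_boot all_order all_algebra.
From mathcomp Require Import all_classical all_reals all_analysis.

Set Implicit Arguments.
Unset Strict Implicit.
Unset Printing Implicit Defensive.

Import Order.TTheory GRing.Theory Num.Theory.
Import numFieldNormedType.Exports.

Local Open Scope classical_set_scope.
Local Open Scope ring_scope.

(* A finite signed measure is a charge.  Its Jordan decomposition does not
   depend (on measurable sets) on the Hahn decomposition chosen here. *)
Section signed_measure.
Context {dsp : measure_display} {T : measurableType dsp} {R : realType}.
Implicit Types (nu : {charge set T -> \bar R}) (A D : set T).

Definition hahn_pos nu : set T := projT1 (cid (Hahn_decomposition nu)).

Definition hahn_neg nu : set T :=
  projT1 (cid (projT2 (cid (Hahn_decomposition nu)))).

Lemma hahn_pos_neg nu : hahn_decomposition nu (hahn_pos nu) (hahn_neg nu).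
Proof. exact: projT2 (cid (projT2 (cid (Hahn_decomposition nu)))). Qed.

Definition total_variation nu : set T -> \bar R :=
  charge_variation (hahn_pos_neg nu).

Definition charge_Rintegral nu D (f : T -> R) : R :=
  Rintegral (jordan_pos (hahn_pos_neg nu)) D f
  - Rintegral (jordan_neg (hahn_pos_neg nu)) D f.

Definition concentrated_on nu A : Prop :=
  forall B : set T, measurable B -> B `&` A = set0 -> nu B = 0%E.

End signed_measure.

Section mars.
Context {R : realType} {d : nat}.

Definition unit_cube : set ('I_d -> R) := [set x | forall j, 0 <= x j <= 1].

Definition ho_cube (m : nat) : set (m.-tuple R) :=
  [set t | forall i, 0 <= tnth t i < 1].

(* The multi-index alpha in {0,1}^d is identified with its support S(alpha), a
   {set 'I_d}.  R^S(alpha) is represented by #|alpha|.-tuple R, with its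
   product (Borel) sigma-algebra: the i-th entry is the coordinate indexed by
   the i-th element enum_val i of alpha.  A signed measure on [0,1)^|alpha| is
   a charge on R^|alpha| concentrated on [0,1)^|alpha|. *)
Definition charge_family : Type :=
  forall alpha : {set 'I_d}, {charge set (#|alpha|.-tuple R) -> \bar R}.

Definition active (s : nat) : pred {set 'I_d} :=
  fun alpha => (alpha != finset.set0) && (#|alpha| <= s)%N.

Definition hinge_prod (alpha : {set 'I_d}) (x : 'I_d -> R)
    (t : #|alpha|.-tuple R) : R :=
  \prod_(i < #|alpha|) Num.max (x (enum_val i) - tnth t i) 0.

Definition mars_fun (s : nat) (a0 : R) (nu : charge_family) (x : 'I_d -> R) : R :=
  a0 + \sum_(alpha | active s alpha)
         charge_Rintegral (nu alpha) (@ho_cube #|alpha|) (hinge_prod x).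

(* Functions on [0,1]^d are taken as functions on R^d whose values outside
   unit_cube are irrelevant. *)
Definition represents (s : nat) (a0 : R) (nu : charge_family)
    (f : ('I_d -> R) -> R) : Prop :=
  (forall alpha, active s alpha ->
     concentrated_on (nu alpha) (@ho_cube #|alpha|)) /\
  (forall x, unit_cube x -> f x = mars_fun s a0 nu x).

Definition mars_class (s : nat) : set (('I_d -> R) -> R) :=
  [set f | exists a0 nu, represents s a0 nu f].

Definition complexity (s : nat) (nu : charge_family) : \bar R :=
  (\sum_(alpha | active s alpha)
     total_variation (nu alpha)
       (@ho_cube #|alpha| `\` [set t | forall i, tnth t i = 0%R]))%E.

(* The representation of f is unique (as far as active indices and measurable
   sets are concerned), so any one may be chosen; +oo outside mars_class. *)
Definition Vmars (s : nat) (f : ('I_d -> R) -> R) : \bar R :=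
  if pselect (exists nu, exists a0, represents s a0 nu f) is left h
  then complexity s (projT1 (cid h)) else +oo%E.

Definition knot_grid (N : 'I_d -> nat) (alpha : {set 'I_d}) :
    set (#|alpha|.-tuple R) :=
  [set t | forall i, exists2 m : nat, (m <= N (enum_val i))%N &
     tnth t i = m%:R / (N (enum_val i))%:R].

Definition approx_class (s : nat) (V : R) (N : 'I_d -> nat) :
    set (('I_d -> R) -> R) :=
  [set f | (Vmars s f <= V%:E)%E /\
     exists a0 nu, represents s a0 nu f /\
       forall alpha, active s alpha ->
         concentrated_on (nu alpha) (@knot_grid N alpha `&` @ho_cube #|alpha|)].

Definition rss (n : nat) (x : 'I_n -> 'I_d -> R) (y : 'I_n -> R)
    (f : ('I_d -> R) -> R) : R :=
  \sum_(i < n) (y i - f (x i)) ^+ 2.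

Definition is_approx_estimator (s : nat) (V : R) (N : 'I_d -> nat) (n : nat)
    (x : 'I_n -> 'I_d -> R)
    (fhat : ('I_n -> R) -> ('I_d -> R) -> R) : Prop :=
  forall y : 'I_n -> R, approx_class s V N (fhat y) /\
    forall g, approx_class s V N g -> rss x y (fhat y) <= rss x y g.

(* No order on the enumeration x is imposed; as n = n_1 ... n_d, equality of
   the sets makes x injective. *)
Definition lattice_design (rho : R) (n : nat) (x : 'I_n -> 'I_d -> R)
    (nk : 'I_d -> nat) (u : 'I_d -> nat -> R) : Prop :=
  [/\ n = (\prod_(k < d) nk k)%N,
      range x = [set p | forall k, exists2 i : nat, (i < nk k)%N & p k = u k i] &
      forall k, [/\ (2 <= nk k)%N, u k 0%N = 0,
        (forall i, (0 < i < nk k)%N -> u k i.-1 < u k i),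
        u k (nk k).-1 <= 1 &
        (forall i, (0 < i < nk k)%N -> rho / (nk k)%:R <= u k i - u k i.-1)]].

(* The neutral element is at least every N k, so for 0 < d this is the true
   minimum. *)
Definition min_knots (N : 'I_d -> nat) : nat :=
  \big[minn/(\max_(k < d) N k)%N]_(k < d) N k.

End mars.

Section random_errors.
Context {dsp : measure_display} {T : measurableType dsp} {R : realType}.
Variable P : probability T R.

Definition mutually_independent (n : nat) (xi : 'I_n -> {RV P >-> R}) : Prop :=
  forall (I : {set 'I_n}) (B : 'I_n -> set R), (forall i, measurable (B i)) ->
    P (\bigcap_(i in [set i | i \in I]) (xi i @^-1` B i))
    = (\prod_(i in I) P (xi i @^-1` B i))%E.

Definition sub_gaussian (sigma : R) (X : {RV P >-> R}) : Prop :=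
  forall lambda : R,
    (mmt_gen_fun P X lambda <= (expR (sigma ^+ 2 * lambda ^+ 2 / 2))%:E)%E.

Definition risk (d n : nat) (x : 'I_n -> 'I_d -> R) (Y : T -> 'I_n -> R)
    (fhat : ('I_n -> R) -> ('I_d -> R) -> R) (fstar : ('I_d -> R) -> R) :
    \bar R :=
  ('E_P[fun w : T =>
     (n%:R^-1 * \sum_(i < n) (fhat (Y w) (x i) - fstar (x i)) ^+ 2)%R])%E.

End random_errors.

(* Main.v *)
Require Import Defs.
From HB Require Import structures.
From mathcomp Require Import all_boot all_order all_algebra.
From mathcomp Require Import all_classical all_reals all_analysis.
From mathcomp Require Import measurable_realfun zify ring lra.

Set Implicit Arguments.
Unset Strict Implicit.
Unset Printing Implicit Defensive.

Import Order.TTheory GRing.Theory Num.Theory.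
Import numFieldNormedType.Exports.

Local Open Scope classical_set_scope.
Local Open Scope ring_scope.

(* A hinge (x - t)_+ equals (1 - t) x minus the covariance of the Brownian
   bridge, whose Faber-Schauder expansion writes it, at the lattice points, as a
   combination of tents: at level j a coefficient family with l^1 norm at most 1,
   multiplying functions of squared norm O(n 8^-j).  Tensor products give the
   same for products of hinges, with polynomial factors in the level.  Let es be
   an orthonormal basis of the span of all levels at most J (a hyperbolic cross,
   of dimension O(J^(s-1) 2^J)).  The basic inequality of least squares, against
   an oracle g in the approximating class, bounds the loss by 3 |g - f*|^2, plus
   the squared projection of the noise on es, plus the correlation of the noise
   with the residual of fhat - g.  The last is at most 2 V times the supremum over
   hinges, and the expectation of the supremum is summed level by level from the
   sub-Gaussian maximal inequality, giving O(sigma n^(1/2) J^s 8^(-J/2)); then J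
   is optimised.  The oracle g is f* with its measures rounded to the knots by
   linear interpolation, which moves f* by at most V / N and, because the
   representation of a function is unique, does not increase its complexity. *)

(** * Dyadic expansion of the Brownian bridge covariance *)

Section hinge_1d.
Context {R : realType}.
Implicit Types (a b t x y : R) (m j k l n : nat).

(** The hinges form a continuum, yet no chaining is called for: the [l^1] bounds on the coefficients
    are uniform in [t], so at each level the supremum over [t] reduces to a maximum over finitely
    many functions. Up to constants, [8 ^- j] is a squared amplitude [4 ^- j] times a bound [2 ^- j]
    on the fraction of lattice points in a dyadic cell. The obstacle is that the complexity ignores
    mass at the origin, so [V] controls nothing there. It is met by making the coefficients of
    positive level vanish at [t = 0]: the hinge product at the origin then lies in the span of [es]
    and costs only dimension, and the constant function joins that span for the same reason. With
    [M = V n^(1/2) / sigma] and in units of [sigma^2 / n], the noise costs [J^(s-1) 2^J] on the span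
    and [M J^s 8^(-J/2)] off it; equality at [2^J ~ (M log M)^(2/5)] gives the power 4/5 and a
    logarithm to the power [s - 3/5 <= 3(2s-1)/5]. Since the estimator need not be measurable in the
    data, the loss is dominated pointwise by a measurable variable before means are taken. *)

Definition tent y : R := Num.max 0 (Num.min y (1 - y)).

(* The covariance of the Brownian bridge on [0, 1]. *)
Definition bridge a b : R :=
  if (0 <= a <= 1) && (0 <= b <= 1) then Num.min a b - a * b else 0.

Lemma tent_ge0 y : 0 <= tent y.
Proof. by rewrite /tent le_max lexx. Qed.

Lemma tent_le y : tent y <= 2^-1.
Proof.
rewrite /tent ge_max; apply/andP; split; first lra.
by rewrite ge_min; case: (lerP y 2^-1) => //= h; lra.
Qed.

Lemma tent_out y : ~~ (0 < y < 1) -> tent y = 0.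
Proof.
move=> h; apply/max_idPl; rewrite ge_min; case: (lerP y 0) h => //= y0.
by rewrite -leNgt => h; lra.
Qed.

Lemma bridge_ge0 a b : 0 <= bridge a b.
Proof.
rewrite /bridge; case: ifP => // /andP[/andP[a0 a1] /andP[b0 b1]].
by rewrite subr_ge0 le_min; apply/andP; split; nra.
Qed.

Lemma bridge_le a b : bridge a b <= 1.
Proof.
rewrite /bridge; case: ifP => // /andP[/andP[a0 a1] /andP[b0 b1]].
have : Num.min a b <= a by rewrite ge_min lexx.
by move=> h; nra.
Qed.

Lemma bridge_out a b : ~~ ((0 < a < 1) && (0 < b < 1)) -> bridge a b = 0.
Proof.
move=> h; rewrite /bridge; case: ifP => // /andP[/andP[a0 a1] /andP[b0 b1]].
have : [\/ a = 0, a = 1, b = 0 | b = 1].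
  have [a0'|a0'] := ltrP 0 a; last by apply: Or41; lra.
  have [a1'|a1'] := ltrP a 1; last by apply: Or42; lra.
  have [b0'|b0'] := ltrP 0 b; last by apply: Or43; lra.
  have [b1'|b1'] := ltrP b 1; last by apply: Or44; lra.
  by rewrite a0' a1' b0' b1' in h.
have minE : Num.min a b = if a < b then a else b by rewrite /Num.min.
by rewrite minE; case=> e; case: ifP => // c; subst; lra.
Qed.

(* Self-similarity of the Brownian bridge under midpoint splitting; its iteration
   is the Faber-Schauder expansion. *)
Lemma bridge_split a b :
  bridge a b = tent a * tent b
    + 2^-1 * (bridge (2 * a) (2 * b) + bridge (2 * a - 1) (2 * b - 1)).
Proof.
have tentE y : tent y = if 0 < y < 1 then (if y < 2^-1 then y else 1 - y) else 0.
  case: ifPn => [/andP[y0 y1]|/tent_out//].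
  rewrite /tent; case: ifP => yh.
    by rewrite min_l ?max_r //; lra.
  by rewrite min_r ?max_r //; lra.
have minE (u v : R) : Num.min u v = if u < v then u else v by rewrite /Num.min.
have bE u v : bridge u v = if (0 < u < 1) && (0 < v < 1) then
   (if u < v then u else v) - u * v else 0.
  case: ifPn => [/andP[/andP[u0 u1] /andP[v0 v1]]|/bridge_out//].
  by rewrite /bridge !ltW //= minE.
have e1 (u : R) : (2 * u < 1) = (u < 2^-1) by apply/idP/idP; lra.
have e2 (u : R) : (0 < 2 * u - 1) = (2^-1 < u) by apply/idP/idP; lra.
have e3 (u : R) : (0 < 2 * u) = (0 < u) by apply/idP/idP; lra.
have e4 (u : R) : (2 * u - 1 < 1) = (u < 1) by apply/idP/idP; lra.
have e5 (u v : R) : (2 * u < 2 * v) = (u < v) by apply/idP/idP; lra.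
have e6 (u v : R) : (2 * u - 1 < 2 * v - 1) = (u < v) by apply/idP/idP; lra.
rewrite !tentE !bE e1 e2 e3 e4 e5 e1 e2 e3 e4 e6.
have z (u : R) : ~~ (0 < u < 1) ->
    [/\ (0 < u < 1) = false, (0 < u < 2^-1) = false & (2^-1 < u < 1) = false].
  move=> hu; split; first exact/negbTE.
    by apply/negbTE/(contra _ hu) => /andP[h1 h2]; apply/andP; split; lra.
  by apply/negbTE/(contra _ hu) => /andP[h1 h2]; apply/andP; split; lra.
have [ha|/z[_ -> ->]] := boolP (0 < a < 1); last by rewrite /= mul0r addr0 mulr0 addr0.
have [hb|/z[_ -> ->]] := boolP (0 < b < 1); last by rewrite !andbF mulr0 addr0 mulr0 addr0.
move: ha hb => /andP[ha ha1] /andP[hb hb1]; rewrite ha ha1 hb hb1 !andbT /=.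
case: (ltrgtP a 2^-1) => ha2; case: (ltrgtP b 2^-1) => hb2; rewrite /=;
  case: (ltrP a b) => hab; rewrite ?mulr0 ?mul0r ?addr0 ?add0r; subst; lra.
Qed.

(** Iteration of [bridge_split]. The scale factor sits on the second tent, so that the first can
    serve as a coefficient in [t] and the second as a function of the lattice point. The remainder
    is kept exact: on a lattice it becomes one more finite level. *)
Lemma bridge_expand m a b :
  bridge a b = \sum_(j < m) \sum_(k < 2 ^ j)
      tent (2 ^+ j * a - k%:R) * (2 ^- j * tent (2 ^+ j * b - k%:R))
    + \sum_(k < 2 ^ m) 2 ^- m * bridge (2 ^+ m * a - k%:R) (2 ^+ m * b - k%:R).
Proof.
elim: m => [|m IH].
  by rewrite big_ord0 add0r big_ord1 expr0 invr1 !mul1r !subr0.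
rewrite IH big_ord_recr /= -addrA; congr (_ + _).
have -> : \sum_(k < 2 ^ m.+1) 2 ^- m.+1 *
     bridge (2 ^+ m.+1 * a - k%:R) (2 ^+ m.+1 * b - k%:R) =
   \sum_(k < 2 ^ m) 2 ^- m * (2^-1 * (bridge (2 * (2 ^+ m * a - k%:R)) (2 * (2 ^+ m * b - k%:R))
     + bridge (2 * (2 ^+ m * a - k%:R) - 1) (2 * (2 ^+ m * b - k%:R) - 1))).
  rewrite -(big_mkord xpredT (fun k => 2 ^- m.+1 *
     bridge (2 ^+ m.+1 * a - k%:R) (2 ^+ m.+1 * b - k%:R))).
  rewrite -(big_mkord xpredT (fun k => 2 ^- m * (2^-1 * (bridge (2 * (2 ^+ m * a - k%:R)) (2 * (2 ^+ m * b - k%:R))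
     + bridge (2 * (2 ^+ m * a - k%:R) - 1) (2 * (2 ^+ m * b - k%:R) - 1))))).
  (* Induction on the number of cells instead of [m]: cell [n] has the children [2n] and [2n + 1],
     which are the last two terms of the longer sum. *)
  rewrite expnS mulnC; elim: (2 ^ m)%N => [|n IHn]; first by rewrite mul0n !big_nil.
  rewrite mulSn !addSn add0n big_nat_recr // big_nat_recr //= IHn [RHS]big_nat_recr //= -addrA; congr (_ + _).
  rewrite !exprS invfM mulrA (mulrC (2^-1)) -!mulrA -!mulrDr; congr (_ * (_ * (_ + _))).
    by congr bridge; rewrite natrM; ring.
  have e : (n * 2).+1%:R = n%:R * 2 + 1 :> R by rewrite -natrM natr1.
  by congr bridge; rewrite e; ring.
rewrite -big_split /=; apply: eq_bigr => k _.
by rewrite bridge_split; ring.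
Qed.

Lemma hinge_bridge t x : 0 <= t <= 1 -> 0 <= x <= 1 ->
  Num.max (x - t) 0 = (1 - t) * x - bridge t x.
Proof.
move=> ht hx; rewrite /bridge ht hx /=.
have -> : Num.min t x = if t < x then t else x by rewrite /Num.min.
have -> : Num.max (x - t) 0 = if x - t < 0 then 0 else x - t by rewrite /Num.max.
by case: ifP; case: ifP => *; lra.
Qed.

Lemma unit_cell_uniq y k k' : 0 < y - k%:R < 1 -> 0 < y - k'%:R < 1 -> k = k'.
Proof.
move=> /andP[h1 h2] /andP[h3 h4].
have : k%:R < k'%:R + 1 :> R by lra.
have : k'%:R < k%:R + 1 :> R by lra.
by rewrite !natr1 !ltr_nat !ltnS => a1 a2; apply/eqP; rewrite eqn_leq a1 a2.
Qed.

(** The form in which disjointness of supports enters: a level has small [l^1] norm because [t]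
    meets only one of its cells. *)
Lemma sum_le_at_most_one (I : finType) (P : pred I) (F : I -> R) (c : R) : 0 <= c ->
  (forall i, P i -> F i <= c) ->
  (forall i i', P i -> P i' -> F i != 0 -> F i' != 0 -> i = i') ->
  \sum_(i | P i) F i <= c.
Proof.
move=> c0 Fc uniq.
have [/existsP[i /andP[Pi Fi]]|/existsPn h] := boolP [exists i, P i && (F i != 0)].
  rewrite (bigD1 i) //= big1 ?addr0 ?Fc // => i' /andP[Pi' ne].
  by apply/eqP/negPn; apply: contra ne => Fi'; rewrite (uniq _ _ Pi' Pi Fi' Fi).
rewrite big1 // => i Pi; apply/eqP/negPn; apply: contraT => /negPn Fi.
by have := h i; rewrite Pi Fi.
Qed.

End hinge_1d.

(** * Points with a minimal gap on a line *)

Section lattice_1d.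
Context {R : realType}.
Variables (g : R) (n : nat) (u : nat -> R).
Hypothesis g0 : 0 < g.
Hypothesis gap : forall i, (0 < i < n)%N -> g <= u i - u i.-1.

Lemma separated i k : (i + k < n)%N -> k%:R * g <= u (i + k)%N - u i.
Proof.
elim: k => [|k IH] h; first by rewrite addn0 subrr mul0r.
have /IH{}IH : (i + k < n)%N by rewrite addnS in h; exact: ltnW.
have := @gap (i + k.+1)%N; rewrite addnS ltn0Sn -addnS h /= => /(_ isT).
by rewrite -natr1 mulrDl mul1r addnS /=; lra.
Qed.

Lemma separated_lt i k : (i < k)%N -> (k < n)%N -> g <= u k - u i.
Proof.
move=> ik kn; have := @separated i (k - i)%N; rewrite subnKC ?(ltnW ik) // => /(_ kn).
apply: le_trans; rewrite -{1}(mul1r g) ler_pM2r // ler1n subn_gt0 //.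
Qed.

Lemma lattice_inj i k : (i < n)%N -> (k < n)%N -> `|u i - u k| < g -> i = k.
Proof.
move=> hi hk; case: (ltngtP i k) => // ik; rewrite ltr_norml => /andP[h1 h2].
  exfalso; have := separated_lt ik hk; lra.
exfalso; have := separated_lt ik hi; lra.
Qed.

Lemma count_interval a b : a <= b ->
  \sum_(l < n) ((a < u l < b)%R : nat)%:R <= 1 + (b - a) / g.
Proof.
move=> ab.
(* The invariant remembers the last point found in the interval: [S] points span at least [S - 1]
   gaps. *)
suff H k : (k <= n)%N -> let S := \sum_(l < k) ((a < u l < b)%R : nat)%:R in
    S = 0 \/ exists l, [/\ (l < k)%N, a < u l < b & (S - 1) * g <= u l - a].
  case: (H n (leqnn n)) => [->|[l [_ /andP[h1 h2] h3]]].
    by rewrite addr_ge0 // divr_ge0 ?subr_ge0 // ltW.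
  by rewrite -lerBlDl ler_pdivlMr // (le_trans h3) // lerD2r ltW.
elim: k => [|k IH] kn /=; first by left; rewrite big_ord0.
rewrite big_ord_recr /=; case: (boolP (a < u k < b)) => ukab; last first.
  rewrite addr0; case: (IH (ltnW kn)) => [->|[l [h1 h2 h3]]]; first by left.
  by right; exists l; split => //; exact: ltnW.
right; exists k; rewrite ltnSn ukab; split => //.
move: ukab => /andP[ak kb].
case: (IH (ltnW kn)) => [->|[l [h1 h2 h3]]]; first by rewrite add0r subrr mul0r subr_ge0 ltW.
by have := separated_lt h1 kn; rewrite addrK /=; lra.
Qed.

End lattice_1d.

(** * Hinge expansion at the points of a one-dimensional lattice *)

Section hinge_system.
Context {R : realType}.
Variables (rho : R) (n : nat) (u : nat -> R) (A : nat).
Hypotheses (rho0 : 0 < rho) (n0 : (0 < n)%N) (A0 : (0 < A)%N) (rhoA : rho <= A%:R).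
Hypothesis u01 : forall i, (i < n)%N -> 0 <= u i <= 1.
Hypothesis gap : forall i, (0 < i < n)%N -> rho / n%:R <= u i - u i.-1.

Let g0 : 0 < rho / n%:R. Proof. by rewrite divr_gt0 // ltr0n. Qed.

(** At this level dyadic cells are no longer than the lattice gap. Minimality keeps [2 ^ m] of order
    [n / rho], which the norm of the remainder and the cell counts at coarser levels rely on. *)
Lemma finest_level : exists m, n%:R <= rho * 2 ^+ m /\
  (m = 0%N \/ forall j, (j < m)%N -> rho * 2 ^+ j < n%:R).
Proof.
have ex : exists m, (fun m => n%:R <= rho * 2 ^+ m) m.
  exists (Num.bound (n%:R / rho)); rewrite mulrC -ler_pdivrMr //.
  apply: le_trans (ltW (archi_boundP _)) _; first by rewrite divr_ge0 // ltW.
  by rewrite -natrX ler_nat ltnW // ltn_expl.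
have [m hm min] := ex_minnP ex; exists m; split => //.
right => j jm; rewrite ltNge; apply/negP => /min; rewrite leqNgt jm //.
Qed.

Lemma card_lattice_cell m (k : nat) :
  \sum_(l < n) ((0 < 2 ^+ m * u l - k%:R < 1)%R : nat)%:R <= 1 + n%:R / (rho * 2 ^+ m).
Proof.
have p0 : 0 < 2 ^+ m :> R by rewrite exprn_gt0.
have := @count_interval R _ n u g0 gap (k%:R / 2 ^+ m) ((k%:R + 1) / 2 ^+ m).
rewrite ler_pM2r ?invr_gt0 // lerDl ler01 => /(_ isT).
have -> : ((k%:R + 1) / 2 ^+ m - k%:R / 2 ^+ m) / (rho / n%:R) = n%:R / (rho * 2 ^+ m).
  by field; rewrite ?lt0r_neq0 // ltr0n.
apply: le_trans; rewrite le_eqVlt; apply/orP; left; apply/eqP; apply: eq_bigr => l _.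
congr ((nat_of_bool _)%:R); congr (_ && _).
  by rewrite ltr_pdivrMr // subr_gt0 mulrC.
by rewrite ltr_pdivlMr // ltrBlDl mulrC addrC.
Qed.

Lemma lattice_cell_uniq m k l l' : n%:R <= rho * 2 ^+ m -> (l < n)%N -> (l' < n)%N ->
  0 < 2 ^+ m * u l - k%:R < 1 -> 0 < 2 ^+ m * u l' - k%:R < 1 -> l = l'.
Proof.
move=> hm ln l'n /andP[h1 h2] /andP[h3 h4].
have p0 : 0 < 2 ^+ m :> R by rewrite exprn_gt0.
apply: (lattice_inj g0 gap ln l'n).
have : 2 ^+ m * `|u l - u l'| < 1.
  by rewrite -{1}(gtr0_norm p0) -normrM mulrBr ltr_norml; apply/andP; split; lra.
move=> h; rewrite ltr_pdivlMr ?ltr0n //.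
have : `|u l - u l'| * n%:R <= `|u l - u l'| * (rho * 2 ^+ m) by rewrite ler_wpM2l.
move/le_lt_trans; apply; rewrite mulrCA -[ltRHS]mulr1 ltr_pM2l // mulrC //.
Qed.

(* Level 0 carries (1 - t) x and level j + 1 the tents of scale 2^-j.  From the
   first m with 2^-m at most the lattice gap on, a dyadic cell contains at most
   one lattice point, so the whole remainder of the expansion fits in level m + 1
   as a combination of indicators of lattice points. *)
Lemma hinge_system : exists (M : nat) (c phi : nat -> nat -> R -> R),
  [/\ forall M' l t, (M <= M')%N -> (l < n)%N -> 0 <= t <= 1 -> Num.max (u l - t) 0 =
        \sum_(j < M') \sum_(k < A * 2 ^ j) c j k t * phi j k (u l),
      forall j t, 0 <= t <= 1 -> \sum_(k < A * 2 ^ j) `|c j k t| <= 1,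
      forall j k, \sum_(l < n) phi j k (u l) ^+ 2 <= (8 + 16 / rho) * n%:R * 8 ^- j,
      forall k x, phi 0%N k x = x & forall j k, c j.+1 k 0 = 0].
Proof.
have [m [hm m_min]] := finest_level.
pose c (j k : nat) (t : R) : R := if j isn't i.+1 then (k == 0)%N%:R * (1 - t) else
  if (i < m)%N then tent (2 ^+ i * t - k%:R) else if i == m then
   (k < n)%N%:R * \sum_(q < 2 ^ m) bridge (2 ^+ m * t - q%:R) (2 ^+ m * u k - q%:R) else 0.
pose phi (j k : nat) (x : R) : R := if j isn't i.+1 then x else
  if (i < m)%N then - (2 ^- i * tent (2 ^+ i * x - k%:R)) else
  if i == m then - (2 ^- m * (x == u k)%:R) else 0.
have uinj l l' : (l < n)%N -> (l' < n)%N -> u l = u l' -> l = l'.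
  by move=> h1 h2 e; apply: (lattice_inj g0 gap h1 h2); rewrite e subrr normr0.
have p0 j : 0 < 2 ^+ j :> R by rewrite exprn_gt0.
have tent_far (j k : nat) (t : R) : 0 <= t <= 1 -> (2 ^ j <= k)%N -> tent (2 ^+ j * t - k%:R) = 0 :> R.
  move=> /andP[t0 t1] jk; apply: tent_out; rewrite negb_and; apply/orP; left.
  rewrite -leNgt subr_le0 (@le_trans _ _ (2 ^+ j)) //; last by rewrite -natrX ler_nat.
  by rewrite ler_piMr // ltW.
(* Room for the [n] indicators at level [m + 1]; this is the purpose of [rho <= A]. *)
have nA : (n <= A * 2 ^ m.+1)%N.
  rewrite -(ler_nat R) natrM natrX (le_trans hm) // (@le_trans _ _ (A%:R * 2 ^+ m)) //.
    by rewrite ler_pM2r.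
  by rewrite ler_wpM2l // exprS ler_peMl ?ler1n // ltW.
exists m.+2, c, phi; split.
- move=> M' l t MM' ln t01 /=; have ul := u01 ln.
  rewrite hinge_bridge // (bridge_expand m).
  have -> : \sum_(j < M') \sum_(k < A * 2 ^ j) c j k t * phi j k (u l) =
    \sum_(j < m.+2) \sum_(k < A * 2 ^ j) c j k t * phi j k (u l).
    rewrite -!(big_mkord xpredT (fun j => \sum_(k < A * 2 ^ j) c j k t * phi j k (u l))).
    rewrite (@big_cat_nat _ _ _ m.+2) //= [X in _ + X]big1_seq ?addr0 // => -[|j];
      rewrite mem_index_iota => /andP[_ /andP[mj _]] //; apply: big1 => k _; rewrite /c /=.
    by rewrite ltnNge (ltnW (mj : (m < j)%N)) /= gtn_eqF // mul0r.
  rewrite big_ord_recr /= big_ord_recl /= opprD addrA; congr (_ + _ + _).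
  + rewrite expn0 muln1 -(prednK A0) big_ord_recl /= mul1r big1 ?addr0 // => k _.
    by rewrite !mul0r.
  + rewrite -sumrN; apply: eq_bigr => j _; rewrite /bump leq0n add1n /= ltn_ord.
    rewrite -(big_mkord xpredT (fun k => tent (2 ^+ j * t - k%:R) * (2 ^- j * tent (2 ^+ j * u l - k%:R)))).
    rewrite -(big_mkord xpredT (fun k => tent (2 ^+ j * t - k%:R) * - (2 ^- j * tent (2 ^+ j * u l - k%:R)))).
    rewrite [RHS](@big_cat_nat _ _ _ (2 ^ j)%N) //=; last first.
      by rewrite (leq_trans _ (leq_pmull _ A0)) // leq_exp2l.
    rewrite [X in _ = _ + X]big1_seq ?addr0; last first.
      by move=> k; rewrite mem_index_iota => /andP[_ /andP[jk _]]; rewrite (tent_far j k t) // mul0r.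
    by rewrite -sumrN; apply: eq_bigr => k _; rewrite mulrN.
  + rewrite ltnn eqxx (bigD1 (Ordinal (leq_trans ln nA))) //= ln eqxx mul1r mulr1.
    rewrite [X in _ = _ + X]big1 ?addr0; first by rewrite -mulr_sumr mulrN mulrC.
    move=> k kl; case: (ltnP k n) => kn; last by rewrite !mul0r.
    rewrite (_ : (u l == u k) = false) ?mulr0 ?oppr0 ?mulr0 //.
    by apply: contraNF kl => /eqP /(uinj _ _ ln kn) e; apply/eqP/val_inj.
- move=> [|j] t t01.
  + apply: sum_le_at_most_one => //.
    * by move=> k _; rewrite /c /= normrM normr_nat; case: (k == 0 :> nat); rewrite ?mul0r // mul1r ger0_norm; lra.
    * move=> k k' _ _; rewrite /c /=.
      case: (nat_of_ord k =P 0%N) => [e _|_]; last by rewrite mul0r normr0 eqxx.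
      case: (nat_of_ord k' =P 0%N) => [e' _|_]; last by rewrite mul0r normr0 eqxx.
      by apply/val_inj; rewrite /= e e'.
  rewrite /c /=; case: (ltnP j m) => jm /=.
    apply: sum_le_at_most_one => //.
    * move=> k _; rewrite ger0_norm ?tent_ge0 // (le_trans (tent_le _)) //; lra.
    * move=> k k' _ _.
      have [h _|/tent_out->] := boolP (0 < 2 ^+ j * t - k%:R < 1); last by rewrite normr0 eqxx.
      have [h' _|/tent_out->] := boolP (0 < 2 ^+ j * t - k'%:R < 1); last by rewrite normr0 eqxx.
      by apply/val_inj; exact: unit_cell_uniq h h'.
  case: (j =P m) => [jE|_] /=; last by rewrite big1 // => *; rewrite normr0.
  (* Flattened to pairs of a lattice point and a cell: [t] determines the cell, and the cell holds
     at most one lattice point, so at most one term survives. *)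
  rewrite (_ : \sum_(k < _) _ = \sum_(p : 'I_(A * 2 ^ j.+1) * 'I_(2 ^ m)) (p.1 < n)%N%:R *
     bridge (2 ^+ m * t - p.2%:R) (2 ^+ m * u p.1 - p.2%:R)); last first.
    rewrite -(pair_bigA _ (fun (p : 'I_(A * 2 ^ j.+1)) (q : 'I_(2 ^ m)) => (p < n)%N%:R * bridge (2 ^+ m * t - q%:R) (2 ^+ m * u p - q%:R))) /=.
    apply: eq_bigr => k _; rewrite ger0_norm; first by rewrite mulr_sumr.
    rewrite mulr_ge0 //.
    by apply: sumr_ge0 => *; exact: bridge_ge0.
  apply: sum_le_at_most_one => // [[k q] _|[k q] [k' q'] _ _] /=.
    by case: (k < n)%N; rewrite ?mul0r // mul1r bridge_le.
  have [kn|] := boolP (k < n)%N; last by rewrite mul0r eqxx.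
  have [k'n|] := boolP (k' < n)%N; last by rewrite mul0r eqxx.
  rewrite !mul1r.
  have [/andP[h1 h2] _|/bridge_out->] :=
    boolP ((0 < 2 ^+ m * t - q%:R < 1) && (0 < 2 ^+ m * u k - q%:R < 1)); last by rewrite eqxx.
  have [/andP[h3 h4] _|/bridge_out->] :=
    boolP ((0 < 2 ^+ m * t - q'%:R < 1) && (0 < 2 ^+ m * u k' - q'%:R < 1)); last by rewrite eqxx.
  have qq' : q = q' by apply/val_inj; exact: unit_cell_uniq h1 h3.
  subst q'; congr (_, _); apply/val_inj.
  exact: (lattice_cell_uniq hm kn k'n h2 h4).
- have n1 : 1 <= n%:R :> R by rewrite ler1n.
  have r16 : 0 <= 16 / rho by rewrite divr_ge0 // ltW.
  move=> [|j] k; rewrite /phi /=.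
    rewrite expr0 invr1 mulr1 (@le_trans _ _ (\sum_(l < n) 1)) //.
      apply: ler_sum => l _; have /andP[h1 h2] := u01 (ltn_ord l).
      by rewrite -(expr1n _ 2) ler_pXn2r // nnegrE.
    by rewrite sumr_const card_ord -[leLHS]mul1r ler_pM2r ?ltr0n //; lra.
  case: (ltnP j m) => [jm|_] /=.
    have jn : rho * 2 ^+ j < n%:R by case: m_min => [m0|]; [rewrite m0 in jm|apply].
    have p1 : 0 < rho * 2 ^+ j by rewrite mulr_gt0.
    apply: (@le_trans _ _ (\sum_(l < n) (4 ^- j * 4^-1) * ((0 < 2 ^+ j * u l - k%:R < 1)%R : nat)%:R)).
      apply: ler_sum => l _; rewrite sqrrN exprMn.
      have -> : 2 ^- j ^+ 2 = 4 ^- j :> R by rewrite exprVn -exprM mulnC exprM -natrX.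
      rewrite -mulrA ler_wpM2l // ?invr_ge0 ?exprn_ge0 //.
      have [h|/tent_out->] := boolP (0 < 2 ^+ j * u l - k%:R < 1); last by rewrite expr0n mulr0.
      rewrite mulr1 (_ : 4^-1 = 2^-1 ^+ 2); last by rewrite exprVn -natrX.
      by rewrite ler_pXn2r ?nnegrE ?tent_ge0 ?tent_le.
    have q0 : 0 <= 4 ^- j / 4 :> R by rewrite mulr_ge0 ?invr_ge0 ?exprn_ge0.
    rewrite -mulr_sumr; apply: (le_trans (ler_wpM2l q0 (card_lattice_cell j k))).
    have e : n%:R / (rho * 2 ^+ j) = (n%:R * rho^-1) * 2 ^- j by field; rewrite !lt0r_neq0.
    (* Below the finest level [n / (rho 2^j)] exceeds 1 and absorbs the additive one of the
       count. *)
    have : 1 + n%:R / (rho * 2 ^+ j) <= 2 * (n%:R / (rho * 2 ^+ j)).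
      by rewrite mulr2n mulrDl mul1r lerD2r ler_pdivlMr // mul1r ltW.
    move=> h; apply: (le_trans (ler_wpM2l q0 h)).
    rewrite e.
    have -> : 4 ^- j / 4 * (2 * (n%:R / rho * 2 ^- j)) = (4 / rho * n%:R) * 8 ^- j.+1 :> R.
      rewrite exprS invfM (_ : 8 ^- j = 4 ^- j * 2 ^- j :> R); last first.
        by rewrite -!exprVn -exprMn -invfM; congr (_^-1 ^+ _); ring.
      by field; rewrite !expf_neq0 ?(lt0r_neq0 rho0) ?pnatr_eq0.
    rewrite ler_pM2r ?invr_gt0 ?exprn_gt0 // ler_pM2r ?ltr0n //.
    have : 4 / rho <= 16 / rho by rewrite ler_pM2r ?invr_gt0 // ler_nat.
    by lra.
  case: (j =P m) => [jE|_] /=; last first.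
    rewrite big1; first by rewrite !mulr_ge0 ?invr_ge0 ?exprn_ge0 //; lra.
    by move=> l _; rewrite expr0n.
  rewrite (@le_trans _ _ (4 ^- m)) //.
    apply: sum_le_at_most_one; first by rewrite invr_ge0 exprn_ge0.
      move=> l _; rewrite sqrrN exprMn.
      have -> : 2 ^- m ^+ 2 = 4 ^- m :> R by rewrite exprVn -exprM mulnC exprM -natrX.
      by rewrite -[leRHS]mulr1 ler_wpM2l ?invr_ge0 ?exprn_ge0 //; case: (_ == _); rewrite ?expr1n ?expr0n.
    move=> l l' _ _; case: (u l =P u k) => [e _|_]; last by rewrite mulr0 oppr0 expr0n eqxx.
    case: (u l' =P u k) => [e' _|_]; last by rewrite mulr0 oppr0 expr0n eqxx.
    by apply/val_inj/uinj => //=; rewrite e e'.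
  (* Here the constant is decided: [2 ^+ m] is at most [n] if [m = 0], which the summand [8] covers,
     and otherwise below [2 n / rho] by minimality, which [16 / rho] covers. *)
  have -> : 4 ^- m = 8 ^- m * 2 ^+ m :> R.
    rewrite (_ : 8 ^- m = 4 ^- m * 2 ^- m) ?mulfVK ?lt0r_neq0 //.
    by rewrite -invfM -exprMn -natrM.
  have -> : (8 + 16 / rho) * n%:R * 8 ^- j.+1 = 8 ^- m * (n%:R + 2 * (n%:R / rho)) :> R.
    by rewrite jE exprS; field; rewrite (lt0r_neq0 rho0) expf_neq0 ?pnatr_eq0.
  rewrite ler_pM2l ?invr_gt0 ?exprn_gt0 //.
  have nr0 : 0 <= n%:R / rho by rewrite divr_ge0 // ltW.
  case: m_min => [->|m_min]; first by rewrite expr0; lra.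
  case: {jE hm nA c phi p0} m m_min => [|i] hi.
    by rewrite expr0; lra.
  rewrite exprS; have : 2 ^+ i < n%:R / rho by rewrite ltr_pdivlMr // mulrC hi.
  by lra.
- by [].
- move=> j k; rewrite /c mulr0 sub0r; case: ifP => jm.
    by apply: tent_out; rewrite negb_and -leNgt oppr_le0 ler0n.
  case: ifP => // _; rewrite big1 ?mulr0 // => q _; apply: bridge_out.
  by rewrite ?mulr0 sub0r !negb_and -leNgt oppr_le0 ler0n.
Qed.

End hinge_system.

(** * Level sums in tensor products *)

Section graded_product.
Context {R : realType}.

(** Each further factor is one convolution, with [l + 1] terms under a common bound; hence the power
    [m] for [m + 1] factors. *)
Lemma coef_prod_bound (m : nat) (Q : 'I_m.+1 -> {poly R}) (X Y : R) :
  0 <= X -> 0 <= Y -> (forall i j, 0 <= (Q i)`_j <= X * Y ^+ j) ->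
  forall l, 0 <= (\prod_i Q i)`_l <= l.+1%:R ^+ m * X ^+ m.+1 * Y ^+ l.
Proof.
move=> X0 Y0; elim: m Q => [|m IH] Q HQ l.
  by rewrite big_ord1 expr0 mul1r expr1; exact: HQ.
rewrite big_ord_recl coefM; have {}IH := IH (fun i => Q (lift ord0 i)) (fun i => HQ _).
apply/andP; split.
  apply: sumr_ge0 => i _; rewrite mulr_ge0 //; first by have /andP[] := HQ ord0 i.
  by have /andP[] := IH (l - i)%N.
apply: (@le_trans _ _ (\sum_(i < l.+1) l.+1%:R ^+ m * X ^+ m.+2 * Y ^+ l)); last first.
  rewrite sumr_const card_ord -[leLHS]mulr_natl !exprS; rewrite le_eqVlt; apply/orP; left; apply/eqP; ring.
apply: ler_sum => i _.
have /andP[h1 h2] := HQ ord0 i; have /andP[h3 h4] := IH (l - i)%N.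
apply: le_trans (ler_pM h1 h3 h2 h4) _.
have -> : X * Y ^+ i * ((l - i).+1%:R ^+ m * X ^+ m.+1 * Y ^+ (l - i)) =
    (l - i).+1%:R ^+ m * (X ^+ m.+2 * Y ^+ l).
  rewrite (_ : Y ^+ l = Y ^+ i * Y ^+ (l - i)) ?(exprS X m.+1); last by rewrite -exprD subnKC // -ltnS.
  by ring.
have q0 : 0 <= X ^+ m.+2 * Y ^+ l by rewrite mulr_ge0 ?exprn_ge0.
rewrite -mulrA; apply: ler_wpM2r q0 _ _ _.
by apply: lerXn2r; rewrite ?nnegrE ?ler0n // ler_nat ltnS leq_subr.
Qed.

(** Used twice on tensor systems graded by total level: with [Y = 1] for the [l^1] norms of the
    coefficients, and with [Y = 2] for the number of functions of a level, that is, the size of a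
    hyperbolic cross. *)
Lemma graded_product_bound (m : nat) (T : finType) (lv : T -> nat)
    (W : 'I_m.+1 -> T -> R) (X Y : R) :
  0 <= X -> 0 <= Y -> (forall i p, 0 <= W i p) ->
  (forall i j, \sum_(p | lv p == j) W i p <= X * Y ^+ j) ->
  forall l, \sum_(f : {ffun 'I_m.+1 -> T} | (\sum_i lv (f i) == l)%N) \prod_i W i (f i)
     <= l.+1%:R ^+ m * X ^+ m.+1 * Y ^+ l.
Proof.
move=> X0 Y0 W0 HW l.
(* The left-hand side is a coefficient of a product of generating polynomials. *)
pose Q i : {poly R} := \sum_p (W i p) *: 'X^(lv p).
have QE i j : (Q i)`_j = \sum_(p | lv p == j) W i p.
  rewrite coef_sum [RHS]big_mkcond; apply: eq_bigr => p _.
  by rewrite coefZ coefXn eq_sym; case: eqP; rewrite ?mulr1 ?mulr0.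
have := @coef_prod_bound m Q X Y X0 Y0 _ l.
rewrite /Q bigA_distr_bigA coef_sum => H.
have {H}/andP[_] : 0 <= \sum_(f : {ffun 'I_m.+1 -> T}) (\prod_i (W i (f i) *: 'X^(lv (f i))))`_l
    <= l.+1%:R ^+ m * X ^+ m.+1 * Y ^+ l.
  by apply: H => i j; rewrite QE HW andbT sumr_ge0.
apply: le_trans; rewrite [leLHS]big_mkcond; rewrite le_eqVlt; apply/orP; left; apply/eqP/eq_bigr => f _.
have -> : \prod_i (W i (f i) *: 'X^(lv (f i))) =
    (\prod_i W i (f i)) *: 'X^(\sum_i lv (f i))%N :> {poly R}.
  by rewrite scaler_prod; congr (_ *: _); rewrite -prodrXr.
by rewrite coefZ coefXn eq_sym; case: eqP; rewrite ?mulr1 ?mulr0.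
Qed.

End graded_product.

(** * Orthonormal families and projections in Euclidean space *)

Section orthonormalization.
Context {R : realType} {n : nat}.
Implicit Types (v w e : 'I_n -> R) (vs es : seq ('I_n -> R)).

Definition dot v w : R := \sum_i v i * w i.

(** Meaningful for any family, but the orthogonal projection onto the span only when [es] is
    orthonormal. *)
Definition proj es v : 'I_n -> R := fun i => \sum_(e <- es) dot v e * e i.

Lemma dotC v w : dot v w = dot w v.
Proof. by apply: eq_bigr => i _; rewrite mulrC. Qed.

Lemma dotBl v v' w : dot (fun i => v i - v' i) w = dot v w - dot v' w.
Proof. by rewrite /dot -sumrB; apply: eq_bigr => i _; rewrite mulrBl. Qed.

Lemma dotDl v v' w : dot (fun i => v i + v' i) w = dot v w + dot v' w.
Proof. by rewrite /dot -big_split; apply: eq_bigr => i _; rewrite mulrDl. Qed.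

Lemma dotZl a v w : dot (fun i => a * v i) w = a * dot v w.
Proof. by rewrite /dot mulr_sumr; apply: eq_bigr => i _; rewrite mulrA. Qed.

Lemma dot_suml (I : Type) (s : seq I) (P : pred I) (F : I -> 'I_n -> R) w :
  dot (fun i => \sum_(k <- s | P k) F k i) w = \sum_(k <- s | P k) dot (F k) w.
Proof.
by rewrite /dot exchange_big; apply: eq_bigr => i _; rewrite mulr_suml.
Qed.

Lemma dot_proj es v w : dot (proj es v) w = \sum_(e <- es) dot v e * dot e w.
Proof. by rewrite dot_suml; apply: eq_bigr => e _; rewrite dotZl. Qed.

Lemma dot_ge0 v : 0 <= dot v v.
Proof. by apply: sumr_ge0 => i _; rewrite -expr2 sqr_ge0. Qed.

Lemma dot_eq0 v : dot v v = 0 -> forall i, v i = 0.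
Proof.
move=> /eqP; rewrite psumr_eq0 => [/allP h i|i _]; last by rewrite -expr2 sqr_ge0.
by have := h i; rewrite mem_index_enum mulf_eq0 orbb => /(_ isT)/implyP/(_ isT)/eqP.
Qed.

(** The matrix of [v - proj es v] is symmetric for any [es]. This moves the residual onto the noise,
    after which the pairing is visibly linear in the other argument. *)
Lemma dot_res_sym es v w :
  dot (fun i => v i - proj es v i) w = dot v (fun i => w i - proj es w i).
Proof.
rewrite [RHS]dotC !dotBl !dot_proj (dotC w v); congr (_ - _).
by apply: eq_bigr => e _; rewrite mulrC (dotC w) (dotC v).
Qed.

(** Gram-Schmidt, skipping vectors already in the span. Orthogonality is recorded only through its
    consequences: vectors of [vs] are reproduced, and Pythagoras holds for the residual. *)
Lemma orthonormalization vs : exists es,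
  [/\ (size es <= size vs)%N,
      {in es, forall e, dot e e = 1},
      forall v, v \in vs -> proj es v = v &
      forall v, let r := fun i => v i - proj es v i in
         dot r r = dot v v - \sum_(e <- es) dot v e ^+ 2].
Proof.
(* The extra clause says that residuals are orthogonal to [es]; the induction needs it to append a
   new direction. *)
suff [es [h1 h2 h3 h4 _]] : exists es,
    [/\ (size es <= size vs)%N, {in es, forall e, dot e e = 1},
      forall v, v \in vs -> proj es v = v,
      forall v, let r := fun i => v i - proj es v i in
         dot r r = dot v v - \sum_(e <- es) dot v e ^+ 2 &
      forall v e, e \in es -> dot (proj es v) e = dot v e].
  by exists es.
elim: vs => [|v vs [es [hs hu hp hb ho]]].
  exists [::]; split => // v /=; rewrite big_nil subr0.
  by apply: eq_bigr => i _; rewrite /proj big_nil subr0.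
pose w i := v i - proj es v i.
have [w0|wn0] := eqVneq (dot w w) 0.
  exists es; split => //; first exact: leq_trans hs (leqnSn _).
  move=> x; rewrite inE => /predU1P[->|/hp//]; apply/funext => i.
  by have /(_ i)/eqP := dot_eq0 w0; rewrite subr_eq0 eq_sym => /eqP.
have wp : 0 < dot w w by rewrite lt_def wn0 dot_ge0.
pose c := (Num.sqrt (dot w w))^-1.
have c0 : c != 0 by rewrite invr_eq0 sqrtr_eq0 -ltNge.
have cc : c * (c * dot w w) = 1.
  rewrite mulrA -invfM -expr2 sqr_sqrtr ?ltW // mulVf //.
pose u i := c * w i.
have uu : dot u u = 1 by rewrite dotZl dotC dotZl.
have eu e : e \in es -> dot e u = 0.
  by move=> he; rewrite dotC dotZl dotBl ho // subrr mulr0.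
have pu x : dot (proj es x) u = 0.
  by rewrite dot_proj big1_seq // => e /andP[_ /eu->]; rewrite mulr0.
have projE x i : proj (u :: es) x i = dot x u * u i + proj es x i by rewrite /proj big_cons.
exists (u :: es); split.
- by rewrite /= ltnS.
- by move=> e; rewrite inE => /predU1P[->|/hu].
- move=> x; rewrite inE => /predU1P[->|xvs]; apply/funext => i; rewrite projE.
    have -> : dot v u = c * dot w w.
      have -> : dot w w = dot v w.
        rewrite {1}/w dotBl (_ : dot (proj es v) w = 0) ?subr0 //.
        by have /eqP := pu v; rewrite dotC dotZl mulf_eq0 (negPf c0) /= dotC => /eqP.
      by rewrite dotC dotZl dotC.
    rewrite (_ : c * dot w w * u i = c * (c * dot w w) * w i); last by rewrite /u; ring.
    by rewrite cc mul1r /w subrK.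
  by rewrite -{1}(hp x xvs) pu mul0r add0r hp.
- move=> x /=.
  have -> : dot (fun i => x i - proj (u :: es) x i) (fun i => x i - proj (u :: es) x i) =
      dot (fun i => (x i - proj es x i) - dot x u * u i) (fun i => (x i - proj es x i) - dot x u * u i).
    by apply: eq_bigr => i _; rewrite projE; congr (_ * _); ring.
  have key (A : 'I_n -> R) (a : R) : dot (fun i => A i - a * u i) (fun i => A i - a * u i) =
      dot A A - 2 * a * dot A u + a ^+ 2 * dot u u.
    by rewrite /dot !mulr_sumr -sumrB -big_split /=; apply: eq_bigr => i _; ring.
  by rewrite big_cons key uu hb dotBl pu; ring.
- move=> x e; have -> : proj (u :: es) x = (fun i => dot x u * u i + proj es x i).
    by apply/funext => i; exact: projE.
  rewrite inE dotDl dotZl => /predU1P[->|he]; first by rewrite uu pu mulr1 addr0.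
  by rewrite (dotC u) (eu e he) mulr0 add0r ho.
Qed.

End orthonormalization.

(** * Integration against signed measures *)

Section charge_integral.
Context d (T : measurableType d) (R : realType).
Implicit Types (nu : {charge set T -> \bar R}) (D A Z : set T) (F G : T -> R).

Definition bounded_on D F : Prop :=
  measurable_fun setT F /\ exists B, forall t, D t -> `|F t| <= B.

Lemma bounded_on_integrable (mu : {finite_measure set T -> \bar R}) D F :
  measurable D -> bounded_on D F -> mu.-integrable D (EFin \o F).
Proof.
move=> mD [mF [B HB]]; apply: measurable_bounded_integrable => //.
- by rewrite ltey_eq fin_num_measure.
- exact: measurable_funTS.
- by exists B; split; [exact: num_real|move=> M BM t Dt; exact: le_trans (HB t Dt) (ltW BM)].
Qed.

Lemma bounded_onD D F G : bounded_on D F -> bounded_on D G ->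
  bounded_on D (fun t => F t + G t).
Proof.
move=> [mF [B HB]] [mG [C HC]]; split; first exact: measurable_funD.
by exists (B + C) => t Dt; rewrite (le_trans (ler_normD _ _)) // lerD ?HB ?HC.
Qed.

Lemma bounded_onZ D F r : bounded_on D F -> bounded_on D (fun t => r * F t).
Proof.
move=> [mF [B HB]]; split; first exact: measurable_funM.
by exists (`|r| * B) => t Dt; rewrite normrM ler_wpM2l // HB.
Qed.

Lemma bounded_on_cst D r : bounded_on D (fun=> r).
Proof. by split => //; exists `|r|. Qed.

Lemma bounded_on_sum D (I : Type) (s : seq I) (P : pred I) (F : I -> T -> R) :
  (forall i, P i -> bounded_on D (F i)) -> bounded_on D (fun t => \sum_(i <- s | P i) F i t).
Proof.
move=> HF; elim: s => [|i s IH].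
  by under eq_fun do rewrite big_nil; exact: bounded_on_cst.
under eq_fun do rewrite big_cons.
by case: (boolP (P i)) => // Pi; apply: bounded_onD => //; exact: HF.
Qed.

Lemma charge_RintegralD nu D F G : measurable D -> bounded_on D F -> bounded_on D G ->
  charge_Rintegral nu D (fun t => F t + G t) = charge_Rintegral nu D F + charge_Rintegral nu D G.
Proof.
move=> mD bF bG; rewrite /charge_Rintegral !RintegralD //; try exact: bounded_on_integrable.
by ring.
Qed.

Lemma charge_RintegralZ nu D F r : measurable D -> bounded_on D F ->
  charge_Rintegral nu D (fun t => r * F t) = r * charge_Rintegral nu D F.
Proof.
move=> mD bF; rewrite /charge_Rintegral !RintegralZl //; try exact: bounded_on_integrable.
by ring.
Qed.

Lemma charge_Rintegral_sum nu D (I : Type) (s : seq I) (P : pred I) (F : I -> T -> R) :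
  measurable D -> (forall i, P i -> bounded_on D (F i)) ->
  charge_Rintegral nu D (fun t => \sum_(i <- s | P i) F i t) =
  \sum_(i <- s | P i) charge_Rintegral nu D (F i).
Proof.
move=> mD HF; elim: s => [|i s IH].
  under eq_fun do rewrite big_nil.
  rewrite big_nil (_ : (fun=> 0) = (fun _ : T => 0 * 0)); last by apply/funext => ?; rewrite mul0r.
  by rewrite charge_RintegralZ ?mul0r //; exact: bounded_on_cst.
rewrite big_cons; under eq_fun do rewrite big_cons.
case: (boolP (P i)) => // Pi; rewrite charge_RintegralD ?IH //; first exact: HF.
exact: bounded_on_sum.
Qed.

Lemma eq_charge_Rintegral nu D F G : (forall t, D t -> F t = G t) ->
  charge_Rintegral nu D F = charge_Rintegral nu D G.
Proof.
by move=> FG; rewrite /charge_Rintegral; congr (_ - _); apply: eq_Rintegral => t /set_mem/FG.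
Qed.

Lemma Rintegral_vanish (mu : {measure set T -> \bar R}) D Z F :
  (forall t, D t -> Z t -> F t = 0) -> Rintegral mu D F = Rintegral mu (D `\` Z) F.
Proof.
move=> F0; rewrite [LHS]Rintegral_mkcond [RHS]Rintegral_mkcond; apply: eq_Rintegral => t _.
rewrite /patch; case: (boolP (t \in D)) => [/set_mem Dt|/negP nDt].
  case: (boolP (t \in D `\` Z)) => [//|/negP h]; apply: F0 => //.
  by apply: contrapT => nZ; apply: h; apply: mem_set.
by rewrite ifF //; apply/negP => /set_mem[/mem_set].
Qed.

(** The two Jordan parts are bounded separately on [D] minus [Z], where the integrand lives. With
    [Z] the origin, this is how a bound on the complexity, blind to mass at the origin, controls an
    integral. *)
Lemma le_total_variation_charge_Rintegral nu D Z F B :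
  measurable D -> measurable Z -> bounded_on D F -> 0 <= B ->
  (forall t, D t -> Z t -> F t = 0) -> (forall t, D t -> `|F t| <= B) ->
  `|charge_Rintegral nu D F| <= B * fine (Defs.total_variation nu (D `\` Z)).
Proof.
move=> mD mZ bF B0 F0 FB.
have mDZ : measurable (D `\` Z) by exact: measurableD.
have bF' : bounded_on (D `\` Z) F by case: bF => mF _; split => //; exists B => t [/FB].
have H (mu : {finite_measure set T -> \bar R}) : `|Rintegral mu D F| <= B * fine (mu (D `\` Z)).
  rewrite (Rintegral_vanish _ F0); apply: le_trans (le_normr_Rintegral mDZ _) _.
    exact: bounded_on_integrable.
  rewrite -Rintegral_cst //; apply: le_Rintegral => //; last by move=> t [/FB].
    apply: bounded_on_integrable => //; case: bF' => mF [C HC]; split.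
      exact: measurableT_comp.
    by exists C => t /HC; rewrite normr_id.
  by apply: bounded_on_integrable => //; exact: bounded_on_cst.
rewrite /charge_Rintegral /Defs.total_variation /charge_variation fineD ?fin_num_measure //.
by rewrite mulrDr; apply: le_trans (ler_normB _ _) _; apply: lerD; exact: H.
Qed.

Lemma total_variationE nu A : measurable A ->
  Defs.total_variation nu A = (nu (A `&` hahn_pos nu) - nu (A `&` hahn_neg nu))%E.
Proof.
move=> mA; rewrite /Defs.total_variation /charge_variation /= jordan_posE jordan_negE.
by rewrite cjordan_posE cjordan_negE /crestr0 mem_set.
Qed.

Lemma hahn_measurable nu : measurable (hahn_pos nu) /\ measurable (hahn_neg nu).
Proof. by have [[mP _] [mN _] _ _] := hahn_pos_neg nu. Qed.

(** The two charges carry independently chosen Hahn sets. The variation of [nu] is evaluated on its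
    own pieces, and on each piece the value of [nu'] is at most its variation. *)
Lemma total_variation_eq nu nu' : (forall A, measurable A -> nu A = nu' A) ->
  forall A, measurable A -> (Defs.total_variation nu A <= Defs.total_variation nu' A)%E.
Proof.
move=> e A mA; have [mP mN] := hahn_measurable nu; have [mP' mN'] := hahn_measurable nu'.
rewrite total_variationE // !e; try exact: measurableI.
have disj : A `&` hahn_pos nu `&` (A `&` hahn_neg nu) = set0.
  by have [_ _ _ h] := hahn_pos_neg nu; rewrite setIACA h setI0.
have tvP := @abse_charge_variation _ _ _ _ _ _ (hahn_pos_neg nu').
apply: (@le_trans _ _ (Defs.total_variation nu' (A `&` hahn_pos nu) + Defs.total_variation nu' (A `&` hahn_neg nu))%E).
  apply: leeD.
    by rewrite (le_trans (lee_abs _)) //; apply: tvP; exact: measurableI.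
  by rewrite (le_trans (lee_abs _)) // abseN; apply: tvP; exact: measurableI.
rewrite /Defs.total_variation -measureU //; try exact: measurableI.
apply: le_measure; rewrite ?inE //; last by move=> t [[]|[]].
by apply: measurableU; exact: measurableI.
Qed.

(** Jordan parts are not additive, since positive and negative mass may cancel. What survives is an
    identity between sums of positive measures, the negative parts being moved across, and this can
    be integrated. *)
Lemma Rintegral_balance (m1 m2 m3 m4 m5 m6 : {finite_measure set T -> \bar R}) D F :
  measurable D -> bounded_on D F -> (forall t, D t -> 0 <= F t) ->
  (forall A, measurable A -> m1 A + m2 A + m3 A = m4 A + m5 A + m6 A)%E ->
  Rintegral m1 D F + Rintegral m2 D F + Rintegral m3 D F =
  Rintegral m4 D F + Rintegral m5 D F + Rintegral m6 D F.
Proof.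
move=> mD bF F0 e.
have mF : measurable_fun D (EFin \o F).
  by apply/measurable_EFinP/measurable_funTS; case: bF.
have fin (m : {finite_measure set T -> \bar R}) :
    (\int[m]_(x in D) (F x)%:E)%E = (Rintegral m D F)%:E.
  by rewrite fineK //; apply: integrable_fin_num => //; exact: bounded_on_integrable.
have add (m m' m'' : {finite_measure set T -> \bar R}) :
    (Rintegral m D F + Rintegral m' D F + Rintegral m'' D F)%:E =
    (\int[measure_add (measure_add m m') m'']_(x in D) (F x)%:E)%E.
  by rewrite !ge0_integral_measure_add // !EFinD !fin.
apply: EFin_inj; rewrite !add.
apply: eq_measure_integral => A mA _.
rewrite -[LHS]/(measure_add (measure_add m1 m2) m3 A) -[RHS]/(measure_add (measure_add m4 m5) m6 A).
have E (m m' m'' : {finite_measure set T -> \bar R}) :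
    measure_add (measure_add m m') m'' A = (m A + m' A + m'' A)%E.
  by rewrite measure_addE -[X in (X + _)%E]/(measure_add m m' A) measure_addE.
by rewrite !E e.
Qed.

End charge_integral.

(** * Signed measures with finitely many atoms *)

Section discrete_charge.
Context d (T : measurableType d) (R : realType).
(** Atoms are added one at a time. The integral is updated by [Rintegral_balance], the sign of [w i]
    deciding on which side the new point mass is placed. *)
Lemma discrete_charge (I : Type) (s : seq I) (w : I -> R) (pt : I -> T) :
  exists nu : {charge set T -> \bar R},
    (forall A, measurable A -> nu A = (\sum_(i <- s) w i * \1_A (pt i))%:E) /\
    (forall D F, measurable D -> bounded_on D F -> (forall t, D t -> 0 <= F t) ->
       (forall i, D (pt i)) -> charge_Rintegral nu D F = \sum_(i <- s) w i * F (pt i)).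
Proof.
elim: s => [|i s [nu [nuE nuI]]].
  exists (charge_of_finite_measure (@mzero _ T R)).
  set nu0 := charge_of_finite_measure _.
  have E A : measurable A -> nu0 A = 0%E by [].
  split=> [A mA|D F mD bF F0 _]; first by rewrite big_nil.
  rewrite big_nil /charge_Rintegral.
  have H (m : {measure set T -> \bar R}) : (forall A, measurable A -> m A = 0%E) ->
     Rintegral m D F = 0.
    move=> m0; rewrite /Rintegral (eq_measure_integral (@mzero _ T R)).
      by rewrite integral_measure_zero.
    by move=> A mA _; rewrite m0.
  rewrite !H ?subr0 // => A mA.
    by rewrite -[LHS]/(jordan_neg (hahn_pos_neg nu0) A) jordan_negE cjordan_negE /crestr0 mem_set //; exact: oppe0.
  by rewrite -[LHS]/(jordan_pos (hahn_pos_neg nu0) A) jordan_posE cjordan_posE /crestr0 mem_set.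
pose del := charge_of_finite_measure (dirac (pt i) : {finite_measure set T -> \bar R}).
pose nu1 : {charge set T -> \bar R} := cadd nu (cscale (w i) del).
have nu1E A : measurable A -> nu1 A = (nu A + (w i * \1_A (pt i))%:E)%E.
  by move=> mA; rewrite -[LHS]/(nu A + (w i)%:E * \d_(pt i) A)%E diracE EFinM indicE.
exists nu1; split => [A mA|D F mD bF F0 Dpt].
  by rewrite nu1E // nuE // big_cons addrC EFinD.
rewrite big_cons -(nuI D F) //.
have wp : 0 <= `|w i| by [].
pose m : {finite_measure set T -> \bar R} := mscale (NngNum wp) (dirac (pt i)).
have mE A : measurable A -> m A = (`|w i| * \1_A (pt i))%:E.
  by move=> mA; rewrite -[LHS]/(`|w i|%:E * \d_(pt i) A)%E diracE EFinM indicE.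
have mI : Rintegral m D F = `|w i| * F (pt i).
  have mF : measurable_fun D (EFin \o F).
    by apply/measurable_EFinP/measurable_funTS; case: bF.
  have F0' t : D t -> (0 <= (EFin \o F) t)%E by move=> Dt; rewrite lee_fin F0.
  rewrite /Rintegral /m (ge0_integral_mscale _ mD _ mF F0') /= integral_dirac //.
  by rewrite diracE mem_set // mul1e.
pose p : {finite_measure set T -> \bar R} := jordan_pos (hahn_pos_neg nu).
pose q : {finite_measure set T -> \bar R} := jordan_neg (hahn_pos_neg nu).
pose p1 : {finite_measure set T -> \bar R} := jordan_pos (hahn_pos_neg nu1).
pose q1 : {finite_measure set T -> \bar R} := jordan_neg (hahn_pos_neg nu1).
have fin (m' : {finite_measure set T -> \bar R}) A : measurable A -> m' A = (fine (m' A))%:E.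
  by move=> mA; rewrite fineK // fin_num_measure.
have J A : measurable A -> fine (p1 A) - fine (q1 A) = fine (p A) - fine (q A) + w i * \1_A (pt i).
  move=> mA; have := nu1E A mA.
  rewrite (jordan_decomp (hahn_pos_neg nu1) mA) (jordan_decomp (hahn_pos_neg nu) mA).
  move=> H.
  have H' : (p1 A + (-1)%:E * q1 A = (p A + (-1)%:E * q A) + (w i * \1_A (pt i))%:E)%E by exact: H.
  by move: H'; rewrite !mulN1e (fin p1) // (fin q1) // (fin p) // (fin q) // => -[].
pose mz : {finite_measure set T -> \bar R} := @mzero _ T R.
have mz0 A : mz A = 0%:E by [].
have mzI : Rintegral mz D F = 0 by rewrite /Rintegral integral_measure_zero.
have [w0|w0] := leP 0 (w i).
  have : Rintegral p1 D F + Rintegral q D F + Rintegral mz D F =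
      Rintegral q1 D F + Rintegral p D F + Rintegral m D F.
    apply: Rintegral_balance => // A mA; have := J A mA.
    rewrite (mE A mA) (ger0_norm w0) (fin p1) // (fin q1) // (fin p) // (fin q) //.
    by rewrite (mz0 A) => h; congr EFin; lra.
  rewrite mI (ger0_norm w0) mzI.
  by rewrite /charge_Rintegral -/p -/q -/p1 -/q1; lra.
have : Rintegral p1 D F + Rintegral q D F + Rintegral m D F =
    Rintegral q1 D F + Rintegral p D F + Rintegral mz D F.
  apply: Rintegral_balance => // A mA; have := J A mA.
  rewrite (mE A mA) (ltr0_norm w0) (fin p1) // (fin q1) // (fin p) // (fin q) //.
  by rewrite (mz0 A) => h; congr EFin; lra.
rewrite mI (ltr0_norm w0) mzI.
by rewrite /charge_Rintegral -/p -/q -/p1 -/q1; lra.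
Qed.

End discrete_charge.

Section lower_integral.
Context d (T : measurableType d) (R : realType) (mu : {measure set T -> \bar R}).
Local Open Scope ereal_scope.

(* No measurability is required (the estimator need not depend measurably on the
   data): the integral of a nonnegative function is a supremum over the simple
   functions below it. *)
Lemma ge0_le_integral_nomeas (f g : T -> \bar R) :
  (forall x, 0 <= f x) -> (forall x, f x <= g x) ->
  \int[mu]_x f x <= \int[mu]_x g x.
Proof.
move=> f0 fg; rewrite !ge0_integralTE //; last by move=> x; exact: le_trans (fg x).
apply: le_ereal_sup => _ [h hf <-]; exists h => // x /=.
exact: le_trans (hf x) (fg x).
Qed.

End lower_integral.

(** * Means of products of independent variables *)

Section independence.
Context d (T : measurableType d) (R : realType) (P : probability T R).
Local Open Scope ereal_scope.
Import HBNNSimple.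

(** From indicators to nonnegative functions of [X], by simple functions and monotone convergence.
    An inequality is enough for bounds on moment generating functions, and it requires no
    integrability. *)
Lemma integral_mul_comp_le (W : T -> R) (X : {RV P >-> R}) (c : R) :
  measurable_fun setT W -> (forall w, 0 <= W w)%R -> (0 <= c)%R ->
  (forall B : set R, measurable B ->
     \int[P]_w (W w * \1_B (X w))%:E <= c%:E * P (X @^-1` B)) ->
  forall f : R -> R, measurable_fun setT f -> (forall x, 0 <= f x)%R ->
    \int[P]_w (W w * f (X w))%:E <= c%:E * \int[P]_w (f (X w))%:E.
Proof.
move=> mW W0 c0 HB f mf f0.
have mfE : measurable_fun setT (EFin \o f) by exact/measurable_EFinP.
pose g := nnsfun_approx measurableT mfE.
have fE0 x : setT x -> 0 <= (EFin \o f) x by rewrite lee_fin.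
have gnd x : {homo (fun n => g n x) : n m / (n <= m)%N >-> (n <= m)%R}.
  by move=> a b ab; exact/lefP/nd_nnsfun_approx.
have glim x : (g n x)%:E @[n --> \oo] --> (f x)%:E.
  exact: (cvg_nnsfun_approx measurableT mfE fE0).
have gle n x : (g n x)%:E <= (f x)%:E.
  by rewrite /g nnsfun_approxE; exact: (le_approx n fE0).
have mX : measurable_fun setT X by [].
have mgX n : measurable_fun setT (fun w => g n (X w)).
  by apply: measurableT_comp.
have mWg n : measurable_fun setT (fun w => (W w * g n (X w))%:E).
  by apply/measurable_EFinP; exact: measurable_funM.
have := @cvg_monotone_convergence _ _ _ P setT measurableT
  (fun n w => (W w * g n (X w))%:E) mWg.
have Wg0 n w : setT w -> 0 <= (W w * g n (X w))%:E by rewrite lee_fin mulr_ge0.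
move=> /(_ Wg0); rewrite (_ : (fun w => _) = fun w => (W w * f (X w))%:E); last first.
  apply/funext => w; apply/cvg_lim => //.
  under eq_fun do rewrite EFinM; rewrite EFinM.
  by apply: cvgeZl => //; exact: glim.
have Wnd w : setT w -> {homo (fun n => (W w * g n (X w))%:E) : n m / (n <= m)%N >-> n <= m}.
  by move=> _ a b ab; rewrite lee_fin ler_wpM2l // gnd.
move=> /(_ Wnd) cv; rewrite -(cvg_lim _ cv) //.
apply: lime_le; first by apply/cvg_ex; eexists; exact: cv.
apply: nearW => n.
apply: (@le_trans _ _ (c%:E * \int[P]_w (g n (X w))%:E)); last first.
  rewrite lee_wpmul2l ?lee_fin //.
  by apply: ge0_le_integral_nomeas => w //; rewrite lee_fin.
have fin : finite_set (range (g n)) by [].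
pose s : seq R := finmap.enum_fset (fset_set (range (g n))).
(* The values of [g n] are nonnegative; writing [|y|] makes each term nonnegative without carrying
   membership of [y] in the range. *)
have gE x : g n x = (\sum_(y <- s) `|y| * \1_(g n @^-1` [set y]) x)%R.
  rewrite {1}fimfunE fsbig_finite //=; apply: eq_big_seq => y.
  by rewrite in_fset_set // inE => -[z _ <-]; rewrite ger0_norm.
have mB y : measurable (g n @^-1` [set y]) by exact: measurable_funPTI.
have mI (B : set R) : measurable B -> measurable_fun setT (fun w => \1_B (X w) : R).
  by move=> mB'; apply: measurableT_comp => //; exact: measurable_indic.
have -> : \int[P]_w (W w * g n (X w))%:E =
    \sum_(y <- s) `|y|%:E * \int[P]_w (W w * \1_(g n @^-1` [set y]) (X w))%:E.
  transitivity (\int[P]_w \sum_(y <- s) (`|y|%:E * (W w * \1_(g n @^-1` [set y]) (X w))%:E)).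
    apply: eq_integral => w _; rewrite gE mulr_sumr -sumEFin; apply: eq_bigr => y _.
    by rewrite -EFinM mulrCA.
  rewrite ge0_integral_sum //.
  - apply: eq_bigr => y _; rewrite ge0_integralZl_EFin //.
    + by move=> w _; rewrite lee_fin mulr_ge0.
    + by apply/measurable_EFinP/measurable_funM => //; exact: mI.
  - move=> y; under eq_fun do rewrite -EFinM; apply/measurable_EFinP.
    by apply: measurable_funM => //; apply: measurable_funM => //; exact: mI.
  - by move=> y w _; rewrite lee_fin !mulr_ge0.
have -> : \int[P]_w (g n (X w))%:E =
    \sum_(y <- s) `|y|%:E * P (X @^-1` (g n @^-1` [set y])).
  transitivity (\int[P]_w \sum_(y <- s) (`|y|%:E * (\1_(g n @^-1` [set y]) (X w))%:E)).
    apply: eq_integral => w _; rewrite gE -sumEFin; apply: eq_bigr => y _.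
    by rewrite -EFinM.
  rewrite ge0_integral_sum //.
  - apply: eq_bigr => y _; rewrite ge0_integralZl_EFin //.
    + congr (_ * _); rewrite -[X in P X]setIT -integral_indic //; last first.
        by rewrite -[X in measurable X]setTI; exact: mX.
    + by apply/measurable_EFinP; exact: mI.
  - by move=> y; under eq_fun do rewrite -EFinM; apply/measurable_EFinP/measurable_funM => //; exact: mI.
rewrite ge0_sume_distrr; last by move=> y _; rewrite mule_ge0 // lee_fin.
apply: lee_sum => y _.
by rewrite muleCA lee_wpmul2l ?lee_fin //; exact: HB.
Qed.

Lemma independent_prod_le (n : nat) (xi : 'I_n -> {RV P >-> R})
    (f : 'I_n -> R -> R) (c : 'I_n -> R) :
  mutually_independent xi ->
  (forall i, measurable_fun setT (f i)) -> (forall i x, 0 <= f i x)%R ->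
  (forall i, 0 <= c i)%R -> (forall i, \int[P]_w (f i (xi i w))%:E <= (c i)%:E) ->
  \int[P]_w (\prod_i f i (xi i w))%:E <= (\prod_i c i)%:E.
Proof.
move=> ind mf f0 c0 fc.
(* Indicators are replaced by the [f i] one factor at a time. *)
pose g (k : nat) (B : 'I_n -> set R) (i : 'I_n) (x : R) : R :=
  if (i < k)%N then f i x else \1_(B i) x.
pose b (k : nat) (B : 'I_n -> set R) (i : 'I_n) : R :=
  if (i < k)%N then c i else fine (P (xi i @^-1` B i)).
have g0 k B i x : (0 <= g k B i x)%R by rewrite /g; case: ifP.
have b0 k B i : (0 <= b k B i)%R by rewrite /b; case: ifP => // _; exact: fine_ge0.
have mg k B i : (forall j, measurable (B j)) -> measurable_fun setT (g k B i).
  by move=> mB; rewrite /g; case: (i < k)%N => //; exact: measurable_indic.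
have mxi i (A : set R) : measurable A -> measurable (xi i @^-1` A).
  by move=> mA; rewrite -[X in measurable X]setTI; exact: (measurable_funP (xi i)).
suff H k : (k <= n)%N -> forall B : 'I_n -> set R, (forall j, measurable (B j)) ->
    \int[P]_w (\prod_i g k B i (xi i w))%:E <= (\prod_i b k B i)%:E.
  have := H n (leqnn n) (fun=> setT) (fun=> measurableT).
  rewrite (_ : \prod_i b n _ i = \prod_i c i)%R; last first.
    by apply: eq_bigr => i _; rewrite /b ltn_ord.
  congr (_ <= _); apply: eq_integral => w _; congr EFin.
  by apply: eq_bigr => i _; rewrite /g ltn_ord.
elim: k => [|k IH] kn B mB.
  have -> : \int[P]_w (\prod_i g 0%N B i (xi i w))%:E =
     P (\bigcap_(i in [set i | i \in [set: 'I_n]%SET]) (xi i @^-1` B i)).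
    rewrite -[X in P X]setIT -integral_indic //; last first.
      by apply: fin_bigcap_measurable => // i _; exact: mxi.
    apply: eq_integral => w _; congr EFin; rewrite indicE /g /=.
    have [h|h] := pselect (forall i, B i (xi i w)).
      rewrite mem_set; last by move=> i _; exact: h.
      by rewrite big1 // => i _; rewrite indicE mem_set.
    rewrite memNset; last by move=> /= h'; apply: h => i; apply: h'; rewrite /= inE.
    move/existsNP : h => [i hi].
    by rewrite (bigD1 i) //= indicE memNset // mul0r.
  rewrite ind // -prodEFin /= le_eqVlt; apply/orP; left; apply/eqP.
  apply: eq_big => [i|i _]; first by rewrite inE.
  by rewrite /b /= fineK // fin_num_measure //; exact: mxi.
pose i0 := Ordinal kn.
rewrite (bigD1 i0) //=.
have bE : b k.+1 B i0 = c i0 by rewrite /b /= ltnSn.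
have gE x : g k.+1 B i0 x = f i0 x by rewrite /g /= ltnSn.
have ne i : i != i0 -> (i < k.+1)%N = (i < k)%N.
  move=> h; rewrite ltnS leq_eqVlt (_ : (i == k :> nat) = false) //.
  by apply/negbTE; apply: contra h => /eqP e; apply/eqP/val_inj.
pose W w := (\prod_(i | i != i0) g k.+1 B i (xi i w))%R.
pose C := (\prod_(i | i != i0) b k.+1 B i)%R.
have C0 : (0 <= C)%R by apply: prodr_ge0.
apply: (@le_trans _ _ (C%:E * \int[P]_w (f i0 (xi i0 w))%:E)); last first.
  by rewrite bE mulrC EFinM lee_wpmul2l ?lee_fin.
have -> : \int[P]_w (\prod_i g k.+1 B i (xi i w))%:E = \int[P]_w (W w * f i0 (xi i0 w))%:E.
  by apply: eq_integral => w _; rewrite (bigD1 i0) //= gE mulrC.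
apply: integral_mul_comp_le => //.
- rewrite /W; under eq_fun do rewrite big_mkcond; apply: measurable_prod => i _.
  by case: (i != i0) => //; apply: measurableT_comp => //; exact: mg.
- by move=> w; apply: prodr_ge0.
move=> A mA.
(* The induction hypothesis with the [k]-th set replaced by [A] is exactly the bound on indicators
   that [integral_mul_comp_le] asks for; this is why [B] is arbitrary in it. *)
pose B' i := if i == i0 then A else B i.
have mB' i : measurable (B' i) by rewrite /B'; case: ifP.
have := IH (ltnW kn) B' mB'.
rewrite (bigD1 i0) //= {1}/b ltnn /B' eqxx mulrC EFinM fineK ?fin_num_measure //; last first.
  exact: mxi.
rewrite (_ : \prod_(i | i != i0) _ = C)%R; last first.
  by apply: eq_bigr => i h; rewrite /b (ne _ h) (negPf h).
apply: le_trans; rewrite le_eqVlt; apply/orP; left; apply/eqP.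
apply: eq_integral => w _; rewrite (bigD1 i0) //= /g ltnn /B' eqxx mulrC; congr EFin; congr (_ * _)%R.
by apply: eq_bigr => i h; rewrite /g (ne _ h) (negPf h).
Qed.

End independence.

(** * Sums over the lattice design *)

Section lattice_sum.
Context {R : realType} {d : nat}.

(** The design is given as a set, in no order, so a bijection with multi-indices is built: each
    multi-index is attained, distinct ones at distinct points, and the cardinality [n] forces
    surjectivity. *)
Lemma lattice_sum (n : nat) (x : 'I_n -> 'I_d -> R) (nk : 'I_d -> nat) (u : 'I_d -> nat -> R)
    (F : 'I_d -> R -> R) :
  n = (\prod_(k < d) nk k)%N ->
  range x = [set p | forall k, exists2 i : nat, (i < nk k)%N & p k = u k i] ->
  (forall k i j, (i < nk k)%N -> (j < nk k)%N -> u k i = u k j -> i = j) ->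
  \sum_i \prod_k F k (x i k) = \prod_k \sum_(l < nk k) F k (u k l).
Proof.
move=> nE xE uinj.
pose m := (\max_k nk k)%N.
have nkm k : (nk k <= m)%N by exact: leq_bigmax.
pose Q (k : 'I_d) : pred 'I_m := fun l => (l < nk k)%N.
have -> : \prod_k \sum_(l < nk k) F k (u k l) = \prod_k \sum_(l < m | Q k l) F k (u k l).
  by apply: eq_bigr => k _; rewrite (big_ord_widen m (fun l => F k (u k l))).
rewrite bigA_distr_big_dep.
pose p (f : {ffun 'I_d -> 'I_m}) k := u k (f k).
have ex (f : {ffun 'I_d -> 'I_m}) : f \in family Q -> exists i, x i = p f.
  move=> /familyP fQ; have : range x (p f) by rewrite xE => k; exists (f k) => //; exact: fQ.
  by move=> [i _ <-]; exists i.
pose g (f : {ffun 'I_d -> 'I_m}) : option 'I_n := [pick i | x i == p f].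
have gP f : f \in family Q -> exists2 i, g f = Some i & x i = p f.
  move=> fQ; rewrite /g; case: pickP => [i /eqP h|h]; first by exists i.
  by have [i /eqP] := ex f fQ; rewrite h.
have ginj : {in family Q &, injective g}.
  move=> f f' fQ f'Q; have [i -> h] := gP f fQ; have [i' -> h'] := gP f' f'Q => -[ii'].
  apply/ffunP => k; apply/val_inj/(uinj k).
  - by move/familyP : fQ; apply.
  - by move/familyP : f'Q; apply.
  - by rewrite -[LHS]/(p f k) -[RHS]/(p f' k) -h -h' ii'.
pose S := g @: [set f in family Q].
have cS : #|S| = n.
  rewrite card_in_imset; last by move=> f f'; rewrite !inE; exact: ginj.
  rewrite cardsE card_family nE foldrE big_map big_enum /=; apply: eq_bigr => k _.
  rewrite -sum1_card (eq_bigl (Q k)) // -(big_ord_widen m (fun=> 1%N)) //.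
  by rewrite sum1_card card_ord.
have SE : S = [set Some i | i in [set: 'I_n]]%SET.
  apply/eqP; rewrite eqEcard cS card_imset; last by move=> ? ? [].
  rewrite cardsT card_ord leqnn andbT; apply/fintype.subsetP => _ /imsetP[f fQ ->].
  have [i -> _] := gP f ltac:(by rewrite inE in fQ).
  by apply/imsetP; exists i; rewrite ?inE.
pose H (o : option 'I_n) : R := if o is Some i then \prod_k F k (x i k) else 0.
transitivity (\sum_(o in S) H o).
  by rewrite SE big_imset /=; [apply: eq_bigl => i; rewrite inE|move=> ? ? _ _ []].
rewrite big_imset /=; last by move=> f f'; rewrite !inE; exact: ginj.
rewrite (eq_bigl (fun f => f \in family Q)); last by move=> f; rewrite inE.
apply: eq_bigr => f fQ; have [i -> h] := gP f fQ.
by rewrite /= h.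
Qed.

End lattice_sum.

(** The reciprocal of 1 plus the sum of reciprocals also covers an empty [I]. *)
Lemma positive_lower_bound {R : realType} (I : finType) (y : I -> R) :
  (forall i, 0 < y i) -> exists2 e, 0 < e & forall i, e <= y i.
Proof.
move=> y0; have s0 : 0 <= \sum_i (y i)^-1 by apply: sumr_ge0 => i _; rewrite invr_ge0 ltW.
exists (1 + \sum_i (y i)^-1)^-1 => [|i]; first by rewrite invr_gt0; lra.
rewrite -[leRHS]invrK lef_pV2 ?posrE ?invr_gt0 //; last lra.
rewrite (bigD1 i) //= addrCA lerDl addr_ge0 // sumr_ge0 // => j _.
by rewrite invr_ge0 ltW.
Qed.

(** * A signed measure is determined by its hinge integrals *)

Section hinge_uniqueness.
Context {R : realType} {m : nat}.
Implicit Types (x : 'I_m -> R) (t : m.-tuple R) (nu : {charge set (m.-tuple R) -> \bar R}).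

Definition hinge x t : R := \prod_i Num.max (x i - tnth t i) 0.

Definition orthant x : set (m.-tuple R) := [set t | forall i, tnth t i < x i].

Lemma measurable_tnth_lt (i : 'I_m) (a : R) : measurable [set t : m.-tuple R | tnth t i < a].
Proof.
have := @measurable_tnth _ (measurableTypeR R) m i measurableT `]-oo, a[%classic (measurable_itv _).
by rewrite setTI; congr measurable; apply/seteqP; split => t /=; rewrite in_itv.
Qed.

Lemma measurable_orthant x : measurable (orthant x).
Proof.
rewrite (_ : orthant x = \bigcap_(i in setT) [set t | tnth t i < x i]).
  by apply: fin_bigcap_measurable => // i _; exact: measurable_tnth_lt.
by apply/seteqP; split => t /= h i *; exact: h.
Qed.

Lemma measurable_ho_cube : measurable (@ho_cube R m).
Proof.
rewrite (_ : @ho_cube R m = \bigcap_(i in setT) ([set t | tnth t i < 1] `\` [set t | tnth t i < 0])).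
  apply: fin_bigcap_measurable => // i _.
  by apply: measurableD; exact: measurable_tnth_lt.
apply/seteqP; split => t /= h i.
  by move=> _; have /andP[h0 h1] := h i; split => //=; apply/negP; rewrite -leNgt.
by have [/= h1 /negP] := h i I; rewrite -leNgt => ->.
Qed.

(** A half-space is the union of the orthants whose remaining bounds run through the natural
    numbers. *)
Lemma tuple_measurable_orthants :
  @measurable _ (m.-tuple R) = <<s range orthant >>.
Proof.
apply/seteqP; split; last first.
  apply: smallest_sub; first exact: sigma_algebra_measurable.
  by move=> _ [x _ <-]; exact: measurable_orthant.
pose T1 := g_sigma_algebraType (range orthant).
suff : measurable_fun [set: T1] (id : T1 -> m.-tuple R).
  by move=> h A mA; have := h measurableT A mA; rewrite setTI.
apply/measurable_fun_tnthP => i.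
refine (@measurability _ _ T1 _ setT _ _ (RGenInftyO.measurableE R) _).
move=> _ [_ [a ->] <-]; rewrite setTI.
rewrite (_ : _ @^-1` _ = \bigcup_k orthant (fun l => if l == i then a else k%:R)); last first.
  apply/seteqP; split => t /=; rewrite in_itv /=.
    move=> ta; pose M := \big[Num.max/0]_l tnth t l.
    exists (Num.bound M) => // l /=; case: eqP => [->//|_].
    apply: le_lt_trans (archi_boundP _); last by rewrite /M bigmax_ge_id.
    exact: le_bigmax.
  by move=> [k _ /(_ i)]; rewrite eqxx.
by apply: bigcup_measurable => k _; apply: sub_sigma_algebra; exists (fun l => if l == i then a else k%:R).
Qed.

Lemma finite_measure_orthant_unique (m1 m2 : {measure set (m.-tuple R) -> \bar R}) :
  (forall A, measurable A -> m1 A < +oo)%E ->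
  (forall x, m1 (orthant x) = m2 (orthant x)) ->
  forall A, measurable A -> m1 A = m2 A.
Proof.
move=> fin e A mA.
apply: (measure_unique (range orthant) (fun k : nat => orthant (fun=> k%:R))) => //.
- exact: tuple_measurable_orthants.
- move=> _ _ [x _ <-] [y _ <-]; exists (fun i => Num.min (x i) (y i)) => //.
  apply/seteqP; split => t /= h.
    by split => i; have := h i; rewrite lt_min => /andP[].
  by move=> i; rewrite lt_min h.1 h.2.
- apply/seteqP; split => // t _; exists (Num.bound (\big[Num.max/0]_l tnth t l)) => // l /=.
  by apply: le_lt_trans (archi_boundP _); [exact: le_bigmax|rewrite bigmax_ge_id].
- by move=> _ [x _ <-].
- by move=> k; apply: fin; exact: measurable_orthant.
Qed.

Lemma measurable_hinge x : measurable_fun setT (hinge x).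
Proof.
apply: measurable_prod => i _; apply: measurable_maxr => //.
by apply: measurable_funB => //; exact: measurable_tnth.
Qed.

Lemma hinge_ge0 x t : 0 <= hinge x t.
Proof. by apply: prodr_ge0 => i _; rewrite le_max lexx orbT. Qed.

Lemma hinge_le1 x t : (forall i, x i <= 1) -> @ho_cube R m t -> hinge x t <= 1.
Proof.
move=> x1 Dt; apply: (@le_trans _ _ (\prod_(i < m) (1 : R))); last by rewrite big1_eq.
apply: ler_prod => i _; rewrite le_max lexx orbT /= ge_max ler01 andbT.
by have /andP[h _] := Dt i; have := x1 i; lra.
Qed.

Lemma bounded_on_hinge x : (forall i, x i <= 1) -> bounded_on (@ho_cube R m) (hinge x).
Proof.
move=> x1; split; first exact: measurable_hinge.
by exists 1 => t Dt; rewrite ger0_norm ?hinge_ge0 // hinge_le1.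
Qed.

Section ramp.
Variables (x : 'I_m -> R).

(** Mixed difference quotient of step [e]: it takes values in [[0, 1]], vanishes off the orthant of
    [x], and increases to its indicator as [e] decreases to 0. *)
Definition ramp (e : R) t : R :=
  \prod_i ((Num.max (x i - tnth t i) 0 - Num.max (x i - tnth t i - e) 0) / e).

(** A factor is [y / e] truncated to [[0, 1]], from which everything is read off. *)
Lemma ramp_factor e (y : R) : 0 < e ->
  [/\ 0 <= (Num.max y 0 - Num.max (y - e) 0) / e <= 1,
      y <= 0 -> (Num.max y 0 - Num.max (y - e) 0) / e = 0,
      e <= y -> (Num.max y 0 - Num.max (y - e) 0) / e = 1 &
      forall e', 0 < e' -> e' <= e ->
       (Num.max y 0 - Num.max (y - e) 0) / e <= (Num.max y 0 - Num.max (y - e') 0) / e'].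
Proof.
move=> e0.
have mE (u : R) : Num.max u 0 = if u < 0 then 0 else u by rewrite /Num.max.
have F (e1 : R) : 0 < e1 -> (Num.max y 0 - Num.max (y - e1) 0) / e1 =
    if y < 0 then 0 else if y < e1 then y / e1 else 1.
  move=> e0'; rewrite !mE subr_lt0; case: ltP => hy.
    by rewrite (lt_trans hy e0') subrr mul0r.
  case: ltP => hye; first by rewrite subr0.
  by rewrite opprB addrCA subrr addr0 divff // lt0r_neq0.
rewrite (F e) //; split.
- case: ltP => // hy; first by rewrite lexx ler01.
  case: ltP => hye; last by rewrite ler01 lexx.
  by rewrite divr_ge0 ?(ltW e0) //= ler_pdivrMr // mul1r ltW.
- by move=> hy; case: ltP => // hy'; rewrite (le_lt_trans hy e0) (le_anti (introT andP (conj hy hy'))) mul0r.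
- by move=> hy; rewrite ltNge (le_trans (ltW e0) hy) /= ltNge hy.
- move=> e' e'0 e'e; rewrite F //; case: ltP => // hy.
  case: (ltP y e') => hye'.
    rewrite (lt_le_trans hye' e'e); apply: ler_wpM2l => //.
    by rewrite lef_pV2.
  case: ltP => // hye.
  by rewrite ler_pdivrMr // mul1r ltW.
Qed.

(** Expanding the product gives one hinge for each corner of a box of side [e]. The assumption
    [e <= x i <= 1] keeps all corners in the unit cube, the only place where hinge integrals are
    known to agree. *)
Lemma ramp_expand nu e : 0 < e -> (forall i, e <= x i <= 1) ->
  charge_Rintegral nu (@ho_cube R m) (ramp e) =
  \sum_(f : {ffun 'I_m -> bool}) (\prod_i ((-1) ^+ f i / e)) *
     charge_Rintegral nu (@ho_cube R m) (hinge (fun i => x i - e * (f i)%:R)).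
Proof.
move=> e0 xe.
have xle (f : {ffun 'I_m -> bool}) i : x i - e * (f i)%:R <= 1.
  have /andP[_ h] := xe i; apply: le_trans h; rewrite gerBl mulr_ge0 // ltW //.
pose c (f : {ffun 'I_m -> bool}) := \prod_i ((-1) ^+ f i / e).
transitivity (charge_Rintegral nu (@ho_cube R m)
    (fun t => \sum_(f : {ffun 'I_m -> bool}) c f * hinge (fun i => x i - e * (f i)%:R) t)).
  apply: eq_charge_Rintegral => t _; rewrite /ramp.
  transitivity (\prod_i \sum_(b : bool) (-1) ^+ b / e * Num.max (x i - e * b%:R - tnth t i) 0).
    apply: eq_bigr => i _; rewrite big_bool /= expr1 expr0 mulr1 mulr0 subr0 (addrAC (x i) (- e)); ring.
  by rewrite bigA_distr_bigA; apply: eq_bigr => f _; rewrite -big_split.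
rewrite charge_Rintegral_sum; first last.
- by move=> f _; apply: bounded_onZ; exact: bounded_on_hinge.
- exact: measurable_ho_cube.
apply: eq_bigr => f _; rewrite charge_RintegralZ //; first exact: measurable_ho_cube.
exact: bounded_on_hinge.
Qed.

Lemma ramp_ge0 e t : 0 < e -> 0 <= ramp e t.
Proof. by move=> e0; apply: prodr_ge0 => i _; have [/andP[]] := ramp_factor (x i - tnth t i) e0. Qed.

Lemma ramp_le1 e t : 0 < e -> ramp e t <= 1.
Proof.
move=> e0; apply: (@le_trans _ _ (\prod_(i < m) (1 : R))); last by rewrite big1_eq.
by apply: ler_prod => i _; have [h _ _ _] := ramp_factor (x i - tnth t i) e0.
Qed.

Lemma measurable_ramp e : measurable_fun setT (ramp e).
Proof.
apply: measurable_prod => i _; apply: measurable_funM => //; apply: measurable_funB;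
  by apply: measurable_maxr => //; repeat apply: measurable_funB => //; exact: measurable_tnth.
Qed.

Lemma ramp_mono e e' t : 0 < e' -> e' <= e -> ramp e t <= ramp e' t.
Proof.
move=> e'0 e'e; have e0 := lt_le_trans e'0 e'e.
apply: ler_prod => i _; have := ramp_factor (x i - tnth t i) e0.
by move=> -[/andP[-> _] _ _ /(_ _ e'0 e'e)].
Qed.

Lemma ramp_cvg e t : 0 < e -> (ramp (e / k.+1%:R) t)%:E @[k --> \oo] --> (\1_(orthant x) t)%:E.
Proof.
move=> e0; have ek k : 0 < e / k.+1%:R by rewrite divr_gt0 // ltr0n.
have [h|h] := pselect (orthant x t).
  rewrite indicE mem_set //=.
  have [dl dl0 dlE] : exists2 dl, 0 < dl & forall i, dl <= x i - tnth t i.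
    by apply: positive_lower_bound => i; rewrite subr_gt0; exact: h.
  apply: cvg_near_cst; exists (Num.bound (e / dl)) => // k /= kb; congr EFin.
  rewrite /ramp big1 // => i _; have [_ _ H _] := ramp_factor (x i - tnth t i) (ek k).
  apply: H; apply: le_trans (dlE i).
  rewrite ler_pdivrMr ?ltr0n // mulrC -ler_pdivrMr //.
  apply: le_trans (ltW (archi_boundP _)) _; first by rewrite divr_ge0 // ltW.
  by rewrite ler_nat (leq_trans kb).
rewrite indicE memNset //=; move/existsNP : h => [i /negP]; rewrite -leNgt => hi.
apply: cvg_near_cst; apply: nearW => k; congr EFin.
rewrite /ramp (bigD1 i) //=; have [_ H _ _] := ramp_factor (x i - tnth t i) (ek k).
by rewrite H ?mul0r // subr_le0.
Qed.

Lemma Rintegral_ramp_cvg (mu : {finite_measure set (m.-tuple R) -> \bar R}) e : 0 < e ->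
  Rintegral mu (@ho_cube R m) (ramp (e / k.+1%:R)) @[k --> \oo] -->
  fine (mu (orthant x `&` @ho_cube R m)).
Proof.
move=> e0; have mD := measurable_ho_cube.
have ek k : 0 < e / k.+1%:R by rewrite divr_gt0 // ltr0n.
have bR k : bounded_on (@ho_cube R m) (ramp (e / k.+1%:R)).
  split; first exact: measurable_ramp.
  by exists 1 => t _; rewrite ger0_norm ?ramp_ge0 // ramp_le1.
have mR k : measurable_fun (@ho_cube R m) (fun t => (ramp (e / k.+1%:R) t)%:E).
  by apply/measurable_EFinP/measurable_funTS; exact: measurable_ramp.
have R0 k t : @ho_cube R m t -> (0 <= (ramp (e / k.+1%:R) t)%:E)%E.
  by move=> _; rewrite lee_fin ramp_ge0.
have Rnd t : @ho_cube R m t ->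
    {homo (fun k : nat => (ramp (e / k.+1%:R) t)%:E) : a b / (a <= b)%N >-> (a <= b)%E}.
  move=> _ a b ab; rewrite lee_fin ramp_mono // ler_pM2l // lef_pV2 ?posrE ?ltr0n //.
  by rewrite ler_nat.
have := @cvg_monotone_convergence _ _ _ mu _ mD _ mR R0 Rnd.
rewrite (eq_integral (fun t => (\1_(orthant x) t)%:E)); last first.
  by move=> t _; apply/cvg_lim => //; exact: ramp_cvg.
rewrite integral_indic //; last exact: measurable_orthant.
have E : mu (orthant x `&` @ho_cube R m) = (fine (mu (orthant x `&` @ho_cube R m)))%:E.
  by rewrite fineK // fin_num_measure //; apply: measurableI => //; exact: measurable_orthant.
move=> cv; apply: fine_cvg; rewrite -E; exact: cv.
Qed.

End ramp.

(* Mixed difference quotients of hinges converge to indicators of orthants, which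
   form a generating pi-system. *)
Lemma charge_hinge_unique nu nu' :
  concentrated_on nu (@ho_cube R m) -> concentrated_on nu' (@ho_cube R m) ->
  (forall x, (forall i, 0 <= x i <= 1) ->
     charge_Rintegral nu (@ho_cube R m) (hinge x) = charge_Rintegral nu' (@ho_cube R m) (hinge x)) ->
  forall A, measurable A -> nu A = nu' A.
Proof.
move=> cnu cnu' H; have mD := measurable_ho_cube.
have J nu0 A : measurable A -> fine (nu0 A) =
    fine (jordan_pos (hahn_pos_neg nu0) A) - fine (jordan_neg (hahn_pos_neg nu0) A).
  move=> mA; have E := jordan_decomp (hahn_pos_neg nu0) mA.
  have E' : (nu0 A = jordan_pos (hahn_pos_neg nu0) A + (-1)%:E * jordan_neg (hahn_pos_neg nu0) A)%E by exact: E.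
  by rewrite E' mulN1e fineB // fin_num_measure.
have unit_case x : (forall i, 0 < x i <= 1) ->
    nu (orthant x `&` @ho_cube R m) = nu' (orthant x `&` @ho_cube R m).
  move=> x01; have [e e0 ex] : exists2 e, 0 < e & forall i, e <= x i.
    by apply: positive_lower_bound => i; case/andP : (x01 i).
  have ek k : 0 < e / k.+1%:R by rewrite divr_gt0 // ltr0n.
  have cvgC nu0 : charge_Rintegral nu0 (@ho_cube R m) (ramp x (e / k.+1%:R)) @[k --> \oo] -->
      fine (nu0 (orthant x `&` @ho_cube R m)).
    rewrite J; last by apply: measurableI => //; exact: measurable_orthant.
    by apply: cvgB; exact: Rintegral_ramp_cvg.
  have mI : measurable (orthant x `&` @ho_cube R m).
    by apply: measurableI => //; exact: measurable_orthant.
  rewrite -[LHS]fineK ?fin_num_measure // -[RHS]fineK ?fin_num_measure //; congr EFin.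
  have := cvgC nu; rewrite (_ : (fun k => _) =
      (fun k : nat => charge_Rintegral nu' (@ho_cube R m) (ramp x (e / k.+1%:R)))); last first.
    apply/funext => k.
    have ekx i : e / k.+1%:R <= x i.
      rewrite ler_pdivrMr ?ltr0n //; apply: (le_trans (ex i)).
      by rewrite ler_peMr ?ler1n //; case/andP : (x01 i) => /ltW.
    have xe i : e / k.+1%:R <= x i <= 1 by rewrite ekx; case/andP : (x01 i).
    rewrite !ramp_expand //; apply: eq_bigr => f _; congr (_ * _); apply: H => i.
    have /andP[h1 h2] := xe i; have ekk := ek k.
    have : (f i)%:R = 0 :> R \/ (f i)%:R = 1 :> R by case: (f i); [right|left].
    move: (e / k.+1%:R) h1 ekk => e1 h1 e10.
    by move=> [h|h]; rewrite h ?mulr1 ?mulr0 ?subr0; apply/andP; split; lra.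
  by move=> c; apply: (cvg_unique _ c (cvgC nu')).
have drop nu0 : concentrated_on nu0 (@ho_cube R m) -> forall A, measurable A ->
    nu0 A = nu0 (A `&` @ho_cube R m).
  move=> c A mA; rewrite -{1}(setUIDK A (@ho_cube R m)) chargeU //; last 3 first.
  - exact: measurableI.
  - exact: measurableD.
  - by apply/seteqP; split => // t [[_ h] [_ /(_ h)]].
  rewrite (c (A `\` _)) ?adde0 //; first exact: measurableD.
  by apply/seteqP; split => // t [[_ /[apply]]].
(* Orthants missing the cube have no mass and the others can be clipped at 1, which reduces to
   [unit_case]; there positivity of [x] leaves room for the step [e]. *)
have orth x : nu (orthant x) = nu' (orthant x).
  have mO := measurable_orthant x.
  rewrite (drop _ cnu) // (drop _ cnu') //.
  have [h|/existsNP[i /negP]] := pselect (forall i, 0 < x i); last first.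
    rewrite -leNgt => xi; have -> : orthant x `&` @ho_cube R m = set0.
      apply/seteqP; split => // t [/= /(_ i) h1 /(_ i)/andP[h2 _]].
      by have := le_lt_trans h2 (lt_le_trans h1 xi); rewrite ltxx.
    by rewrite !charge0.
  have -> : orthant x `&` @ho_cube R m = orthant (fun i => Num.min (x i) 1) `&` @ho_cube R m.
    apply/seteqP; split => t [h1 h2]; split => // i; have := h1 i.
      by rewrite lt_min => ->; have /andP[] := h2 i.
    by rewrite lt_min => /andP[].
  by apply: unit_case => i; rewrite lt_min h ltr01 ge_min lexx orbT.
move=> A mA; rewrite -[LHS]fineK ?fin_num_measure // -[RHS]fineK ?fin_num_measure //; congr EFin.
pose p := jordan_pos (hahn_pos_neg nu); pose q : {finite_measure set (m.-tuple R) -> \bar R} := jordan_neg (hahn_pos_neg nu).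
pose p' := jordan_pos (hahn_pos_neg nu'); pose q' : {finite_measure set (m.-tuple R) -> \bar R} := jordan_neg (hahn_pos_neg nu').
have fin (mu : {finite_measure set (m.-tuple R) -> \bar R}) B : measurable B -> mu B = (fine (mu B))%:E.
  by move=> mB; rewrite fineK // fin_num_measure.
have Jn B : measurable B -> fine (nu B) = fine (p B) - fine (q B) by exact: J.
have Jn' B : measurable B -> fine (nu' B) = fine (p' B) - fine (q' B) by exact: J.
have addE (m1 m2 : {finite_measure set (m.-tuple R) -> \bar R}) B :
    measure_add m1 m2 B = (m1 B + m2 B)%E by exact: measure_addE.
(* Uniqueness on a generating class is a statement about measures, so the negative parts change
   sides. *)
have : measure_add p q' A = measure_add p' q A.
  apply: finite_measure_orthant_unique => // [B mB|x].
    by rewrite -[X in (X < _)%E]/(measure_add p q' B) addE lte_add_pinfty // ltey_eq fin_num_measure.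
  have mO := measurable_orthant x.
  rewrite -[LHS]/(measure_add p q' (orthant x)) -[RHS]/(measure_add p' q (orthant x)) !addE (fin p) // (fin q) // (fin p') // (fin q') // -!EFinD; congr EFin.
  have := orth x => /(congr1 fine); rewrite Jn // Jn' //.
  move: (fine (p _)) (fine (q _)) (fine (p' _)) (fine (q' _)) => a b c e; lra.
rewrite !addE (fin p) // (fin q) // (fin p') // (fin q') // -!EFinD => -[].
rewrite Jn // Jn' //.
move: (fine (p _)) (fine (q _)) (fine (p' _)) (fine (q' _)) => a b c e; lra.
Qed.

End hinge_uniqueness.

(** * Uniqueness of the representing measures *)

Section representation_uniqueness.
Context {R : realType} {d : nat}.
Implicit Types (alpha beta : {set 'I_d}) (x : 'I_d -> R) (nu : @charge_family R d).

Lemma charge_Rintegral0 dsp (T : measurableType dsp) (nu : {charge set T -> \bar R}) (D : set T) :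
  measurable D -> charge_Rintegral nu D (fun=> 0) = 0.
Proof.
move=> mD; rewrite (_ : (fun=> 0) = (fun _ : T => 0 * 0)); last by apply/funext => ?; rewrite mul0r.
by rewrite charge_RintegralZ ?mul0r //; exact: bounded_on_cst.
Qed.

Definition hinge_integral nu alpha x : R :=
  charge_Rintegral (nu alpha) (@ho_cube R #|alpha|) (hinge_prod x).

Definition restrict alpha x : 'I_d -> R := fun k => if k \in alpha then x k else 0.

Lemma unit_cube_restrict alpha x : unit_cube x -> unit_cube (restrict alpha x).
Proof. by move=> hx j; rewrite /restrict; case: ifP => // _; rewrite lexx ler01. Qed.

(** Knots are nonnegative, so a coordinate set to 0 kills every hinge product that involves it. *)
Lemma hinge_integral_restrict nu alpha beta x :
  hinge_integral nu beta (restrict alpha x) =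
  if beta \subset alpha then hinge_integral nu beta x else 0.
Proof.
case: (boolP (beta \subset alpha)) => [/fintype.subsetP h|/subsetPn [k kb ka]].
  apply: eq_charge_Rintegral => t _; rewrite /hinge_prod; apply: eq_bigr => i _.
  by rewrite /restrict h // enum_valP.
rewrite -(charge_Rintegral0 (nu beta) (@measurable_ho_cube R #|beta|)).
apply: eq_charge_Rintegral => t Dt; rewrite /hinge_prod (bigD1 (enum_rank_in kb k)) //=.
rewrite enum_rankK_in // /restrict (negPf ka) sub0r.
have /andP[t0 _] := Dt (enum_rank_in kb k).
by rewrite max_r ?mul0r // oppr_le0.
Qed.

Lemma mars_fun_restrict s a0 nu alpha x :
  mars_fun s a0 nu (restrict alpha x) =
  a0 + \sum_(beta | active s beta && (beta \subset alpha)) hinge_integral nu beta x.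
Proof.
rewrite /mars_fun [in RHS]big_mkcondr; congr (_ + _); apply: eq_bigr => beta _.
exact: hinge_integral_restrict.
Qed.

(* Restricting x to alpha keeps exactly the terms with index included in alpha, so
   the terms are isolated by induction on the cardinality of alpha. *)
Lemma represents_hinge_integral s a0 nu a0' nu' f :
  represents s a0 nu f -> represents s a0' nu' f ->
  forall alpha x, active s alpha -> unit_cube x ->
    hinge_integral nu alpha x = hinge_integral nu' alpha x.
Proof.
move=> [_ h] [_ h'].
have E alpha x : unit_cube x ->
    a0 + \sum_(beta | active s beta && (beta \subset alpha)) hinge_integral nu beta x =
    a0' + \sum_(beta | active s beta && (beta \subset alpha)) hinge_integral nu' beta x.
  by move=> hx; rewrite -!mars_fun_restrict -h ?h' //; exact: unit_cube_restrict.
have a0E : a0 = a0'.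
  have := E finset.set0 (fun=> 0); rewrite !big_pred0 ?addr0; first by apply=> j; rewrite lexx ler01.
    by move=> beta; rewrite finset.subset0 /active /=; case: (beta == finset.set0); rewrite ?andbF.
  by move=> beta; rewrite finset.subset0 /active /=; case: (beta == finset.set0); rewrite ?andbF.
subst a0'; move=> alpha; have [n] := ubnP #|alpha|.
elim: n alpha => // n IH alpha; rewrite ltnS => an x aa hx.
have := E alpha x hx => /addrI.
rewrite (bigD1 alpha) ?aa ?subxx //= [in RHS](bigD1 alpha) ?aa ?subxx //=.
rewrite [in RHS](eq_bigr (fun beta => hinge_integral nu beta x)); first by move/addIr.
move=> beta /andP[/andP[ab ba] ne]; rewrite IH //; apply: leq_trans an.
by apply: proper_card; rewrite finset.properEneq ne ba.
Qed.

Lemma represents_unique s a0 nu a0' nu' f :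
  represents s a0 nu f -> represents s a0' nu' f ->
  forall alpha, active s alpha ->
  forall A, measurable A -> nu alpha A = nu' alpha A.
Proof.
move=> r r' alpha aa; have [c _] := r; have [c' _] := r'.
apply: charge_hinge_unique; [exact: c|exact: c'|] => y hy.
(* An element of [alpha] is the default value that [enum_rank_in] requires to turn [y] into a point
   of the cube. *)
have [i0|a0'k] := pickP (mem alpha); last first.
  have /andP[/eqP ne _] := aa; exfalso; apply: ne.
  by apply/setP => k; rewrite inE; exact: a0'k.
move=> i0a.
pose x (k : 'I_d) := y (enum_rank_in i0a k).
have hx : unit_cube x by move=> j; exact: hy.
have := represents_hinge_integral r r' aa hx; rewrite /hinge_integral.
have e : hinge_prod (alpha := alpha) x = hinge y.
  by apply/funext => t; rewrite /hinge_prod; apply: eq_bigr => i _; rewrite /x enum_valK_in.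
by rewrite e.
Qed.

Lemma measurable_zero_tuple (m : nat) : measurable [set t : m.-tuple R | forall i, tnth t i = 0].
Proof.
rewrite (_ : [set t : m.-tuple R | _] = \bigcap_(i in setT)
   ((~` [set t : m.-tuple R | tnth t i < 0]) `&`
    \bigcap_k [set t : m.-tuple R | tnth t i < k.+1%:R^-1])).
  apply: fin_bigcap_measurable => // i _; apply: measurableI.
    by apply: measurableC; exact: measurable_tnth_lt.
  by apply: bigcapT_measurable => k; exact: measurable_tnth_lt.
apply/seteqP; split => t /= h i.
  by move=> _; split=> [/=|k _ /=]; rewrite h ?ltxx // invr_gt0 ltr0n.
have [/= /negP h0 h1] := h i I; apply/eqP; rewrite eq_le [X in _ && X]leNgt h0 andbT leNgt.
apply/negP => t0; have /= := h1 (Num.bound (tnth t i)^-1) I; apply/negP; rewrite -leNgt.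
rewrite -[leRHS]invrK lef_pV2 ?posrE ?invr_gt0 ?ltr0n //.
apply: le_trans (ltW (archi_boundP _)) _; first by rewrite invr_ge0 ltW.
by rewrite ler_nat.
Qed.

Lemma Vmars_represents s f (V : R) : (Vmars s f <= V%:E)%E ->
  exists a0 nu, represents s a0 nu f /\ (complexity s nu <= V%:E)%E.
Proof.
rewrite /Vmars; case: pselect => [h hV|_]; last by rewrite leye_eq.
have [a0 r] := projT2 (cid h).
by exists a0, (projT1 (cid h)).
Qed.

(** [Vmars] evaluates a representation picked by choice; uniqueness transfers to it the complexity
    of any representation constructed by hand. *)
Lemma Vmars_le_complexity s a0 nu f : represents s a0 nu f ->
  (Vmars s f <= complexity s nu)%E.
Proof.
move=> r; rewrite /Vmars; case: pselect => [h|nh]; last by case: nh; exists nu, a0.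
have [a1 r1] := projT2 (cid h).
apply: lee_sum => alpha aa; apply: total_variation_eq.
  exact: represents_unique r1 r _ aa.
by apply: measurableD; [exact: measurable_ho_cube|exact: measurable_zero_tuple].
Qed.

End representation_uniqueness.

(** * Linear interpolation of a hinge between knots *)

Section knot_interpolation.
Context {R : realType}.
Implicit Types (N r : nat) (t x : R).

Definition knot_weight N r t : R := Num.max 0 (1 - `|N%:R * t - r%:R|).

(** The sum stops before [N]: the knot 1 lies outside [[0, 1)], and its hinge vanishes on the unit
    interval. *)
Definition interpolated_hinge N t x : R :=
  \sum_(r < N) knot_weight N r t * Num.max (x - r%:R / N%:R) 0.

Lemma knot_weight_ge0 N r t : 0 <= knot_weight N r t.
Proof. by rewrite le_max lexx. Qed.

Lemma knot_weight_at0 N r : (0 < r)%N -> knot_weight N r 0 = 0.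
Proof.
move=> r0; apply/max_idPl; rewrite mulr0 sub0r normrN normr_nat subr_le0.
by rewrite ler1n.
Qed.

(** Only the hats at the two ends of the cell of [t] are nonzero, [q] being the fractional part of
    [N t]. The condition [F N = 0] serves the last cell, whose right end is not in the sum. *)
Lemma knot_sum N t (F : nat -> R) : (0 < N)%N -> 0 <= t < 1 -> F N = 0 ->
  exists a (q : R), [/\ (a < N)%N, 0 <= q < 1, N%:R * t = a%:R + q &
   \sum_(r < N) knot_weight N r t * F r = (1 - q) * F a + q * F a.+1].
Proof.
move=> N0 /andP[t0 t1] FN.
have Nt0 : 0 <= N%:R * t by rewrite mulr_ge0.
pose a := Num.truncn (N%:R * t); pose q := N%:R * t - a%:R.
have /andP[a1 a2] : a%:R <= N%:R * t < a.+1%:R by exact: truncn_itv.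
have aN : (a < N)%N.
  by rewrite -(ltr_nat R) (le_lt_trans a1) // gtr_pMr // ltr0n.
exists a, q; split => //; first by rewrite -natr1 in a2; apply/andP; split; rewrite /q; lra.
  by rewrite /q addrC subrK.
have wE r : knot_weight N r t = if r == a then 1 - q else if r == a.+1 then q else 0.
  rewrite /knot_weight (_ : N%:R * t = a%:R + q); last by rewrite /q addrC subrK.
  have q0 : 0 <= q by rewrite /q; lra.
  have q1 : q < 1 by rewrite /q; rewrite -natr1 in a2; lra.
  case: eqP => [->|ra]; first by rewrite addrAC subrr add0r ger0_norm // max_r //; lra.
  case: eqP => [->|ra1].
    rewrite -natr1 (_ : a%:R + q - (a%:R + 1) = - (1 - q)); last by ring.
    by rewrite normrN ger0_norm; [rewrite max_r; lra|lra].
  apply/max_idPl; rewrite subr_le0; case: (ltngtP r a) => h; last by [].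
    have : r.+1%:R <= a%:R :> R by rewrite ler_nat.
    by rewrite -natr1 => h'; rewrite ger0_norm; lra.
  have : a.+2%:R <= r%:R :> R by rewrite ler_nat ltn_neqAle eq_sym h andbT; apply/eqP.
  by rewrite -!natr1 => h'; rewrite ler0_norm; lra.
pose G r := knot_weight N r t * F r.
transitivity (\sum_(r < N.+1) G r).
  by rewrite big_ord_recr /= /G FN mulr0 addr0.
rewrite (bigD1 (Ordinal (leqW aN))) //= (bigD1 (Ordinal (aN : (a.+1 < N.+1)%N))) /=; last first.
  by rewrite -val_eqE /= gtn_eqF.
rewrite big1 ?addr0; first by rewrite /G !wE eqxx gtn_eqF // eqxx.
move=> r; rewrite -!val_eqE /= => /andP[/negPf r1 /negPf r2].
by rewrite /G wE r1 r2 mul0r.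
Qed.

(** In the last cell the omitted hat takes its share, hence an inequality. *)
Lemma knot_weight_sum_le1 N t : (0 < N)%N -> 0 <= t < 1 ->
  \sum_(r < N) knot_weight N r t <= 1.
Proof.
move=> N0 t01.
have FN : (N < N)%N%:R = 0 :> R by rewrite ltnn.
have [a [q [_ /andP[q0 q1] _]]] := knot_sum (F := fun r => (r < N)%N%:R) N0 t01 FN.
rewrite (eq_bigr (fun r : 'I_N => knot_weight N r t)); last by move=> r _; rewrite ltn_ord mulr1.
move=> ->; have : ((a < N)%N%:R : R) <= 1 by case: (_ < _)%N.
have : ((a.+1 < N)%N%:R : R) <= 1 by case: (_ < _)%N.
by nra.
Qed.

(* In t, interpolation changes the hinge only when x and t lie in the same cell,
   where both the hinge and its interpolation are at most 1 / N. *)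
Lemma interpolated_hingeP N t x : (0 < N)%N -> 0 <= t < 1 -> 0 <= x <= 1 ->
  [/\ Num.max (x - t) 0 <= interpolated_hinge N t x <= 1,
      t = 0 -> interpolated_hinge N t x = Num.max (x - t) 0 &
      interpolated_hinge N t x = Num.max (x - t) 0 \/ interpolated_hinge N t x <= N%:R^-1].
Proof.
move=> N0 t01 /andP[x0 x1]; have n0 : 0 < N%:R :> R by rewrite ltr0n.
have [//|a [q [aN /andP[q0 q1] tE]]] := @knot_sum N t (fun r => Num.max (x - r%:R / N%:R) 0) N0 t01.
  by rewrite divff ?lt0r_neq0 // max_r // subr_le0.
rewrite -/(interpolated_hinge N t x) => ->.
have mE (u : R) : Num.max u 0 = if u < 0 then 0 else u by rewrite /Num.max.
pose c : R := N%:R^-1; have c0 : 0 < c by rewrite invr_gt0.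
have tc : t = (a%:R + q) * c by rewrite -tE /c mulrC mulKf // lt0r_neq0.
rewrite -natr1 -/c tc; set y := a%:R * c.
have -> : (a%:R + q) * c = y + q * c by rewrite mulrDl.
have -> : (a%:R + 1) * c = y + c by rewrite mulrDl mul1r.
have y0 : 0 <= y by rewrite mulr_ge0 // ltW.
have qc0 : 0 <= q * c by rewrite mulr_ge0 // ltW.
have qc1 : q * c < c by rewrite gtr_pMl.
have y00 : y + q * c = 0 -> y = 0 /\ q = 0.
  move=> h; have yy : y = 0 by lra.
  split => //; have : q * c = 0 by lra.
  by move/eqP; rewrite mulf_eq0 (gt_eqF c0) orbF => /eqP.
rewrite !mE !subr_lt0.
case: (ltP x y) => h1.
  rewrite (lt_le_trans h1) ?lerDl // (lt_trans h1) ?ltrDl // !mulr0 addr0.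
  by split; [rewrite lexx ler01| |left].
case: (ltP x (y + c)) => h2.
  rewrite mulr0 addr0.
  have b1 : (1 - q) * (x - y) <= c by nra.
  have b2 : (1 - q) * (x - y) <= 1 by nra.
  split; [|move=> /y00[-> ->]|by right].
    rewrite b2 andbT; case: ifP => h3; first by apply: mulr_ge0; lra.
    by nra.
  by rewrite mul0r addr0 subr0 mul1r ltNge x0.
have -> : (x < y + q * c) = false by apply/negbTE; rewrite -leNgt; lra.
have e : (1 - q) * (x - y) + q * (x - (y + c)) = x - (y + q * c) by ring.
rewrite e; split; [|by []|by left].
by rewrite lexx /=; lra.
Qed.

(** The bound does not grow with the number of factors: if some factor differs, its [b i] is at most
    [e], so both products lie in [[0, e]]. *)
Lemma prod_perturb (I : finType) (a b : I -> R) (e : R) :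
  0 <= e -> (forall i, 0 <= a i <= b i) -> (forall i, b i <= 1) ->
  (forall i, b i = a i \/ b i <= e) ->
  `|\prod_i b i - \prod_i a i| <= e.
Proof.
move=> e0 ab b1 H.
have [/forallP h|] := boolP [forall i, b i == a i].
  by rewrite (eq_bigr a) ?subrr ?normr0 // => i _; apply/eqP.
rewrite negb_forall => /existsP[i /eqP ne].
have bie : b i <= e by case: (H i).
have a0 j : 0 <= a j by case/andP : (ab j).
have b0 j : 0 <= b j by case/andP : (ab j) => h1 h2; exact: le_trans h2.
have le1 : \prod_i a i <= \prod_i b i by apply: ler_prod => j _; exact: ab.
have le2 : \prod_i b i <= e.
  rewrite (bigD1 i) //= (le_trans _ bie) // ler_piMr //.
  apply: (@le_trans _ _ (\prod_(j | j != i) (1 : R))); last by rewrite big1_eq.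
  by apply: ler_prod => j _; rewrite b0 b1.
have : 0 <= \prod_i a i by apply: prodr_ge0.
by rewrite ger0_norm ?subr_ge0 // lerBlDr => h; rewrite (le_trans le2) // lerDl.
Qed.

End knot_interpolation.

(** * Rounding a signed measure to the knots *)

Section rounding.
Context {R : realType} {m : nat}.
Variables (N : 'I_m -> nat) (eps : R) (nu : {charge set (m.-tuple R) -> \bar R}).
Hypotheses (N0 : forall i, (0 < N i)%N) (Neps : forall i, (N i)%:R^-1 <= eps) (eps0 : 0 <= eps).

Let D := @ho_cube R m.
Let Z := [set t : m.-tuple R | forall i, tnth t i = 0].
Let Q := (\max_i N i)%N.
Let I := {ffun 'I_m -> 'I_Q}.

Let NQ i : (N i <= Q)%N. Proof. exact: leq_bigmax. Qed.

(** The [N i] differ, so indices run through a common range; an index beyond [N i] has weight 0 and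
    a default knot still in [[0, 1)]. *)
Let knot (f : I) : m.-tuple R :=
  [tuple if (f i < N i)%N then (f i)%:R / (N i)%:R else 0 | i < m].

Let lam (f : I) (t : m.-tuple R) : R :=
  \prod_i (if (f i < N i)%N then knot_weight (N i) (f i) (tnth t i) else 0).

Let knot_in f : D (knot f).
Proof.
move=> i; rewrite tnth_mktuple; case: ifP => h; last by rewrite lexx ltr01.
by rewrite divr_ge0 //= ltr_pdivrMr ?ltr0n ?mul1r ?ltr_nat.
Qed.

Let lam_ge0 f t : 0 <= lam f t.
Proof. by apply: prodr_ge0 => i _; case: ifP => // _; exact: knot_weight_ge0. Qed.

Let sum_ord_if i (F : nat -> R) :
  \sum_(r < Q) (if (r < N i)%N then F r else 0) = \sum_(r < N i) F r.
Proof. by rewrite (big_ord_widen Q F (NQ i)) [RHS]big_mkcond. Qed.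

Let lam_sum t : D t -> \sum_f lam f t <= 1.
Proof.
move=> Dt; rewrite /lam -(bigA_distr_bigA (fun i (r : 'I_Q) =>
  if (r < N i)%N then knot_weight (N i) r (tnth t i) else 0)).
apply: (@le_trans _ _ (\prod_(i < m) (1 : R))); last by rewrite big1_eq.
apply: ler_prod => i _; rewrite (sum_ord_if i (fun r => knot_weight (N i) r (tnth t i))).
rewrite (knot_weight_sum_le1 (N0 i) (Dt i)) andbT.
by apply: sumr_ge0 => r _; exact: knot_weight_ge0.
Qed.

(** The origin is itself a knot and gives weight to no other, so mass at the origin, which is not
    counted in the complexity, never turns into mass that is. *)
Let lam_zero f t : Z t -> lam f t != 0 -> Z (knot f).
Proof.
move=> Zt /prodf_neq0 h i; rewrite tnth_mktuple.
have := h i isT; case: ifP => // fN.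
case: (posnP (f i)) => [->|f0]; first by rewrite mul0r.
by rewrite Zt knot_weight_at0 // eqxx.
Qed.

Let mlam f : measurable_fun setT (lam f).
Proof.
apply: measurable_prod => i _; case: (f i < N i)%N => //; rewrite /knot_weight.
apply: measurable_maxr => //; apply: measurable_funB => //.
apply: measurableT_comp => //; apply: measurable_funB => //.
by apply: measurable_funM => //; exact: measurable_tnth.
Qed.

Let lam_le1 f t : D t -> lam f t <= 1.
Proof.
move=> Dt; apply: le_trans (lam_sum Dt); rewrite (bigD1 f) //= lerDl.
by apply: sumr_ge0.
Qed.

Let blam f : bounded_on D (lam f).
Proof. by split=> //; exists 1 => t Dt; rewrite ger0_norm // lam_le1. Qed.

Let lam_hinge x t : (forall i, 0 <= x i <= 1) -> D t ->
  \sum_f hinge x (knot f) * lam f t = \prod_i interpolated_hinge (N i) (tnth t i) (x i).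
Proof.
move=> x01 Dt; rewrite /interpolated_hinge.
under [RHS]eq_bigr => i _ do rewrite -(sum_ord_if i
  (fun r => knot_weight (N i) r (tnth t i) * Num.max (x i - r%:R / (N i)%:R) 0)).
rewrite bigA_distr_bigA; apply: eq_bigr => f _; rewrite /hinge /lam -big_split /=.
apply: eq_bigr => i _; rewrite tnth_mktuple; case: ifP => h; last by rewrite mulr0.
by rewrite mulrC.
Qed.

(** The mass at a knot is the [nu]-integral of its weight, the transpose of interpolation:
    integrating a hinge against the rounded charge amounts to integrating the interpolated hinge
    against [nu]. *)
Lemma rounding_charge : exists nug : {charge set (m.-tuple R) -> \bar R},
  [/\ concentrated_on nug ([set t | forall i, exists2 k : nat, (k <= N i)%N &
        tnth t i = k%:R / (N i)%:R] `&` @ho_cube R m),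
      forall x, (forall i, 0 <= x i <= 1) ->
        `|charge_Rintegral nug (@ho_cube R m) (hinge x)
          - charge_Rintegral nu (@ho_cube R m) (hinge x)|
        <= eps * fine (Defs.total_variation nu
             (@ho_cube R m `\` [set t | forall i, tnth t i = 0])) &
      (Defs.total_variation nug (@ho_cube R m `\` [set t | forall i, tnth t i = 0%R])
        <= Defs.total_variation nu (@ho_cube R m `\` [set t | forall i, tnth t i = 0%R]))%E].
Proof.
have mD : measurable D := @measurable_ho_cube R m.
have mZ : measurable Z := @measurable_zero_tuple R m.
have mDZ : measurable (D `\` Z) by exact: measurableD.
pose w (f : I) := charge_Rintegral nu D (lam f).
have [nug [nugE nugI]] := @discrete_charge _ _ R I (index_enum I) w knot.
exists nug; split.
- move=> B mB BE; rewrite nugE // big1 // => f _.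
  rewrite indicE memNset ?mulr0 // => Bf.
  suff : (B `&` ([set t | forall i, exists2 k : nat, (k <= N i)%N &
        tnth t i = k%:R / (N i)%:R] `&` @ho_cube R m)) (knot f) by rewrite BE.
  split=> //; split; last exact: knot_in.
  move=> i; rewrite tnth_mktuple; case: ifP => h; first by exists (f i) => //; exact: ltnW.
  by exists 0%N => //; rewrite mul0r.
- move=> x x01; have bx : bounded_on D (hinge x).
    by apply: bounded_on_hinge => i; case/andP : (x01 i).
  rewrite nugI //; last by move=> t _; exact: hinge_ge0.
  have bl f : bounded_on D (fun t => hinge x (knot f) * lam f t) by apply: bounded_onZ.
  have -> : \sum_f w f * hinge x (knot f) =
      charge_Rintegral nu D (fun t => \sum_f hinge x (knot f) * lam f t).
    rewrite charge_Rintegral_sum //; apply: eq_bigr => f _.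
    by rewrite charge_RintegralZ // mulrC.
  have bs : bounded_on D (fun t => \sum_f hinge x (knot f) * lam f t).
    by apply: bounded_on_sum.
  have -> : charge_Rintegral nu D (fun t => \sum_f hinge x (knot f) * lam f t)
      - charge_Rintegral nu D (hinge x) =
      charge_Rintegral nu D (fun t => \sum_f hinge x (knot f) * lam f t + -1 * hinge x t).
    by rewrite charge_RintegralD //; [rewrite charge_RintegralZ // mulN1r|exact: bounded_onZ].
  apply: le_total_variation_charge_Rintegral => //.
  + by apply: bounded_onD => //; exact: bounded_onZ.
  + move=> t Dt Zt; rewrite lam_hinge // mulN1r; apply/eqP; rewrite subr_eq0; apply/eqP.
    apply: eq_bigr => i _.
    by have [_ -> //] := @interpolated_hingeP R (N i) (tnth t i) (x i) (N0 i) (Dt i) (x01 i).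
  + move=> t Dt; rewrite lam_hinge // mulN1r; apply: prod_perturb => // i;
      have [/andP[h1 h2] _ h3] := @interpolated_hingeP R (N i) (tnth t i) (x i) (N0 i) (Dt i) (x01 i).
    * by rewrite h1 le_max lexx orbT.
    * exact: h2.
    * by case: h3 => [->|h]; [left|right; exact: le_trans (Neps i)].
- have [mP mN] := hahn_measurable nug.
  have mAP : measurable ((D `\` Z) `&` hahn_pos nug) by exact: measurableI.
  have mAN : measurable ((D `\` Z) `&` hahn_neg nug) by exact: measurableI.
  (* The variation of the rounded charge is the [nu]-integral of the weights signed by its Hahn
     sets. As the weights sum to at most 1, this integrand is bounded by 1, and it vanishes at the
     origin. *)
  pose sg f : R := \1_((D `\` Z) `&` hahn_pos nug) (knot f) - \1_((D `\` Z) `&` hahn_neg nug) (knot f).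
  have sg1 f : `|sg f| <= 1.
    rewrite /sg !indicE; case: (_ \in _); case: (_ \in _);
      by rewrite ?subrr ?subr0 ?sub0r ?normrN ?normr1 ?normr0 ?lexx ?ler01.
  have sgZ f : Z (knot f) -> sg f = 0.
    by move=> Zf; rewrite /sg !indicE !memNset ?subrr // => -[[_ /(_ Zf)]].
  rewrite total_variationE // !nugE // -EFinB -sumrB.
  have -> : \sum_f (w f * \1_((D `\` Z) `&` hahn_pos nug) (knot f)
      - w f * \1_((D `\` Z) `&` hahn_neg nug) (knot f)) =
      charge_Rintegral nu D (fun t => \sum_f sg f * lam f t).
    rewrite charge_Rintegral_sum //; last by move=> f _; exact: bounded_onZ.
    by apply: eq_bigr => f _; rewrite charge_RintegralZ // /sg -/(w f); ring.
  rewrite -[leRHS]fineK; last by rewrite /Defs.total_variation fin_num_measure.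
  rewrite lee_fin -[leRHS]mul1r (le_trans (ler_norm _)) //.
  apply: le_total_variation_charge_Rintegral => //.
  + by apply: bounded_on_sum => f _; exact: bounded_onZ.
  + move=> t Dt Zt; rewrite big1 // => f _.
    have [->|l0] := eqVneq (lam f t) 0; first by rewrite mulr0.
    by rewrite sgZ ?mul0r //; exact: lam_zero l0.
  + move=> t Dt; apply: le_trans (ler_norm_sum _ _ _) _.
    apply: le_trans (lam_sum Dt); apply: ler_sum => f _.
    by rewrite normrM (ger0_norm (lam_ge0 f t)) ler_piMl.
Qed.

End rounding.

Lemma expR_half_le2 {R : realType} : expR 2^-1 <= 2 :> R.
Proof.
have := @expR_ge1Dx R (- 2^-1); rewrite expRN => h1.
have e0 := @expR_gt0 R 2^-1.
rewrite -[leRHS]invrK -[leLHS]invrK lef_pV2 ?posrE ?invr_gt0 //.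
by lra.
Qed.

(** * Mean bounds for sub-Gaussian linear forms *)

Section expectation_bounds.
Context d (T : measurableType d) (R : realType) (P : probability T R).
Implicit Types (Z : T -> R) (c : R).

(** Closed under sums and nonnegative multiples, so mean bounds compose without integrability
    conditions. *)
Definition mean_le Z c : Prop :=
  [/\ measurable_fun setT Z, forall w, 0 <= Z w & (\int[P]_w (Z w)%:E <= c%:E)%E].

Lemma mean_leD Z Z' c c' : mean_le Z c -> mean_le Z' c' ->
  mean_le (fun w => Z w + Z' w) (c + c').
Proof.
move=> [m0 p0 i0] [m1 p1 i1]; split; first exact: measurable_funD.
  by move=> w; rewrite addr_ge0.
under eq_integral do rewrite EFinD.
rewrite ge0_integralD //; first by rewrite EFinD leeD.
all: try by move=> w _; rewrite lee_fin.
all: exact/measurable_EFinP.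
Qed.

Lemma mean_leZ Z c a : 0 <= a -> mean_le Z c -> mean_le (fun w => a * Z w) (a * c).
Proof.
move=> a0 [m0 p0 i0]; split; first exact: measurable_funM.
  by move=> w; rewrite mulr_ge0.
under eq_integral do rewrite EFinM.
rewrite ge0_integralZl_EFin //; first by rewrite EFinM lee_wpmul2l ?lee_fin.
  by move=> w _; rewrite lee_fin.
exact/measurable_EFinP.
Qed.

Lemma mean_le_cst c : 0 <= c -> mean_le (fun=> c) c.
Proof.
move=> c0; split => //; have := expectation_cst P c; rewrite unlock => ->; exact: lexx.
Qed.

Lemma mean_le_sum (I : Type) (s : seq I) (Q : pred I) (Z : I -> T -> R) (c : I -> R) :
  (forall i, Q i -> mean_le (Z i) (c i)) ->
  mean_le (fun w => \sum_(i <- s | Q i) Z i w) (\sum_(i <- s | Q i) c i).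
Proof.
move=> H; elim: s => [|i s IH].
  by under eq_fun do rewrite big_nil; rewrite big_nil; exact: mean_le_cst.
under eq_fun do rewrite big_cons; rewrite big_cons.
by case: (boolP (Q i)) => // Qi; apply: mean_leD => //; exact: H.
Qed.

Lemma mean_le_trans Z c c' : mean_le Z c -> c <= c' -> mean_le Z c'.
Proof. by move=> [m0 p0 i0] cc; split => //; rewrite (le_trans i0) // lee_fin. Qed.

Lemma mean_le_mono Z Z' c : measurable_fun setT Z' -> (forall w, 0 <= Z' w <= Z w) ->
  mean_le Z c -> mean_le Z' c.
Proof.
move=> mZ' h [m0 p0 i0]; split => // [w|]; first by case/andP: (h w).
apply: le_trans i0; apply: ge0_le_integral_nomeas => w; rewrite lee_fin.
  by case/andP: (h w).
by case/andP: (h w).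
Qed.

Section subgaussian.
Variables (n : nat) (xi : 'I_n -> {RV P >-> R}) (sigma : R).
Hypotheses (ind : mutually_independent xi) (sub : forall i, sub_gaussian sigma (xi i)).
Hypothesis sigma0 : 0 < sigma.

Let X (a : 'I_n -> R) w : R := dot (fun i => xi i w) a.

Lemma measurable_dot_noise a : measurable_fun setT (X a).
Proof. by apply: measurable_sum => i; apply: measurable_funM. Qed.

Lemma mgf_dot_noise a (l : R) :
  (\int[P]_w (expR (l * X a w))%:E <= (expR (sigma ^+ 2 * l ^+ 2 * dot a a / 2))%:E)%E.
Proof.
have E w : expR (l * X a w) = \prod_i expR (l * a i * xi i w).
  by rewrite -expR_sum /X /dot mulr_sumr; congr expR; apply: eq_bigr => i _; ring.
have E' : expR (sigma ^+ 2 * l ^+ 2 * dot a a / 2) =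
    \prod_i expR (sigma ^+ 2 * (l * a i) ^+ 2 / 2).
  rewrite -expR_sum /dot mulr_sumr mulr_suml; congr expR; apply: eq_bigr => i _; ring.
under eq_integral do rewrite E.
rewrite E'; apply: (@independent_prod_le _ _ _ P n xi (fun i y => expR (l * a i * y))) => //.
- move=> i; apply: measurableT_comp => //; exact: measurable_funM.
- move=> i; have := sub i (l * a i); rewrite /mmt_gen_fun unlock.
  by apply: le_trans; rewrite le_eqVlt; apply/orP; left; apply/eqP; apply: eq_integral => w _ /=; rewrite mulrC.
Qed.

(** At [1 / tau] and [- 1 / tau] the moment generating function is at most [expR 2^-1 <= 2]. The sum
    of the two exponentials dominates that of the absolute value. *)
Lemma mean_le_cosh a (tau : R) : 0 < tau -> sigma ^+ 2 * dot a a <= tau ^+ 2 ->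
  mean_le (fun w => expR (X a w / tau) + expR (- (X a w / tau))) 4.
Proof.
move=> t0 h.
have mX l : measurable_fun setT (fun w => expR (l * X a w)).
  apply: measurableT_comp => //; apply: measurable_funM => //; exact: measurable_dot_noise.
have B l : l ^+ 2 = tau ^- 2 -> mean_le (fun w => expR (l * X a w)) 2.
  move=> l2; split => [//|w|]; first exact: expR_ge0.
  rewrite (le_trans (mgf_dot_noise a l)) // lee_fin (le_trans _ expR_half_le2) // ler_expR l2.
  have : sigma ^+ 2 * dot a a / tau ^+ 2 <= 1 by rewrite ler_pdivrMr ?exprn_gt0 // mul1r.
  move=> h2; rewrite (_ : _ / 2 = (sigma ^+ 2 * dot a a / tau ^+ 2) / 2); last by ring.
  by lra.
have -> : (fun w => expR (X a w / tau) + expR (- (X a w / tau))) =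
    (fun w => expR (tau^-1 * X a w) + expR (- tau^-1 * X a w)).
  by apply/funext => w; rewrite mulNr (mulrC _ tau^-1).
rewrite (_ : 4 = 2 + 2 :> R); last by ring.
by apply: mean_leD; apply: B; rewrite ?sqrrN exprVn.
Qed.

(** From [y^2 <= 2 (e^y + e^-y)] and [mean_le_cosh] at [tau = sigma]; the constant is 2 times 4. *)
Lemma mean_le_sqr a : dot a a <= 1 -> mean_le (fun w => X a w ^+ 2) (8 * sigma ^+ 2).
Proof.
move=> a1; have := @mean_le_cosh a sigma sigma0.
have s2 : 0 < sigma ^+ 2 by rewrite exprn_gt0.
rewrite -[leRHS]mulr1 ler_pM2l // => /(_ a1).
have s22 : 0 <= 2 * sigma ^+ 2 by rewrite mulr_ge0 // ltW.
move/(mean_leZ s22); rewrite (_ : 2 * sigma ^+ 2 * 4 = 8 * sigma ^+ 2); last by ring.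
apply: mean_le_mono; first by apply: measurable_funX; exact: measurable_dot_noise.
move=> w; rewrite sqr_ge0 /=.
have sqr_le (y : R) : y ^+ 2 <= 2 * (expR y + expR (- y)).
  wlog y0 : y / 0 <= y => [H|].
    have [y0|/ltW y0] := lerP 0 y; first exact: H.
    by have := H (- y); rewrite sqrrN opprK oppr_ge0 (addrC (expR _)) => /(_ y0).
  have := expR_ge1Dxn 1 y0; have := expR_ge0 (- y).
  by rewrite (_ : 2`!%:R = 2 :> R) //; lra.
have := sqr_le (X a w / sigma); rewrite expr_div_n ler_pdivrMr //.
by congr (_ <= _); ring.
Qed.

End subgaussian.

End expectation_bounds.

(** * Tensor products of the one-dimensional systems *)

Section tensor_system.
Context {R : realType} {d n : nat}.
Variables (rho : R) (x : 'I_n -> 'I_d -> R) (nk : 'I_d -> nat) (u : 'I_d -> nat -> R) (A : nat).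
Hypotheses (rho0 : 0 < rho) (A0 : (0 < A)%N) (rhoA : rho <= A%:R).
Hypothesis design : lattice_design rho x nk u.

Let B : R := 8 + 16 / rho.

Let B0 : 0 <= B. Proof. by rewrite addr_ge0 // divr_ge0 // ltW. Qed.

Lemma lattice_design_mono k i j : (i <= j)%N -> (j < nk k)%N -> u k i <= u k j.
Proof.
have [_ _ /(_ k)[_ _ inc _ _]] := design.
elim: j => [|j IH]; first by rewrite leqn0 => /eqP->.
rewrite leq_eqVlt => /predU1P[->//|]; rewrite ltnS => ij jn.
by apply: le_trans (IH ij (ltnW jn)) _; apply/ltW/(inc j.+1).
Qed.

Lemma lattice_design_unit k i : (i < nk k)%N -> 0 <= u k i <= 1.
Proof.
move=> ik; have [_ _ /(_ k)[nk2 u0 _ u1 _]] := design.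
rewrite -{1}u0 lattice_design_mono //=; apply: le_trans u1.
by apply: lattice_design_mono; case: (nk k) ik nk2.
Qed.

Lemma lattice_design_inj k i j : (i < nk k)%N -> (j < nk k)%N -> u k i = u k j -> i = j.
Proof.
have [_ _ /(_ k)[nk2 _ inc _ _]] := design.
have H a b : (a < b)%N -> (b < nk k)%N -> u k a < u k b.
  case: b => // b; rewrite ltnS => ab bn.
  by apply: le_lt_trans (lattice_design_mono ab (ltnW bn)) _; exact: (inc b.+1).
move=> ik jk e; case: (ltngtP i j) => // h; exfalso.
  by have := H _ _ h jk; rewrite e ltxx.
by have := H _ _ h ik; rewrite e ltxx.
Qed.

Lemma lattice_design_coord l k : exists2 i, (i < nk k)%N & x l k = u k i.
Proof.
have [_ xE _] := design.
have : range x (x l) by exists l.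
by rewrite xE => /(_ k).
Qed.

Lemma lattice_design_cube l : unit_cube (x l).
Proof. by move=> k; have [i ik ->] := lattice_design_coord l k; exact: lattice_design_unit. Qed.

(** The grading is by total level. Index types are widened to ranges common to all coordinates, and
    [V] marks the genuine indices. The last clause handles the origin, where [nu] may carry
    uncontrolled mass. *)
Lemma tensor_system (alpha : {set 'I_d}) : (0 < #|alpha|)%N ->
  exists (I : finType) (lev : I -> nat) (V : pred I) (phi : I -> 'I_n -> R)
      (c : I -> #|alpha|.-tuple R -> R),
  [/\ forall t l, @ho_cube R #|alpha| t -> hinge_prod (x l) t = \sum_p c p t * phi p l,
      forall t j, @ho_cube R #|alpha| t ->
        \sum_(p | lev p == j) `|c p t| <= j.+1%:R ^+ #|alpha|.-1,
      forall j, \sum_(p | (lev p == j) && V p) 1 <= j.+1%:R ^+ #|alpha|.-1 * A%:R ^+ #|alpha| * 2 ^+ j :> R,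
      forall p, dot (phi p) (phi p) <= B ^+ #|alpha| * n%:R * 8 ^- lev p &
      (forall p t, ~~ V p -> c p t = 0) /\
      (forall p t, (forall i, tnth t i = 0) -> (0 < lev p)%N -> c p t = 0)].
Proof.
move=> m0; have [nE xE dk] := design.
have sys k : exists (Mcp : nat * (nat -> nat -> R -> R) * (nat -> nat -> R -> R)),
  let: (M, c, phi) := Mcp in
  [/\ forall M' l t, (M <= M')%N -> (l < nk k)%N -> 0 <= t <= 1 -> Num.max (u k l - t) 0 =
        \sum_(j < M') \sum_(i < A * 2 ^ j) c j i t * phi j i (u k l),
      forall j t, 0 <= t <= 1 -> \sum_(i < A * 2 ^ j) `|c j i t| <= 1,
      forall j i, \sum_(l < nk k) phi j i (u k l) ^+ 2 <= B * (nk k)%:R * 8 ^- j,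
      forall i y, phi 0%N i y = y & forall j i, c j.+1 i 0 = 0].
  have [nk2 _ _ _ gap] := dk k.
  have nk0 : (0 < nk k)%N by exact: ltnW.
  have [M [c [phi H]]] := hinge_system rho0 nk0 A0 rhoA (@lattice_design_unit k) gap.
  by exists (M, c, phi).
have [F HF] := choice sys.
pose Mk k := (F k).1.1; pose ck k := (F k).1.2; pose pk k := (F k).2.
have {}HF k : [/\ forall M' l t, (Mk k <= M')%N -> (l < nk k)%N -> 0 <= t <= 1 -> Num.max (u k l - t) 0 =
        \sum_(j < M') \sum_(i < A * 2 ^ j) ck k j i t * pk k j i (u k l),
      forall j t, 0 <= t <= 1 -> \sum_(i < A * 2 ^ j) `|ck k j i t| <= 1,
      forall j i, \sum_(l < nk k) pk k j i (u k l) ^+ 2 <= B * (nk k)%:R * 8 ^- j,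
      forall i y, pk k 0%N i y = y & forall j i, ck k j.+1 i 0 = 0].
  by rewrite /Mk /ck /pk; have := HF k; case: (F k) => [[]].
pose M := (\max_k Mk k)%N.
have MkM k : (Mk k <= M)%N by exact: leq_bigmax.
pose K := (A * 2 ^ M)%N.
pose m := #|alpha|; pose J := ('I_M * 'I_K)%type.
pose I : finType := {ffun 'I_m -> J}.
pose lv (q : J) : nat := q.1.
pose vd (q : J) := (q.2 < A * 2 ^ q.1)%N.
have AK (j : 'I_M) : (A * 2 ^ j <= K)%N by rewrite /K leq_pmul2l // leq_exp2l // ltnW.
pose kk (i : 'I_m) : 'I_d := enum_val i.
pose cc (i : 'I_m) (q : J) (t : R) : R := if vd q then ck (kk i) q.1 q.2 t else 0.
have sumJ (G : nat -> nat -> R) (j : 'I_M) :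
    \sum_(q : J | q.1 == j) (if vd q then G q.1 q.2 else 0) = \sum_(i < A * 2 ^ j) G j i.
  rewrite (big_ord_widen K (G j) (AK j)) [RHS]big_mkcond /=.
  transitivity (\sum_(a | a == j) \sum_(b : 'I_K) (if vd (a, b) then G a b else 0)).
    by rewrite pair_big /=; apply: eq_big => [[a b]|[a b] _] //=; rewrite andbT.
  by rewrite big_pred1_eq.
have sumJ' (G : nat -> nat -> R) (j : nat) :
    \sum_(q : J | lv q == j) (if vd q then G q.1 q.2 else 0) =
    if (j < M)%N then \sum_(i < A * 2 ^ j) G j i else 0.
  case: ltnP => jM; first by rewrite -(sumJ G (Ordinal jM)); apply: eq_bigl.
  rewrite big_pred0 // => q; apply/negbTE; rewrite neq_ltn (leq_trans _ jM) //.
  by rewrite /lv ltn_ord.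
have mE : #|alpha| = #|alpha|.-1.+1 by rewrite prednK.
exists I, (fun p : I => (\sum_i lv (p i))%N), (fun p : I => [forall i, vd (p i)]),
  (fun (p : I) l => \prod_i pk (kk i) (p i).1 (p i).2 (x l (kk i))),
  (fun (p : I) t => \prod_i cc i (p i) (tnth t i)).
have graded (W : 'I_m -> J -> R) (X Y : R) : 0 <= X -> 0 <= Y -> (forall i q, 0 <= W i q) ->
    (forall i j, \sum_(q | lv q == j) W i q <= X * Y ^+ j) -> forall j,
    \sum_(p : I | (\sum_i lv (p i) == j)%N) \prod_i W i (p i) <= j.+1%:R ^+ m.-1 * X ^+ m * Y ^+ j.
  rewrite /I; move: W; rewrite /m mE => W X0 Y0 W0 H j.
  exact: graded_product_bound.
split.
- move=> t l Dt; rewrite /hinge_prod.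
  transitivity (\prod_i \sum_(q : J) cc i q (tnth t i) * pk (kk i) q.1 q.2 (x l (kk i))).
    apply: eq_bigr => i _; have [a ak xa] := lattice_design_coord l (kk i).
    have /andP[t0 t1] := Dt i.
    have [H _ _ _ _] := HF (kk i).
    rewrite -/(kk i) xa (H M a) ?t0 ?(ltW t1) //.
    rewrite (partition_big (fun q : J => q.1) xpredT) //=.
    apply: eq_bigr => j _.
    rewrite -(sumJ (fun j k => ck (kk i) j k (tnth t i) * pk (kk i) j k (u (kk i) a)) j).
    by apply: eq_bigr => q _; rewrite /cc; case: ifP => //; rewrite mul0r.
  by rewrite bigA_distr_bigA; apply: eq_bigr => p _; rewrite -big_split.
- move=> t j Dt.
  rewrite (eq_bigr (fun p : I => \prod_i `|cc i (p i) (tnth t i)|)); last first.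
    by move=> p _; rewrite normr_prod.
  have := graded (fun i q => `|cc i q (tnth t i)|) 1 1 ler01 ler01 _ _ j.
  rewrite !expr1n !mulr1; apply=> // i a; rewrite expr1n mulr1.
  rewrite (eq_bigr (fun q : J => if vd q then `|ck (kk i) q.1 q.2 (tnth t i)| else 0)); last first.
    by move=> q _; rewrite /cc; case: ifP; rewrite ?normr0.
  rewrite (sumJ' (fun j k => `|ck (kk i) j k (tnth t i)|)); case: ifP => // _.
  have [_ H _ _ _] := HF (kk i); apply: H.
  by have /andP[-> /ltW] := Dt i.
- move=> j.
  rewrite big_mkcondr /=.
  rewrite (eq_bigr (fun p : I => \prod_i (if vd (p i) then 1 else 0 : R))); last first.
    move=> p _; case: forallP => [h|/forallP]; first by rewrite big1 // => i _; rewrite h.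
    by rewrite negb_forall => /existsP[i /negPf hi]; rewrite (bigD1 i) //= hi mul0r.
  apply: (graded (fun _ q => if vd q then 1 else 0)) => // [i q|i a]; first by case: ifP.
  rewrite (sumJ' (fun _ _ => 1)); case: ifP => _; last by rewrite mulr_ge0 // exprn_ge0.
  by rewrite sumr_const card_ord natrM natrX.
- move=> p; rewrite /dot.
  (* An empty product for [k] outside [alpha]: such a coordinate contributes only [n_k], and these
     factors multiply up to [n]. *)
  pose G k y : R := \prod_(i | kk i == k) pk (kk i) (p i).1 (p i).2 y ^+ 2.
  rewrite (eq_bigr (fun l => \prod_k G k (x l k))); last first.
    move=> l _; rewrite -expr2 -prodrXl (partition_big kk xpredT) //=.
    by apply: eq_bigr => k _; apply: eq_bigr => i /eqP ->.
  rewrite (lattice_sum G nE xE); last by move=> k i j; exact: lattice_design_inj.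
  apply: (@le_trans _ _ (\prod_k ((nk k)%:R * \prod_(i | kk i == k) (B * 8 ^- (p i).1)))).
    apply: ler_prod => k _; apply/andP; split.
      by apply: sumr_ge0 => l _; apply: prodr_ge0 => i _; exact: sqr_ge0.
    have [i0 /eqP ki0|none] := pickP (fun i => kk i == k); last first.
      rewrite [in leRHS]big_pred0 // mulr1 (eq_bigr (fun=> 1)); last first.
        by move=> l _; rewrite /G big_pred0.
      by rewrite sumr_const card_ord.
    have uniq i : (kk i == k) = (i == i0).
      by rewrite -ki0; apply/eqP/eqP => [/enum_val_inj|->].
    rewrite (big_pred1 i0) // /G.
    under eq_bigr => l _ do rewrite (big_pred1 i0) //.
    have [_ _ H _ _] := HF (kk i0).
    rewrite -ki0; apply: le_trans (H _ _) _.
    by rewrite le_eqVlt; apply/orP; left; apply/eqP; ring.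
  rewrite big_split /= -natr_prod -nE.
  have -> : \prod_k \prod_(i | kk i == k) (B * 8 ^- (p i).1) = \prod_i (B * 8 ^- (p i).1).
    by rewrite [RHS](partition_big kk xpredT).
  rewrite big_split /=.
  rewrite prodr_const card_ord prodfV prodrXr.
  by rewrite le_eqVlt; apply/orP; left; apply/eqP; ring.
- split=> [p t|p t t0].
  + rewrite negb_forall => /existsP[i hi]; rewrite (bigD1 i) //= /cc (negPf hi) mul0r //.
  + rewrite lt0n sum_nat_eq0 negb_forall => /existsP[i /= hi].
    rewrite (bigD1 i) //= /cc; case: ifP => _; last by rewrite mul0r.
    have [_ _ _ _ H] := HF (kk i).
    rewrite t0; move: hi; rewrite /lv; case: (nat_of_ord (p i).1) => // j _.
    by rewrite H mul0r.
Qed.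

End tensor_system.

(** * Balancing dimension against tail *)

Section rate.
Context {R : realType}.

Lemma ln2_ge_half : 2^-1 <= ln 2 :> R.
Proof. by rewrite -ler_expR lnK ?posrE // expR_half_le2. Qed.

Lemma head_sum (m J : nat) :
  \sum_(j < J.+1) j.+1%:R ^+ m * 2 ^+ j <= J.+1%:R ^+ m * 2 ^+ J.+1 :> R.
Proof.
apply: (@le_trans _ _ (\sum_(j < J.+1) J.+1%:R ^+ m * 2 ^+ j)).
  apply: ler_sum => j _; apply: ler_wpM2r; first by rewrite exprn_ge0.
  by apply: lerXn2r; rewrite ?nnegrE // ler_nat.
rewrite -mulr_sumr; apply: ler_wpM2l; first by rewrite exprn_ge0.
have : \sum_(j < J.+1) 2 ^+ j = 2 ^+ J.+1 - 1 :> R.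
  elim: J => [|J IH]; first by rewrite big_ord1 expr0 expr1; lra.
  by rewrite big_ord_recr /= IH [in RHS]exprS; lra.
by move=> ->; lra.
Qed.

(** [8^(-1/2)]: the norm of a function of level [j] is of order [n^(1/2)] times the [j]-th power of
    this. *)
Definition decay : R := (Num.sqrt 8)^-1.

Lemma decay_gt0 : 0 < decay.
Proof. by rewrite invr_gt0 sqrtr_gt0. Qed.

Lemma decay_sqr : decay ^+ 2 = 8^-1.
Proof. by rewrite exprVn sqr_sqrtr. Qed.

Lemma decay_lt_half : 2 * decay < 1.
Proof. by have := decay_sqr; have := decay_gt0; nra. Qed.

Lemma tail_sum (m : nat) : exists2 S : R, 0 < S & forall J L,
  \sum_(j < L | (J < j)%N) j.+1%:R ^+ m * decay ^+ j <= S * (J.+1%:R ^+ m * decay ^+ J).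
Proof.
have q0 := decay_gt0; have q1 := decay_lt_half.
pose r := 2 * decay; have r0 : 0 < r by rewrite mulr_gt0.
have r1 : 0 < 1 - r by rewrite subr_gt0.
pose K : R := (2 * m.+1)%:R ^+ m.+1.
have K0 : 0 < K by rewrite exprn_gt0 // ltr0n.
(* The inequality [1 + y <= e^y] at [y = i / (2 (m + 1))], raised to the power [m + 1], leaves
   [e^(i/2) <= 2^i]. *)
have poly i : i.+1%:R ^+ m <= K * 2 ^+ i :> R.
  pose e : R := expR (2 * m.+1)%:R^-1.
  have e0 : 0 < e by exact: expR_gt0.
  have h1 : i.+1%:R <= (2 * m.+1)%:R * e ^+ i :> R.
    have := @expR_ge1Dx R (i%:R / (2 * m.+1)%:R).
    rewrite /e -expRM_natl => h.
    apply: (@le_trans _ _ ((2 * m.+1)%:R * (1 + i%:R / (2 * m.+1)%:R))); last first.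
      by rewrite ler_pM2l ?ltr0n // mulrC // (le_trans h) // ler_expR mulrC.
    rewrite mulrDr mulr1 mulrC divfK ?pnatr_eq0 // -natrD ler_nat.
    by rewrite mulSn; lia.
  have h2 : e ^+ m.+1 <= 2.
    rewrite /e -expRM_natl (_ : _ * _ = 2^-1); first exact: expR_half_le2.
    by rewrite natrM invfM mulrCA mulfV ?mulr1 // pnatr_eq0.
  apply: (@le_trans _ _ (i.+1%:R ^+ m.+1)).
    by rewrite exprS ler_peMl ?exprn_ge0 // ler1n.
  apply: (@le_trans _ _ (((2 * m.+1)%:R * e ^+ i) ^+ m.+1)).
    by apply: lerXn2r; rewrite ?nnegrE // mulr_ge0 // exprn_ge0 // ltW.
  rewrite exprMn -exprM (mulnC i) exprM ler_pM2l //.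
  by apply: lerXn2r; rewrite ?nnegrE // exprn_ge0 // ltW.
exists (K / (1 - r)); first by rewrite divr_gt0.
move=> J L.
pose f j : R := j.+1%:R ^+ m * decay ^+ j.
pose c := J.+1%:R ^+ m * decay ^+ J.
have c0 : 0 < c by rewrite mulr_gt0 ?exprn_gt0 ?ltr0n.
have fle i : f (J + i)%N <= c * (K * r ^+ i).
  have h : (J + i).+1%:R ^+ m <= J.+1%:R ^+ m * i.+1%:R ^+ m :> R.
    rewrite -exprMn; apply: lerXn2r; rewrite ?nnegrE ?mulr_ge0 // -natrM ler_nat; lia.
  rewrite /f exprD /c.
  have -> : J.+1%:R ^+ m * decay ^+ J * (K * r ^+ i) =
     (J.+1%:R ^+ m * (K * 2 ^+ i)) * (decay ^+ J * decay ^+ i) by rewrite /r exprMn; ring.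
  apply: ler_wpM2r; first by rewrite mulr_ge0 // exprn_ge0 // ltW.
  by apply: le_trans h _; apply: ler_wpM2l; [rewrite exprn_ge0|exact: poly].
have H n : \sum_(j < J + n | (J < j)%N) f j <= c * K * ((1 - r ^+ n) / (1 - r)).
  elim: n => [|n IH].
    rewrite expr0 subrr mul0r mulr0 addn0 big_pred0 // => j.
    by rewrite ltnNge ltnW.
  rewrite addnS big_mkcond big_ord_recr /= -big_mkcond /=.
  apply: (@le_trans _ _ (c * K * ((1 - r ^+ n) / (1 - r)) + c * (K * r ^+ n))).
    apply: lerD => //; case: ifP => _; first exact: fle.
    by rewrite !mulr_ge0 ?exprn_ge0 // ltW.
  rewrite le_eqVlt; apply/orP; left; apply/eqP; rewrite exprS; field.
  by rewrite lt0r_neq0.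
have [LJ|JL] := leqP L J.
  rewrite big_pred0; first by rewrite mulr_ge0 // ltW // divr_gt0.
  by move=> j; apply/negbTE; rewrite -leqNgt (leq_trans (ltnW (ltn_ord j))).
have := H (L - J)%N; rewrite subnKC ?(ltnW JL) // => {}H.
apply: le_trans H _.
rewrite (_ : K / (1 - r) * _ = c * K * (1 / (1 - r))); last by rewrite -/c; field; rewrite lt0r_neq0.
apply: ler_wpM2l; first by rewrite mulr_ge0 // ltW.
by apply: ler_wpM2r; [rewrite invr_ge0 ltW|rewrite gerBl exprn_ge0 // ltW].
Qed.

Lemma one_le_powR2 (y : R) : 0 <= y -> 1 <= 2 `^ y.
Proof. by move=> y0; rewrite -[leLHS](powRr0 2); apply: ler_powR => //; rewrite ler1n. Qed.

(** The 1 in [b] covers small [M], where [J = 0] already works. Otherwise the logarithm collects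
    [s - 1] from the hyperbolic cross and [2/5] from [2 ^ J], at most the exponent stated. *)
Lemma rate_choice (s : nat) : (0 < s)%N -> exists2 K : R, 0 < K & forall M, 0 < M ->
  exists J : nat, let b := 1 + M `^ (2 / 5) * ln (2 + M) `^ (3 * (2 * s%:R - 1) / 5) in
    J.+1%:R ^+ s.-1 * 2 ^+ J <= K * b /\ M * (J.+1%:R ^+ s * decay ^+ J) <= K * b.
Proof.
move=> s0; pose e : R := 3 * (2 * s%:R - 1) / 5.
have s1 : 1 <= s%:R :> R by rewrite ler1n.
pose K : R := 2 * 6 ^+ s * 2 `^ e.
have t1 : 1 <= 2 `^ e.
  by apply: one_le_powR2; rewrite /e divr_ge0 // mulr_ge0 //; lra.
have six : 1 <= 6 ^+ s :> R by rewrite exprn_ege1 // ler1n.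
have K2 : 2 <= K by have := mulr_ege1 six t1; rewrite /K -mulrA; lra.
exists K; first by lra.
move=> M M0; have [L LE] : exists L, L = ln (2 + M) by eexists.
rewrite -LE.
have L2 : 2^-1 <= L.
  rewrite LE; apply: le_trans ln2_ge_half _; rewrite ler_ln ?posrE //; lra.
have L0 : 0 < L by lra.
have ML0 : 0 < M * L by rewrite mulr_gt0.
(* The least such J balances the two bounds: 2^J is of order (M L)^(2/5). *)
have ex : exists J, (fun J => (M * L) ^+ 2 <= 32 ^+ J) J.
  exists (Num.bound ((M * L) ^+ 2)); apply: le_trans (ltW (archi_boundP _)) _.
    exact: sqr_ge0.
  by rewrite -natrX ler_nat ltnW // ltn_expl.
have [J hJ minJ] := ex_minnP ex.
exists J => b.
have b0 : 0 <= M `^ (2 / 5) * L `^ e by rewrite mulr_ge0 // powR_ge0.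
case: J hJ minJ => [|j] hJ minJ.
  have ML1 : M * L <= 1.
    by move: hJ; rewrite expr0 => h; rewrite -(@ler_pXn2r _ 2) ?nnegrE ?expr1n // ltW.
  rewrite expr1n !mul1r expr0 mulr1 expr1n mulr1.
  have M2 : M <= 2 by nra.
  by split; rewrite /b -/e; nra.
have hj : 32 ^+ j < (M * L) ^+ 2.
  by rewrite ltNge; apply/negP => /minJ; rewrite ltnn.
(* Here [J] is [j.+1]. Logarithms are taken in [32^j < (M L)^2 <= (2 + M)^4]. *)
have jL : j.+2%:R <= 6 * L.
  have : (M * L) ^+ 2 <= (2 + M) ^+ 4.
    have LM : L <= 2 + M.
      by have := @expR_ge1Dx R L; rewrite LE lnK ?posrE -?LE; lra.
    rewrite (_ : 4 = 2 * 2)%N // exprM; apply: lerXn2r; rewrite ?nnegrE ?sqr_ge0 ?(ltW ML0) //.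
    rewrite expr2; apply: ler_pM => //; lra.
  move/(lt_le_trans hj); rewrite -ltr_ln ?posrE ?exprn_gt0 //; last lra.
  have -> : ln ((2 + M) ^+ 4) = L *+ 4 by rewrite LE lnXn //; lra.
  have -> : ln (32 ^+ j) = (ln 2 *+ 5) *+ j :> R.
    have -> : 32 = 2 ^+ 5 :> R by rewrite -natrX.
    by rewrite lnXn ?exprn_gt0 // lnXn.
  rewrite -[X in X < _]mulr_natl => h; have h2 := ln2_ge_half.
  have : j%:R * (5 * 2^-1) <= j%:R * (ln 2 *+ 5) :> R by apply: ler_wpM2l => //; lra.
  rewrite -addn2 natrD; lra.
(* [P ^+ 2] is the exact balance point, between [2 ^+ j] and [2 ^+ j.+1]; at it
   [M L / P^3 = P^2]. *)
pose P := (M * L) `^ 5^-1.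
have P0 : 0 < P by rewrite powR_gt0.
have P5 : P ^+ 5 = M * L.
  by rewrite /P -powR_mulrn ?powR_ge0 // -powRrM mulVf // powRr1 // ltW.
have P2j : 2 ^+ j <= P ^+ 2.
  rewrite -(@ler_pXn2r _ 5) ?nnegrE ?exprn_ge0 ?(ltW P0) //.
  rewrite -!exprM mulnC exprM (mulnC 2%N) exprM P5 -natrX; exact: ltW.
have P2J : P ^+ 2 <= 2 ^+ j.+1.
  rewrite -(@ler_pXn2r _ 5) ?nnegrE ?exprn_ge0 ?(ltW P0) //.
  have -> : (P ^+ 2) ^+ 5 = (M * L) ^+ 2 by rewrite -P5 -!exprM.
  have -> : (2 ^+ j.+1) ^+ 5 = 32 ^+ j.+1 :> R by rewrite -exprM mulnC exprM -natrX.
  exact: hJ.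
have qP : decay ^+ j.+1 <= P ^- 3.
  have q0 := ltW decay_gt0.
  rewrite -(@ler_pXn2r _ 2) ?nnegrE ?exprn_ge0 ?invr_ge0 ?exprn_ge0 ?(ltW P0) //.
  have -> : (decay ^+ j.+1) ^+ 2 = ((2 ^+ j.+1) ^+ 3)^-1.
    rewrite -exprM mulnC exprM decay_sqr exprVn; congr (_^-1); apply/esym.
    by rewrite -exprM mulnC exprM -natrX.
  have -> : (P ^- 3) ^+ 2 = ((P ^+ 2) ^+ 3)^-1 by rewrite exprVn -!exprM.
  rewrite lef_pV2 ?posrE ?exprn_gt0 //.
  by apply: lerXn2r; rewrite ?nnegrE ?exprn_ge0 ?(ltW P0).
have P2E : P ^+ 2 = M `^ (2 / 5) * L `^ (2 / 5).
  rewrite /P -powR_mulrn ?powR_ge0 // -powRrM (_ : 5^-1 * 2%:R = 2 / 5); last by rewrite mulrC.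
  by rewrite powRM // ltW.
pose a : R := s.-1%:R + 2 / 5.
have aE : L ^+ s.-1 * L `^ (2 / 5) = L `^ a.
  rewrite -powR_mulrn ?(ltW L0) // -powRD // gt_eqF ?implybT //.
have sE : s%:R = s.-1%:R + 1 :> R by rewrite natr1 prednK.
(* [L] may be below 1, so exponents are compared for [2 L >= 1]; this is the factor [2 ^ e] in
   [K]. *)
have Lae : L `^ a <= 2 `^ e * L `^ e.
  rewrite -powRM ?(ltW L0) //.
  apply: (@le_trans _ _ ((2 * L) `^ a)).
    rewrite powRM ?(ltW L0) // ler_peMl ?powR_ge0 //.
    by apply: one_le_powR2; rewrite /a addr_ge0.
  apply: ler_powR; first by lra.
  have : 0 <= s.-1%:R :> R by [].
  by rewrite /a /e sE; lra.
have main : 2 * 6 ^+ s * (L ^+ s.-1 * P ^+ 2) <= K * b.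
  rewrite P2E (mulrCA (L ^+ _)) aE.
  apply: (@le_trans _ _ (2 * 6 ^+ s * (M `^ (2 / 5) * (2 `^ e * L `^ e)))).
    apply: ler_wpM2l; first by rewrite mulr_ge0 // exprn_ge0.
    by apply: ler_wpM2l => //; exact: powR_ge0.
  rewrite /K (_ : _ * (_ * (_ * _)) = 2 * 6 ^+ s * 2 `^ e * (M `^ (2 / 5) * L `^ e)); last by ring.
  apply: ler_wpM2l; first by rewrite !mulr_ge0 ?exprn_ge0 ?powR_ge0.
  by rewrite /b -/e lerDr.
have P20 : 0 <= P ^+ 2 by exact: sqr_ge0.
have Ls0 m : 0 <= L ^+ m by rewrite exprn_ge0 // ltW.
have j6 m : j.+2%:R ^+ m <= 6 ^+ m * L ^+ m.
  by rewrite -exprMn; apply: lerXn2r; rewrite ?nnegrE // mulr_ge0 // ltW.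
split; apply: le_trans main.
  apply: (@le_trans _ _ (6 ^+ s.-1 * L ^+ s.-1 * (2 * P ^+ 2))).
    apply: ler_pM; rewrite ?exprn_ge0 // exprS; apply: ler_wpM2l => //.
  have : 6 ^+ s.-1 <= 6 ^+ s :> R by rewrite -{2}(prednK s0) exprS ler_peMl ?exprn_ge0 // ler1n.
  move=> h; rewrite (_ : _ * _ = 6 ^+ s.-1 * (2 * (L ^+ s.-1 * P ^+ 2))); last by ring.
  rewrite (_ : 2 * 6 ^+ s * _ = 6 ^+ s * (2 * (L ^+ s.-1 * P ^+ 2))); last by ring.
  by apply: ler_wpM2r => //; apply: mulr_ge0 => //; apply: mulr_ge0.
apply: (@le_trans _ _ (M * (6 ^+ s * L ^+ s * P ^- 3))).
  rewrite ler_pM2l //; apply: ler_pM => //.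
  by rewrite exprn_ge0 // ltW // decay_gt0.
rewrite (_ : M * _ = 6 ^+ s * (L ^+ s.-1 * P ^+ 2)); last first.
  have -> : L ^+ s = L * L ^+ s.-1 by rewrite -exprS prednK.
  rewrite (_ : M * _ = 6 ^+ s * L ^+ s.-1 * ((M * L) / P ^+ 3)); last by ring.
  by rewrite -P5; field; rewrite lt0r_neq0.
rewrite -mulrA ler_peMl //; last by rewrite ler1n.
by rewrite mulr_ge0 ?exprn_ge0 // mulr_ge0.
Qed.

(** Both sides are monomials in positive quantities, so logarithms make this a linear identity. *)
Lemma rate_rewrite (V sigma : R) (n : nat) : 0 < V -> 0 < sigma -> (0 < n)%N ->
  sigma ^+ 2 / n%:R * (V * n%:R `^ (1 / 2) / sigma) `^ (2 / 5) =
  (sigma ^+ 2 * V `^ (1 / 2) / n%:R) `^ (4 / 5).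
Proof.
move=> V0 s0 n0; have n0' : 0 < n%:R :> R by rewrite ltr0n.
have p1 : 0 < V * n%:R `^ (1 / 2) / sigma by rewrite divr_gt0 // mulr_gt0 // powR_gt0.
have p2 : 0 < sigma ^+ 2 * V `^ (1 / 2) / n%:R.
  by rewrite divr_gt0 // mulr_gt0 ?exprn_gt0 // powR_gt0.
have p3 : 0 < sigma ^+ 2 / n%:R by rewrite divr_gt0 // exprn_gt0.
have s2 : 0 < sigma ^+ 2 by rewrite exprn_gt0.
have q1 := powR_gt0 (1 / 2) n0'; have q2 := powR_gt0 (1 / 2) V0.
have ls : ln (sigma ^+ 2) = 2 * ln sigma by rewrite lnXn // mulr_natl.
have E1 : ln (V * n%:R `^ (1 / 2) / sigma) = ln V + 1 / 2 * ln n%:R - ln sigma.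
  by rewrite lnM ?posrE ?invr_gt0 ?mulr_gt0 // lnM ?posrE // lnV ?posrE // ln_powR.
have E2 : ln (sigma ^+ 2 * V `^ (1 / 2) / n%:R) = 2 * ln sigma + 1 / 2 * ln V - ln n%:R.
  by rewrite lnM ?posrE ?invr_gt0 ?mulr_gt0 // lnM ?posrE // lnV ?posrE // ln_powR ls.
have E3 : ln (sigma ^+ 2 / n%:R) = 2 * ln sigma - ln n%:R.
  by rewrite lnM ?posrE ?invr_gt0 // lnV ?posrE // ls.
apply: ln_inj; [by rewrite posrE mulr_gt0 // powR_gt0|by rewrite posrE powR_gt0|].
rewrite lnM ?posrE ?powR_gt0 // E3 !ln_powR E1 E2.
by move: (ln V) (ln sigma) (ln n%:R) => a b c; lra.
Qed.

(** Absorbs the additive 1 of [rate_choice] into the [log^2 n] term of the risk bound. *)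
Lemma one_le_ln_sqr (n : nat) : (2 <= n)%N -> 1 <= 4 * ln n%:R ^+ 2 :> R.
Proof.
move=> n2; have h : 2^-1 <= ln n%:R :> R.
  by apply: le_trans ln2_ge_half _; rewrite ler_ln ?posrE ?ltr0n ?ler_nat // ltnW.
by nra.
Qed.

End rate.

(** * Supremum of the noise over residuals of hinges *)

Section noise_bound.
Context {R : realType} {n : nat}.

Definition residual (es : seq ('I_n -> R)) (v : 'I_n -> R) : 'I_n -> R :=
  fun i => v i - proj es v i.

Lemma dot_residual_expand es z h (I : finType) (a : I -> R) (phi : I -> 'I_n -> R) :
  (forall l, h l = \sum_p a p * phi p l) ->
  dot z (residual es h) = \sum_p a p * dot z (residual es (phi p)).
Proof.
move=> hE; rewrite /residual -dot_res_sym dotC.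
have -> : h = (fun l => \sum_p a p * phi p l) by apply/funext.
rewrite dot_suml; apply: eq_bigr => p _.
by rewrite (dotZl _ (phi p)) dotC dot_res_sym.
Qed.

Variables (d : measure_display) (T : measurableType d) (P : probability T R).
Variables (xi : 'I_n -> {RV P >-> R}) (sigma : R).
Hypotheses (ind : mutually_independent xi) (sub : forall i, sub_gaussian sigma (xi i)).
Hypothesis sigma0 : 0 < sigma.

Let noise w : 'I_n -> R := fun i => xi i w.

(** [Rb] is free of [t], hence bounds the supremum. Levels up to [J] have zero residual; a higher
    level costs its [l^1] norm [(j+1)^(m-1)] times the maximum of the noise over its functions, of
    mean order [tau j] times [j + 1]. This accounts for the power [m]. *)
Lemma system_noise_bound (m A : nat) (B S : R) (U : Type) (D : set U) (h : U -> 'I_n -> R)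
    (I : finType) (lev : I -> nat) (V : pred I) (phi : I -> 'I_n -> R) (c : I -> U -> R)
    (es : seq ('I_n -> R)) (J : nat) :
  (0 < m)%N -> (0 < n)%N -> 0 < B ->
  (forall J L, \sum_(j < L | (J < j)%N) j.+1%:R ^+ m * decay ^+ j <=
     S * (J.+1%:R ^+ m * decay ^+ J)) ->
  (forall t l, D t -> h t l = \sum_p c p t * phi p l) ->
  (forall t j, D t -> \sum_(p | lev p == j) `|c p t| <= j.+1%:R ^+ m.-1) ->
  (forall j, \sum_(p | (lev p == j) && V p) 1 <= j.+1%:R ^+ m.-1 * A%:R ^+ m * 2 ^+ j :> R) ->
  (forall p, dot (phi p) (phi p) <= B ^+ m * n%:R * 8 ^- lev p) ->
  (forall p t, ~~ V p -> c p t = 0) ->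
  (forall v, dot (residual es v) (residual es v) <= dot v v) ->
  (forall p, V p -> (lev p <= J)%N -> proj es (phi p) = phi p) ->
  exists2 Rb : T -> R,
    mean_le P Rb ((m * A.+1 + 4)%:R * S * Num.sqrt (B ^+ m) * sigma * Num.sqrt n%:R *
       (J.+1%:R ^+ m * decay ^+ J)) &
    forall w t, D t -> `|dot (noise w) (residual es (h t))| <= Rb w.
Proof.
move=> m0 n0 B0 HS hE csum card phi2 cV bessel low.
have q0 := @decay_gt0 R.
have n0' : 0 < n%:R :> R by rewrite ltr0n.
pose tau j : R := sigma * Num.sqrt (B ^+ m * n%:R) * decay ^+ j.
have s0 : 0 < Num.sqrt (B ^+ m * n%:R) by rewrite sqrtr_gt0 mulr_gt0 // exprn_gt0.
have tau0 j : 0 < tau j by rewrite !mulr_gt0 // exprn_gt0.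
have tau2 j : tau j ^+ 2 = sigma ^+ 2 * (B ^+ m * n%:R * 8 ^- j).
  rewrite !exprMn sqr_sqrtr; last by rewrite mulr_ge0 // exprn_ge0 // ltW.
  by rewrite -exprM mulnC exprM decay_sqr exprVn mulrA.
(* A crude bound on the logarithm of the number of functions, from [j + 1 <= 2^j] and [A <= 2^A];
   only linearity in [j + 1] matters. *)
pose Lam j : R := (m * A.+1 * j.+1)%:R.
have count j : \sum_(p | (lev p == j) && V p) 1 <= expR (Lam j).
  apply: le_trans (card j) _.
  have e1 : 2 <= expR 1 :> R by have := @expR_ge1Dx R 1; lra.
  apply: (@le_trans _ _ (2 ^+ (m * A.+1 * j.+1))); last first.
    rewrite /Lam -[X in expR X]mulr1 expRM_natl.
    by apply: lerXn2r; rewrite ?nnegrE // expR_ge0.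
  rewrite -!natrX -!natrM ler_nat.
  apply: (@leq_trans ((2 ^ j) ^ m.-1 * (2 ^ A) ^ m * 2 ^ j)).
    have mono e a b : (a <= b)%N -> (a ^ e <= b ^ e)%N.
      by move=> ab; elim: e => // e IH; rewrite !expnS leq_mul.
    by rewrite !leq_mul // mono //; [exact: ltn_expl|exact/ltnW/ltn_expl].
  rewrite -!expnM -!expnD leq_exp2l //.
  by rewrite -{2 3}(prednK m0); nia.
pose X p w := dot (noise w) (residual es (phi p)).
pose cosh2 j p w : R := expR (X p w / tau j) + expR (- (X p w / tau j)).
(* As y <= Lam + exp (- Lam) exp y and exp Lam dominates the number of functions of
   level j, [E j w] dominates their maximum while its mean stays of order tau j * Lam j. *)
pose E j w : R := tau j * (Lam j + expR (- Lam j) * \sum_(p | (lev p == j) && V p) cosh2 j p w).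
have E0 j w : 0 <= E j w.
  rewrite mulr_ge0 ?(ltW (tau0 j)) // addr_ge0 // mulr_ge0 ?expR_ge0 // sumr_ge0 // => p _.
  by rewrite addr_ge0 ?expR_ge0.
have XE p w : V p -> `|X p w| <= E (lev p) w.
  move=> Vp; set j := lev p; pose y := `|X p w| / tau j.
  have -> : `|X p w| = tau j * y by rewrite /y mulrC divfK // lt0r_neq0.
  rewrite /E; apply: ler_wpM2l; first exact: ltW.
  have h1 : expR y <= cosh2 j p w.
    rewrite /cosh2 /y; have [X0|X0] := lerP 0 (X p w).
      by rewrite (ger0_norm X0) lerDl expR_ge0.
    by rewrite (ltr0_norm X0) mulNr lerDr expR_ge0.
  have h2 : cosh2 j p w <= \sum_(p | (lev p == j) && V p) cosh2 j p w.
    rewrite (bigD1 p) ?eqxx //= lerDl sumr_ge0 // => q _.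
    by rewrite addr_ge0 ?expR_ge0.
  have h3 : expR (- Lam j) * expR y <= expR (- Lam j) * \sum_(p | (lev p == j) && V p) cosh2 j p w.
    by apply: ler_wpM2l; [exact: expR_ge0|exact: le_trans h2].
  have := @expR_ge1Dx R (- Lam j + y); rewrite expRD => h4.
  by move: h3 h4; lra.
pose L := (\max_p lev p).+1.
have levL p : (lev p < L)%N by rewrite ltnS leq_bigmax.
pose lo p : 'I_L := Ordinal (levL p).
exists (fun w => \sum_(j < L | (J < j)%N) j.+1%:R ^+ m.-1 * E j w).
  have Em j : mean_le P (E j) (tau j * ((m * A.+1 + 4)%:R * j.+1%:R)).
    have M : mean_le P (E j) (tau j * (Lam j +
        expR (- Lam j) * \sum_(p | (lev p == j) && V p) 4)).
      apply: mean_leZ; first exact: ltW.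
      apply: mean_leD; first exact: mean_le_cst.
      apply: mean_leZ; first exact: expR_ge0.
      apply: mean_le_sum => p /andP[/eqP lp Vp].
      apply: (mean_le_cosh ind sub) => //.
      rewrite tau2 -lp; apply: ler_wpM2l; first exact: sqr_ge0.
      exact: le_trans (bessel _) (phi2 p).
    apply: mean_le_trans M _; apply: ler_wpM2l; first exact: ltW.
    rewrite natrD mulrDl -natrM; apply: lerD; first by [].
    apply: (@le_trans _ _ 4); last by rewrite ler_peMr // ler1n.
    rewrite -[X in _ * X](mulr1 _) -[leRHS]mulr1.
    rewrite (_ : \sum_(p | _) 4 = 4 * \sum_(p | (lev p == j) && V p) 1); last first.
      by rewrite mulr_sumr; apply: eq_bigr => p _; rewrite mulr1.
    rewrite mulr1 mulrCA ler_pM2l // expRN mulrC ler_pdivrMr ?expR_gt0 // mul1r.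
    exact: count.
  have M : mean_le P (fun w => \sum_(j < L | (J < j)%N) j.+1%:R ^+ m.-1 * E j w)
      (\sum_(j < L | (J < j)%N) j.+1%:R ^+ m.-1 * (tau j * ((m * A.+1 + 4)%:R * j.+1%:R))).
    by apply: mean_le_sum => j _; apply: mean_leZ => //; rewrite exprn_ge0.
  apply: mean_le_trans M _.
  pose k : R := (m * A.+1 + 4)%:R * (sigma * Num.sqrt (B ^+ m * n%:R)).
  have -> : \sum_(j < L | (J < j)%N) j.+1%:R ^+ m.-1 * (tau j * ((m * A.+1 + 4)%:R * j.+1%:R)) =
      k * \sum_(j < L | (J < j)%N) j.+1%:R ^+ m * decay ^+ j.
    rewrite mulr_sumr; apply: eq_bigr => j _.
    have -> : j.+1%:R ^+ m = j.+1%:R * j.+1%:R ^+ m.-1 :> R by rewrite -exprS prednK.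
    by rewrite /k /tau; ring.
  have k0 : 0 <= k by rewrite mulr_ge0 // mulr_ge0 // ltW.
  apply: le_trans (ler_wpM2l k0 (HS J L)) _.
  rewrite /k sqrtrM ?exprn_ge0 ?(ltW B0) //.
  by rewrite le_eqVlt; apply/orP; left; apply/eqP; ring.
move=> w t Dt; rewrite (@dot_residual_expand es (noise w) (h t) I (fun p => c p t) phi); last first.
  by move=> l; exact: hE.
apply: le_trans (ler_norm_sum _ _ _) _.
rewrite (partition_big lo xpredT) //= [leRHS]big_mkcond; apply: ler_sum => j _.
have loE p : (lo p == j) = (lev p == j) by [].
case: ifP => [Jj|/negbT].
  apply: (@le_trans _ _ (\sum_(p | lev p == j) `|c p t| * E j w)); last first.
    by rewrite -mulr_suml; apply: ler_wpM2r => //; exact: csum.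
  rewrite (eq_bigl _ _ loE); apply: ler_sum => p /eqP lp; rewrite normrM.
  have [Vp|nVp] := boolP (V p); last by rewrite cV // normr0 !mul0r.
  by apply: ler_wpM2l => //; rewrite -lp; exact: XE.
rewrite -leqNgt => jJ; rewrite big1 // => p; rewrite loE => /eqP lp.
have [Vp|nVp] := boolP (V p); last by rewrite cV // mul0r normr0.
have lowp : proj es (phi p) = phi p by apply: low => //; rewrite lp.
rewrite (_ : dot _ _ = 0) ?mulr0 ?normr0 // /residual lowp.
by rewrite /dot big1 // => i _; rewrite subrr mulr0.
Qed.

End noise_bound.

(** * Basic inequality of least squares *)

Section lse.
Context {R : realType} {n : nat}.
Implicit Types (z fs fh g : 'I_n -> R) (es : seq ('I_n -> R)).

(** With [Q] the loss, [D] that of [g] and [v = fh - g], [Q <= D + 2 <z, v>]. Young's inequality on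
    the projected part charges [|v|^2 / 8], and [|v|^2 <= 2 Q + 2 D]; in total [Q / 2] returns to
    the left, and doubling gives 3, 8 and 4. *)
Lemma lse_inequality es z fs fh g :
  (forall v, dot (residual es v) (residual es v) = dot v v - \sum_(e <- es) dot v e ^+ 2) ->
  \sum_i (fs i + z i - fh i) ^+ 2 <= \sum_i (fs i + z i - g i) ^+ 2 ->
  \sum_i (fh i - fs i) ^+ 2 <= 3 * \sum_i (g i - fs i) ^+ 2
    + 8 * \sum_(e <- es) dot z e ^+ 2 + 4 * `|dot z (residual es (fun i => fh i - g i))|.
Proof.
move=> bessel rss_le.
pose v i := fh i - g i.
pose Q := \sum_i (fh i - fs i) ^+ 2; pose D := \sum_i (g i - fs i) ^+ 2.
have h1 : Q <= D + 2 * dot z v.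
  have e1 : \sum_i (fs i + z i - fh i) ^+ 2 - \sum_i (fs i + z i - g i) ^+ 2 = Q - D - 2 * dot z v.
    rewrite /Q /D /dot mulr_sumr -!sumrB; apply: eq_bigr => i _; rewrite /v; ring.
  by move: rss_le; rewrite -subr_le0 e1; lra.
have h2 : dot v v <= 2 * Q + 2 * D.
  rewrite /Q /D /dot !mulr_sumr -big_split /=; apply: ler_sum => i _; rewrite /v.
  have := sqr_ge0 ((fh i - fs i) + (g i - fs i)); nra.
have h3 : dot z v = \sum_(e <- es) dot v e * dot z e + dot z (residual es v).
  rewrite (dotC z (residual es v)) dotBl dot_proj (dotC z v).
  have -> : \sum_(e <- es) dot v e * dot z e = \sum_(e <- es) dot v e * dot e z.
    by apply: eq_bigr => e _; rewrite (dotC z).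
  by rewrite addrC subrK.
have h4 : \sum_(e <- es) dot v e * dot z e <=
    2 * \sum_(e <- es) dot z e ^+ 2 + 8^-1 * \sum_(e <- es) dot v e ^+ 2.
  rewrite !mulr_sumr -big_split /=; apply: ler_sum => e _.
  have := sqr_ge0 (dot v e / 4 - dot z e); nra.
have h5 : \sum_(e <- es) dot v e ^+ 2 <= dot v v.
  by have := bessel v; have := dot_ge0 (residual es v); lra.
have h6 := ler_norm (dot z (residual es v)).
rewrite -/Q -/D -/v; lra.
Qed.

End lse.

(** * Noise against residuals of functions of the class *)

Section mars_residual.
Context {R : realType} {d n : nat}.
Variables (x : 'I_n -> 'I_d -> R) (s : nat).
Hypothesis xcube : forall l, unit_cube (x l).

Lemma fine_total_variation_le (nu : @charge_family R d) (V : R) alpha :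
  active s alpha -> (complexity s nu <= V%:E)%E ->
  fine (Defs.total_variation (nu alpha)
    (@ho_cube R #|alpha| `\` [set t | forall i, tnth t i = 0])) <= V.
Proof.
move=> aa h; rewrite -lee_fin fineK; last first.
  rewrite /Defs.total_variation fin_num_measure //.
  by apply: measurableD; [exact: measurable_ho_cube|exact: measurable_zero_tuple].
apply: le_trans h; rewrite /complexity (bigD1 alpha) //= leeDl //.
by apply: sume_ge0 => beta _; rewrite /Defs.total_variation measure_ge0.
Qed.

(** The pairing is linear, hence passes under the integral; the new integrand is bounded by [Rb] and
    vanishes at the origin, so the complexity controls it. *)
Lemma residual_hinge_integral (nu : @charge_family R d) (V : R) alpha
    (es : seq ('I_n -> R)) (z : 'I_n -> R) (Rb : R) :
  active s alpha -> (complexity s nu <= V%:E)%E -> 0 <= Rb ->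
  (forall t, @ho_cube R #|alpha| t ->
     `|dot z (residual es (fun l => hinge_prod (x l) t))| <= Rb) ->
  (forall t : #|alpha|.-tuple R, (forall i, tnth t i = 0) ->
     dot z (residual es (fun l => hinge_prod (x l) t)) = 0) ->
  `|dot z (residual es (fun l => hinge_integral nu alpha (x l)))| <= Rb * V.
Proof.
move=> aa hV Rb0 HRb HZ.
have mD := @measurable_ho_cube R #|alpha|.
have mZ := @measurable_zero_tuple R #|alpha|.
have bh l : bounded_on (@ho_cube R #|alpha|) (hinge_prod (x l)).
  by apply: bounded_on_hinge => i; have /andP[] := xcube l (enum_val i).
pose zt := residual es z.
have F v : dot z (residual es v) = \sum_l zt l * v l by rewrite -dot_res_sym.
have -> : dot z (residual es (fun l => hinge_integral nu alpha (x l))) =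
    charge_Rintegral (nu alpha) (@ho_cube R #|alpha|) (fun t => \sum_l zt l * hinge_prod (x l) t).
  rewrite F charge_Rintegral_sum //; last by move=> l _; exact: bounded_onZ.
  by apply: eq_bigr => l _; rewrite charge_RintegralZ.
apply: (@le_trans _ _ (Rb * fine (Defs.total_variation (nu alpha)
    (@ho_cube R #|alpha| `\` [set t | forall i, tnth t i = 0])))).
  apply: le_total_variation_charge_Rintegral => //.
  - by apply: bounded_on_sum => l _; exact: bounded_onZ.
  - by move=> t Dt Zt; rewrite -F HZ.
  - by move=> t Dt; rewrite -F HRb.
by apply: ler_wpM2l => //; exact: fine_total_variation_le.
Qed.

(** Intercepts drop out since the constant function is in the span; each of the two functions
    contributes one [V]. *)
Lemma residual_mars_fun (nu nu' : @charge_family R d) (a0 a0' V : R)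
    (es : seq ('I_n -> R)) (z : 'I_n -> R) (Rb : {set 'I_d} -> R) :
  (complexity s nu <= V%:E)%E -> (complexity s nu' <= V%:E)%E ->
  proj es (fun=> 1) = (fun=> 1) ->
  (forall alpha, active s alpha -> [/\ 0 <= Rb alpha,
     (forall t, @ho_cube R #|alpha| t ->
       `|dot z (residual es (fun l => hinge_prod (x l) t))| <= Rb alpha) &
     (forall t : #|alpha|.-tuple R, (forall i, tnth t i = 0) ->
       dot z (residual es (fun l => hinge_prod (x l) t)) = 0)]) ->
  `|dot z (residual es (fun l => mars_fun s a0 nu (x l) - mars_fun s a0' nu' (x l)))|
    <= 2 * V * \sum_(alpha | active s alpha) Rb alpha.
Proof.
move=> hV hV' p1 H.
have F v : dot z (residual es v) = dot (residual es z) v by rewrite -dot_res_sym.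
have one : dot (residual es z) (fun=> 1) = 0.
  rewrite -F /residual p1 /dot big1 // => l _.
  by rewrite subrr mulr0.
have E (nu0 : @charge_family R d) a : dot (residual es z) (fun l => mars_fun s a nu0 (x l)) =
    \sum_(alpha | active s alpha) dot z (residual es (fun l => hinge_integral nu0 alpha (x l))).
  rewrite dotC /mars_fun dotDl dot_suml.
  rewrite (_ : (fun=> a) = (fun l : 'I_n => a * 1)); last by apply/funext => l; rewrite mulr1.
  rewrite (dotZl a (fun=> 1)) (dotC _ (residual es z)) one mulr0 add0r.
  by apply: eq_bigr => alpha _; rewrite F dotC.
rewrite F dotC dotBl !(dotC _ (residual es z)) !E -sumrB.
apply: le_trans (ler_norm_sum _ _ _) _; rewrite mulr_sumr; apply: ler_sum => alpha aa.
have [R0 h1 h2] := H alpha aa.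
apply: le_trans (ler_normB _ _) _.
have := residual_hinge_integral aa hV R0 h1 h2.
have := residual_hinge_integral aa hV' R0 h1 h2.
lra.
Qed.

End mars_residual.

(** * An oracle with knots on the grid *)

Section oracle.
Context {R : realType} {d : nat}.

Lemma min_knots_le (N : 'I_d -> nat) k : (min_knots N <= N k)%N.
Proof.
rewrite /min_knots; move: (\max_(i < d) N i)%N => y.
have := mem_index_enum k; elim: (index_enum _) => // a r IH.
rewrite inE big_cons => /predU1P[->|/IH h]; first exact: geq_minl.
exact: leq_trans (geq_minr _ _) h.
Qed.

Lemma min_knots_gt0 (N : 'I_d -> nat) : (0 < d)%N -> (forall k, (0 < N k)%N) -> (0 < min_knots N)%N.
Proof.
move=> d0 N0; rewrite /min_knots; elim/big_ind: _ => //.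
  by apply: leq_trans (N0 (Ordinal d0)) _; exact: leq_bigmax.
by move=> a b a0 b0; rewrite leq_min a0.
Qed.

Lemma oracle_approximation (s : nat) (V : R) (N : 'I_d -> nat) (f : ('I_d -> R) -> R) :
  (0 < d)%N -> (forall k, (0 < N k)%N) -> 0 <= V -> (Vmars s f <= V%:E)%E ->
  exists a0 nu, let g := mars_fun s a0 nu in
    [/\ approx_class s V N g, (complexity s nu <= V%:E)%E &
      forall x, unit_cube x -> `|g x - f x| <= V / (min_knots N)%:R].
Proof.
move=> d0 N0 V0 /Vmars_represents [a0 [nu [[conc fE] hV]]].
have M0 := min_knots_gt0 d0 N0.
pose eps : R := (min_knots N)%:R^-1.
have eps0 : 0 <= eps by rewrite invr_ge0.
have Neps k : (N k)%:R^-1 <= eps.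
  by rewrite lef_pV2 ?posrE ?ltr0n // ler_nat min_knots_le.
have ex (alpha : {set 'I_d}) := @rounding_charge R #|alpha| (fun i => N (enum_val i)) eps (nu alpha)
  (fun i => N0 _) (fun i => Neps _) eps0.
pose nug : @charge_family R d := fun alpha => sval (cid (ex alpha)).
have nugP (alpha : {set 'I_d}) := svalP (cid (ex alpha)).
have cV : (complexity s nug <= V%:E)%E.
  by apply: le_trans hV; apply: lee_sum => alpha _; have [_ _] := nugP alpha.
have gconc (alpha : {set 'I_d}) : active s alpha ->
    concentrated_on (nug alpha) (@knot_grid R d N alpha `&` @ho_cube R #|alpha|).
  by move=> _; have [] := nugP alpha.
have rep : represents s a0 nug (mars_fun s a0 nug).
  split => // alpha aa A mA AE; apply: gconc => //.
  by apply/seteqP; split => // t [At [_ Dt]]; rewrite -AE.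
exists a0, nug; split => //.
  split; last by exists a0, nug.
  exact: le_trans (Vmars_le_complexity rep) cV.
move=> x hx; rewrite fE // /mars_fun opprD addrACA subrr add0r -sumrB.
apply: le_trans (ler_norm_sum _ _ _) _.
pose tv (alpha : {set 'I_d}) := Defs.total_variation (nu alpha)
  (@ho_cube R #|alpha| `\` [set t | forall i, tnth t i = 0]).
have mDZ (alpha : {set 'I_d}) :
    measurable (@ho_cube R #|alpha| `\` [set t | forall i, tnth t i = 0]).
  by apply: measurableD; [exact: measurable_ho_cube|exact: measurable_zero_tuple].
apply: (@le_trans _ _ (\sum_(alpha | active s alpha) eps * fine (tv alpha))).
  apply: ler_sum => alpha _; have [_ H _] := nugP alpha.
  by apply: H => i; exact: hx.
rewrite -mulr_sumr mulrC; apply: ler_wpM2r => //.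
rewrite -lee_fin -sumEFin; apply: le_trans hV; apply: lee_sum => alpha _.
rewrite fineK; first exact: lexx.
by rewrite /tv /Defs.total_variation; apply: fin_num_measure; exact: mDZ.
Qed.

End oracle.

(** * The span of low levels over all interactions *)

Section noise_projection.
Context {R : realType} {d n : nat}.
Variables (rho : R) (x : 'I_n -> 'I_d -> R) (nk : 'I_d -> nat) (u : 'I_d -> nat -> R) (A : nat).
Hypotheses (rho0 : 0 < rho) (A0 : (0 < A)%N) (rhoA : rho <= A%:R).
Hypothesis design : lattice_design rho x nk u.
Variables (dsp : measure_display) (T : measurableType dsp) (P : probability T R).
Variables (xi : 'I_n -> {RV P >-> R}) (sigma : R).
Hypotheses (ind : mutually_independent xi) (sub : forall i, sub_gaussian sigma (xi i)).
Hypothesis sigma0 : 0 < sigma.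

Let B : R := 8 + 16 / rho.
Let noise w : 'I_n -> R := fun i => xi i w.

(** One family, fixed independently of the noise, serves all active [alpha]. In its size, the
    summand 1 counts the constant function and the factor 2 comes from [2 ^+ J.+1] in [head_sum]. *)
Lemma noise_projection (s J : nat) (S : nat -> R) (kappa : R) :
  (0 < s)%N -> (0 < n)%N -> (forall m, 0 < S m) ->
  (forall m J L, \sum_(j < L | (J < j)%N) j.+1%:R ^+ m * decay ^+ j <=
     S m * (J.+1%:R ^+ m * decay ^+ J)) ->
  (forall m, (m <= d)%N -> (m * A.+1 + 4)%:R * S m * Num.sqrt (B ^+ m) <= kappa) ->
  exists (es : seq ('I_n -> R)),
  [/\ (size es)%:R <= (1 + 2 * #|{set 'I_d}|%:R * A%:R ^+ d) * (J.+1%:R ^+ s.-1 * 2 ^+ J) :> R,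
      {in es, forall e, dot e e = 1},
      forall v, dot (residual es v) (residual es v) = dot v v - \sum_(e <- es) dot v e ^+ 2,
      proj es (fun=> 1) = (fun=> 1) &
      exists Rb : {set 'I_d} -> T -> R, forall alpha, active s alpha ->
      [/\ mean_le P (Rb alpha) (kappa * sigma * Num.sqrt n%:R * (J.+1%:R ^+ s * decay ^+ J)),
        forall w t, @ho_cube R #|alpha| t ->
         `|dot (noise w) (residual es (fun l => hinge_prod (x l) t))| <= Rb alpha w &
        forall w (t : #|alpha|.-tuple R), (forall i, tnth t i = 0) ->
         dot (noise w) (residual es (fun l => hinge_prod (x l) t)) = 0]].
Proof.
move=> s0 n0 S0 HS Hkappa.
have B0 : 0 < B by rewrite addr_gt0 // divr_gt0.
(* Packed into a single type so that a system can be chosen for every [alpha]; ['I_0] fills in for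
   the empty set. *)
pose sys (alpha : {set 'I_d}) := {I : finType & (I -> nat) * pred I * (I -> 'I_n -> R) *
   (I -> #|alpha|.-tuple R -> R)}%type.
pose good (alpha : {set 'I_d}) (y : sys alpha) := let: existT I0 (lev, V, phi, c) := y in
  [/\ forall t l, @ho_cube R #|alpha| t -> hinge_prod (x l) t = \sum_p c p t * phi p l,
      forall t j, @ho_cube R #|alpha| t ->
        \sum_(p | lev p == j) `|c p t| <= j.+1%:R ^+ #|alpha|.-1,
      forall j, \sum_(p | (lev p == j) && V p) 1 <= j.+1%:R ^+ #|alpha|.-1 * A%:R ^+ #|alpha| * 2 ^+ j :> R,
      forall p, dot (phi p) (phi p) <= B ^+ #|alpha| * n%:R * 8 ^- lev p &
      (forall p t, ~~ V p -> c p t = 0) /\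
      (forall p t, (forall i, tnth t i = 0) -> (0 < lev p)%N -> c p t = 0)].
have ex (alpha : {set 'I_d}) : exists y : sys alpha, (0 < #|alpha|)%N -> good alpha y.
  have [m0|m0] := ltnP 0 #|alpha|.
    have [I [lev [V [phi [c H]]]]] := tensor_system rho0 A0 rhoA design m0.
    by exists (existT _ I (lev, V, phi, c)).
  pose z : ('I_0 -> nat) * pred 'I_0 * ('I_0 -> 'I_n -> R) * ('I_0 -> #|alpha|.-tuple R -> R) :=
    (fun=> 0%N, xpred0, (fun _ _ => 0), (fun _ _ => 0)).
  exists (existT (fun I : finType => (I -> nat) * pred I * (I -> 'I_n -> R) *
    (I -> #|alpha|.-tuple R -> R))%type ('I_0 : finType) z) => h; discriminate h.
pose Y alpha := sval (cid (ex alpha)).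
have YP (alpha : {set 'I_d}) : (0 < #|alpha|)%N -> good alpha (Y alpha) := svalP (cid (ex alpha)).
pose lv (alpha : {set 'I_d}) := (projT2 (Y alpha)).1.1.1; pose vd (alpha : {set 'I_d}) := (projT2 (Y alpha)).1.1.2.
pose ph (alpha : {set 'I_d}) := (projT2 (Y alpha)).1.2; pose cc (alpha : {set 'I_d}) := (projT2 (Y alpha)).2.
have {}YP (alpha : {set 'I_d}) : (0 < #|alpha|)%N -> [/\ forall t l, @ho_cube R #|alpha| t ->
        hinge_prod (x l) t = \sum_p cc alpha p t * ph alpha p l,
      forall t j, @ho_cube R #|alpha| t ->
        \sum_(p | lv alpha p == j) `|cc alpha p t| <= j.+1%:R ^+ #|alpha|.-1,
      forall j, \sum_(p | (lv alpha p == j) && vd alpha p) 1 <=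
        j.+1%:R ^+ #|alpha|.-1 * A%:R ^+ #|alpha| * 2 ^+ j :> R,
      forall p, dot (ph alpha p) (ph alpha p) <= B ^+ #|alpha| * n%:R * 8 ^- lv alpha p &
      (forall p t, ~~ vd alpha p -> cc alpha p t = 0) /\
      (forall p t, (forall i, tnth t i = 0) -> (0 < lv alpha p)%N -> cc alpha p t = 0)].
  move=> m0; have := YP alpha m0; rewrite /lv /vd /ph /cc.
  by case: (Y alpha) => I [[[lev V] phi] c].
have act0 (alpha : {set 'I_d}) : active s alpha -> (0 < #|alpha|)%N by case/andP; rewrite card_gt0.
pose low (alpha : {set 'I_d}) := [seq ph alpha p | p <- enum (fun p => vd alpha p && (lv alpha p <= J)%N)].
pose vs := (fun=> 1 : R) :: flatten [seq low alpha | alpha <- enum (active s)].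
have [es [hs hu hp hb]] := orthonormalization vs.
have pphi (alpha : {set 'I_d}) p : active s alpha -> vd alpha p -> (lv alpha p <= J)%N ->
    proj es (ph alpha p) = ph alpha p.
  move=> aa Vp lp; apply: hp; rewrite inE; apply/orP; right; apply/flattenP.
  exists (low alpha); first by apply: map_f; rewrite mem_enum.
  by apply: map_f; rewrite mem_enum unfold_in Vp.
exists es; split => //.
- have size_low (alpha : {set 'I_d}) : active s alpha -> (size (low alpha))%:R <=
      A%:R ^+ d * (J.+1%:R ^+ s.-1 * 2 ^+ J.+1) :> R.
    move=> aa; have m0 := act0 _ aa; have [_ _ card _ _] := YP alpha m0.
    have /andP[_ ms] := aa.
    have md : (#|alpha| <= d)%N by rewrite -[leqRHS]card_ord max_card.
    have -> : (size (low alpha))%:R = \sum_(p | vd alpha p && (lv alpha p <= J)%N) 1 :> R.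
      by rewrite sumr_const size_map -cardE.
    rewrite (partition_big (fun p => inord (lv alpha p) : 'I_J.+1) xpredT) //=.
    apply: (@le_trans _ _ (\sum_(j < J.+1) A%:R ^+ d * (j.+1%:R ^+ s.-1 * 2 ^+ j))); last first.
      rewrite -mulr_sumr; apply: ler_wpM2l; first by rewrite exprn_ge0.
      exact: head_sum.
    apply: ler_sum => j _.
    rewrite (eq_bigl (fun p => (lv alpha p == j) && vd alpha p)); last first.
      move=> p; rewrite andbC; case: (boolP (vd alpha p)) => _; rewrite ?andbF // andbT /=.
      apply/andP/eqP => [[/eqP <- lp]|e]; first by rewrite inordK.
      have lp : (lv alpha p <= J)%N by rewrite e -ltnS.
      by split => //; apply/eqP/val_inj; rewrite /= inordK.
    apply: le_trans (card j) _; rewrite [_ * A%:R ^+ _]mulrC -mulrA.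
    apply: ler_pM; rewrite ?mulr_ge0 ?exprn_ge0 //.
      by apply: ler_weXn2l => //; rewrite ler1n.
    apply: ler_wpM2r; first by rewrite exprn_ge0.
    apply: ler_weXn2l; first by rewrite ler1n.
    by rewrite -!subn1 leq_sub2r.
  have q1 : 1 <= J.+1%:R ^+ s.-1 * 2 ^+ J :> R.
    by apply: mulr_ege1; rewrite exprn_ege1 // ler1n.
  apply: (@le_trans _ _ (size vs)%:R); first by rewrite ler_nat.
  rewrite /= size_flatten /shape -map_comp sumnE big_map -natr1 natr_sum addrC mulrDl mul1r.
  apply: lerD => //.
  rewrite big_enum_cond /=; apply: (@le_trans _ _ (\sum_(alpha | active s alpha)
      A%:R ^+ d * (J.+1%:R ^+ s.-1 * 2 ^+ J.+1))).
    by rewrite (eq_bigl (active s)) => [|a]; [apply: ler_sum => alpha aa; exact: size_low|rewrite andbT].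
  apply: (@le_trans _ _ (\sum_(alpha : {set 'I_d}) A%:R ^+ d * (J.+1%:R ^+ s.-1 * 2 ^+ J.+1))).
    rewrite big_mkcond; apply: ler_sum => alpha _; case: ifP => _; first exact: lexx.
    by rewrite mulr_ge0 ?exprn_ge0 // mulr_ge0 ?exprn_ge0.
  rewrite sumr_const -[leLHS]mulr_natl exprS.
  by rewrite le_eqVlt; apply/orP; left; apply/eqP; ring.
- by apply: hp; rewrite inE eqxx.
- have bessel v : dot (residual es v) (residual es v) <= dot v v.
    by rewrite (hb v) gerBl; apply: sumr_ge0 => e _; exact: sqr_ge0.
  have H (alpha : {set 'I_d}) : exists Rb : T -> R, active s alpha ->
      mean_le P Rb (kappa * sigma * Num.sqrt n%:R * (J.+1%:R ^+ s * decay ^+ J)) /\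
      forall w t, @ho_cube R #|alpha| t ->
       `|dot (noise w) (residual es (fun l => hinge_prod (x l) t))| <= Rb w.
    have [aa|na] := boolP (active s alpha); last by exists (fun=> 0).
    have m0 := act0 _ aa; have [hE csum card phi2 [cV _]] := YP alpha m0.
    have [Rb mRb RbP] := system_noise_bound ind sub sigma0 m0 n0 B0 (HS _)
      hE csum card phi2 cV bessel (fun p => pphi alpha p aa).
    exists Rb => _; split=> //; apply: mean_le_trans mRb _.
    have /andP[_ ms] := aa.
    have md : (#|alpha| <= d)%N by rewrite -[leqRHS]card_ord max_card.
    apply: ler_pM.
    + by rewrite !mulr_ge0 ?sqrtr_ge0 ?(ltW sigma0) ?(ltW (S0 _)).
    + by rewrite mulr_ge0 ?exprn_ge0 ?(ltW decay_gt0).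
    + apply: ler_wpM2r; first exact: sqrtr_ge0.
      by apply: ler_wpM2r; [exact: ltW|exact: Hkappa].
    + apply: ler_wpM2r; first by rewrite exprn_ge0 ?(ltW decay_gt0).
      by apply: ler_weXn2l => //; rewrite ler1n.
  have [Rb HRb] := choice H.
  exists Rb => alpha aa; have [h1 h2] := HRb alpha aa; split => // w t t0.
  have m0 := act0 _ aa; have [hE _ _ _ [cV cZ]] := YP alpha m0.
  have Dt : @ho_cube R #|alpha| t by move=> i; rewrite t0 lexx ltr01.
  rewrite (@dot_residual_expand _ _ es (noise w) _ _ (fun p => cc alpha p t) (ph alpha)); last first.
    by move=> l; exact: hE.
  rewrite big1 // => p _.
  have [Vp|nVp] := boolP (vd alpha p); last by rewrite cV // mul0r.
  (* At the origin positive levels have zero coefficient, and level 0 has zero residual since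
     [0 <= J]. *)
  have [l0|l0] := posnP (lv alpha p); last by rewrite cZ // mul0r.
  rewrite /residual (pphi alpha p aa Vp) ?l0 // /dot big1 ?mulr0 // => i _.
  by rewrite subrr mulr0.
Qed.

End noise_projection.

(** * Choice of the constant and assembly of the risk bound *)

Theorem theorem3p4 (R : realType) (rho : R) (d : nat) :
  0 < rho -> (1 <= d)%N ->
  exists C : R, 0 < C /\
  forall (s : nat) (V sigma : R) (N : 'I_d -> nat)
    (n : nat) (x : 'I_n -> 'I_d -> R) (nk : 'I_d -> nat) (u : 'I_d -> nat -> R)
    (dsp : measure_display) (T : measurableType dsp) (P : probability T R)
    (xi : 'I_n -> {RV P >-> R}) (fstar : ('I_d -> R) -> R)
    (fhat : ('I_n -> R) -> ('I_d -> R) -> R),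
  (1 <= s <= d)%N -> 0 < V -> 0 < sigma -> (forall k, (0 < N k)%N) ->
  lattice_design rho x nk u ->
  mutually_independent xi ->
  (forall i, ('E_P[xi i] = 0)%E) ->
  (forall i, sub_gaussian sigma (xi i)) ->
  mars_class s fstar -> (Vmars s fstar <= V%:E)%E ->
  is_approx_estimator s V N x fhat ->
  (risk P x (fun w i => (fstar (x i) + xi i w)%R) fhat fstar <=
    (8 * V ^+ 2 / (min_knots N)%:R ^+ 2
     + C * (sigma ^+ 2 * V `^ (1 / 2) / n%:R) `^ (4 / 5)
         * ln (2 + V * n%:R `^ (1 / 2) / sigma)
             `^ (3 * (2 * s%:R - 1) / 5)
     + C * (sigma ^+ 2 / n%:R) * ln n%:R ^+ 2)%R%:E)%E.
Proof.
move=> rho0 d0.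
pose A := Num.bound rho; have rhoA : rho <= A%:R by exact/ltW/archi_boundP/ltW.
have A0 : (0 < A)%N by rewrite -(ltr_nat R) (lt_le_trans rho0).
pose B : R := 8 + 16 / rho.
have exS (m : nat) : exists S : R, 0 < S /\ forall J L,
    \sum_(j < L | (J < j)%N) j.+1%:R ^+ m * decay ^+ j <= S * (J.+1%:R ^+ m * decay ^+ J).
  by have [S h1 h2] := @tail_sum R m; exists S.
have [S SP] := choice exS.
have exK (s : nat) : exists K : R, 0 < K /\ ((0 < s)%N -> forall M, 0 < M ->
  exists J : nat, let b := 1 + M `^ (2 / 5) * ln (2 + M) `^ (3 * (2 * s%:R - 1) / 5) in
    J.+1%:R ^+ s.-1 * 2 ^+ J <= K * b /\ M * (J.+1%:R ^+ s * decay ^+ J) <= K * b).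
  case: (posnP s) => [->|s0]; first by exists 1.
  by have [K K0 H] := @rate_choice R s s0; exists K.
have [K KP] := choice exK.
pose kap m : R := (m * A.+1 + 4)%:R * S m * Num.sqrt (B ^+ m).
have kap0 m : 0 <= kap m by rewrite !mulr_ge0 ?sqrtr_ge0 // ltW //; case: (SP m).
(* Summing over all orders up to [d], here and in [Kt], makes the constants depend on [rho] and [d]
   alone. *)
pose kappa := \sum_(m < d.+1) kap m.
have kapP m : (m <= d)%N -> kap m <= kappa.
  move=> md; rewrite /kappa (bigD1 (Ordinal (md : (m < d.+1)%N))) //= lerDl.
  by apply: sumr_ge0.
have kappa0 : 0 <= kappa by apply: sumr_ge0.
pose Kt := \sum_(s < d.+1) K s.
have KtP s : (s <= d)%N -> K s <= Kt.
  move=> sd; rewrite /Kt (bigD1 (Ordinal (sd : (s < d.+1)%N))) //= lerDl.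
  by apply: sumr_ge0 => i _; rewrite ltW //; case: (KP i).
have Kt0 : 0 < Kt by apply: lt_le_trans (KtP 0%N isT); case: (KP 0%N).
pose G : R := #|{set 'I_d}|%:R.
have G0 : 0 <= G by [].
pose c1 : R := 1 + 2 * G * A%:R ^+ d.
have c10 : 0 < c1 by rewrite ltr_pwDl // !mulr_ge0 // exprn_ge0.
(* [64] is 8 from [lse_inequality] times 8 from [mean_le_sqr]; [8] is 4 from [lse_inequality] times
   2 from [residual_mars_fun]. *)
pose C0 := Kt * (64 * c1 + 8 * (G * kappa)).
have C00 : 0 < C0 by rewrite mulr_gt0 // ltr_pwDl ?mulr_gt0 // !mulr_ge0.
(* The [4] is that of [one_le_ln_sqr]. *)
exists (4 * C0); split; first by rewrite mulr_gt0.
move=> s V sigma N n x nk u dsp T P xi fstar fhat /andP[s0 sd] V0 sigma0 N0 design ind _ sub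
  _ hV fhatP.
have [nE _ dk] := design.
have n2 : (2 <= n)%N.
  have [k0 _ _ _ _] := dk (Ordinal d0).
  rewrite nE (bigD1 (Ordinal d0)) //= (leq_trans k0) // leq_pmulr // prodn_gt0 // => k.
  by have [h _ _ _ _] := dk k; exact: ltnW.
have n0 : (0 < n)%N by exact: ltnW.
have n0' : 0 < n%:R :> R by rewrite ltr0n.
have sn : V * n%:R `^ (1 / 2) / sigma = V * Num.sqrt n%:R / sigma.
  by rewrite div1r powR12_sqrt.
pose M := V * n%:R `^ (1 / 2) / sigma.
have M0 : 0 < M by rewrite /M sn divr_gt0 // mulr_gt0 // sqrtr_gt0.
have [_ /(_ s0 M M0) [J]] := KP s.
set b := 1 + _; move=> /= [hJ1 hJ2].
have [es [sz eu bessel p1 [Rb RbP]]] := @noise_projection R d n rho x nk u A rho0 A0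
  rhoA design dsp T P xi sigma ind sub sigma0 s J S kappa s0 n0 (fun m => (SP m).1) (fun m => (SP m).2) kapP.
have [b0 [nug [gapp gV gapprox]]] := oracle_approximation d0 N0 (ltW V0) hV.
have xcube l : unit_cube (x l) by exact: (lattice_design_cube design).
pose g := mars_fun s b0 nug.
pose noise w : 'I_n -> R := fun i => xi i w.
pose D := \sum_i (g (x i) - fstar (x i)) ^+ 2.
pose mk : R := (min_knots N)%:R.
have D0 : 0 <= D by apply: sumr_ge0 => i _; exact: sqr_ge0.
have DP : D <= n%:R * (V / mk) ^+ 2.
  apply: (@le_trans _ _ (\sum_(i < n) (V / mk) ^+ 2)); last first.
    by rewrite sumr_const card_ord -[leLHS]mulr_natl.
  apply: ler_sum => i _; rewrite -[leLHS]real_normK ?num_real //.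
  have := gapprox _ (xcube i); rewrite -/g -/mk => h.
  by apply: lerXn2r; rewrite ?nnegrE // divr_ge0 // ltW.
(* A measurable variable that dominates the loss at every outcome. *)
pose Z w := n%:R^-1 * (3 * D + (8 * \sum_(e <- es) dot (noise w) e ^+ 2
   + 8 * V * \sum_(alpha | active s alpha) Rb alpha w)).
pose cst : R := n%:R^-1 * (3 * D + (8 * \sum_(e <- es) (8 * sigma ^+ 2)
   + 8 * V * \sum_(alpha : {set 'I_d} | active s alpha)
        (kappa * sigma * Num.sqrt n%:R * (J.+1%:R ^+ s * decay ^+ J)))).
have mZ : mean_le P Z cst.
  apply: mean_leZ; first by rewrite invr_ge0.
  apply: mean_leD; first by apply: mean_le_cst; rewrite mulr_ge0.
  apply: mean_leD.
    apply: mean_leZ => //; rewrite [X in mean_le _ _ X]big_seq_cond [X in mean_le _ X _](_ : _ = fun w =>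
      \sum_(e <- es | (e \in es) && true) dot (noise w) e ^+ 2); last first.
      by apply/funext => w; rewrite big_seq_cond.
    apply: mean_le_sum => e; rewrite andbT => ee.
    by apply: (mean_le_sqr ind sub sigma0); rewrite eu.
  apply: mean_leZ; first by rewrite mulr_ge0 // ltW.
  by apply: mean_le_sum => alpha aa; have [] := RbP alpha aa.
have Zpt w : n%:R^-1 * \sum_(i < n) (fhat (fun i => fstar (x i) + xi i w) (x i) - fstar (x i)) ^+ 2 <= Z w.
  set Yw := fun i : 'I_n => fstar (x i) + xi i w; have [[hYV _] Ymin] := fhatP Yw.
  have [a0 [nu [[_ nuE] nuV]]] := Vmars_represents hYV.
  have h1 := lse_inequality bessel (Ymin g gapp).
  have h2 : `|dot (noise w) (residual es (fun i => fhat Yw (x i) - g (x i)))| <=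
      2 * V * \sum_(alpha | active s alpha) Rb alpha w.
    have -> : (fun i => fhat Yw (x i) - g (x i)) =
        (fun i => mars_fun s a0 nu (x i) - mars_fun s b0 nug (x i)).
      by apply/funext => i; rewrite nuE.
    apply: residual_mars_fun => // alpha aa; have [[_ q1 _] q2 q3] := RbP alpha aa.
    by split => //; [exact: q2|exact: q3].
  rewrite /Z; apply: ler_wpM2l; first by rewrite invr_ge0.
  apply: le_trans h1 _; rewrite -/D -addrA !lerD2l.
  apply: le_trans (ler_wpM2l _ h2) _ => //; move: (\sum_(alpha | _) _) => q.
  by rewrite le_eqVlt; apply/orP; left; apply/eqP; ring.
rewrite /risk unlock; apply: (@le_trans _ _ cst%:E).
  case: mZ => _ _; apply: le_trans; apply: ge0_le_integral_nomeas => w; rewrite lee_fin //.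
  by rewrite mulr_ge0 ?invr_ge0 // sumr_ge0 // => i _; exact: sqr_ge0.
rewrite lee_fin.
pose r : R := sigma ^+ 2 / n%:R; have r0 : 0 <= r by rewrite divr_ge0 // sqr_ge0.
(* The oracle enters with the 3 of [lse_inequality], within the 8 of the statement. *)
have C0b : cst <= 3 * (V / mk) ^+ 2 + r * (C0 * b).
  pose q1 : R := J.+1%:R ^+ s.-1 * 2 ^+ J; pose q2 : R := J.+1%:R ^+ s * decay ^+ J.
  have q20 : 0 <= q2 by rewrite mulr_ge0 ?exprn_ge0 // ltW // decay_gt0.
  have b0' : 0 <= b by rewrite addr_ge0 // mulr_ge0 // powR_ge0.
  have KJ1 : q1 <= Kt * b.
    by apply: le_trans hJ1 _; apply: ler_wpM2r => //; exact: KtP.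
  have KJ2 : M * q2 <= Kt * b.
    by apply: le_trans hJ2 _; apply: ler_wpM2r => //; exact: KtP.
  have e1 : n%:R^-1 * (3 * D) <= 3 * (V / mk) ^+ 2.
    by rewrite mulrCA ler_pM2l // mulrC ler_pdivrMr // mulrC.
  have e2 : n%:R^-1 * (8 * \sum_(e <- es) (8 * sigma ^+ 2)) <= r * (Kt * (64 * c1) * b).
    rewrite big_const_seq count_predT iter_addr_0 -[_ *+ size es]mulr_natr.
    have -> : n%:R^-1 * (8 * (8 * sigma ^+ 2 * (size es)%:R)) = r * (64 * (size es)%:R).
      by rewrite /r; ring.
    apply: ler_wpM2l => //.
    have h : c1 * q1 <= c1 * (Kt * b) by rewrite ler_pM2l.
    by have := le_trans sz h; lra.
  have e3 : n%:R^-1 * (8 * V * \sum_(alpha : {set 'I_d} | active s alpha)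
      (kappa * sigma * Num.sqrt n%:R * q2)) <= r * (Kt * (8 * (G * kappa)) * b).
    rewrite sumr_const -[kappa * _ * _ * _ *+ _]mulr_natl; set na := #|_|.
    have naG : na%:R <= G by rewrite ler_nat max_card.
    have -> : n%:R^-1 * (8 * V * (na%:R * (kappa * sigma * Num.sqrt n%:R * q2))) =
        r * (8 * (na%:R * kappa * (M * q2))).
      by rewrite /r /M sn; field; rewrite !lt0r_neq0.
    apply: ler_wpM2l => //; have h : na%:R * kappa * (M * q2) <= G * kappa * (Kt * b).
      have na0 : 0 <= na%:R * kappa by rewrite mulr_ge0.
      have Mq0 : 0 <= M * q2 by rewrite mulr_ge0 // ltW.
      by apply: ler_pM => //; exact: ler_wpM2r.
    by move: h; lra.
  rewrite /cst 2!(mulrDr n%:R^-1); apply: le_trans (lerD e1 (lerD e2 e3)) _.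
  by rewrite le_eqVlt; apply/orP; left; apply/eqP; rewrite /C0; ring.
apply: le_trans C0b _.
have ln1 := @one_le_ln_sqr R n n2.
rewrite -(rate_rewrite V0 sigma0 n0) -/M -/r -/mk.
have X0 : 0 <= M `^ (2 / 5) * ln (2 + M) `^ (3 * (2 * s%:R - 1) / 5).
  by apply: mulr_ge0; exact: powR_ge0.
have v0 := sqr_ge0 (V / mk).
have -> : 8 * V ^+ 2 / mk ^+ 2 = 8 * (V / mk) ^+ 2 by rewrite expr_div_n -mulrA.
have rC0 : 0 <= r * C0 by rewrite mulr_ge0 // ltW.
have l1 : r * C0 <= r * C0 * (4 * ln n%:R ^+ 2) by rewrite ler_peMr.
have l2 : r * C0 * (M `^ (2 / 5) * ln (2 + M) `^ (3 * (2 * s%:R - 1) / 5)) <=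
  4 * (r * C0 * (M `^ (2 / 5) * ln (2 + M) `^ (3 * (2 * s%:R - 1) / 5))).
  by rewrite ler_peMl ?ler1n //; exact: mulr_ge0.
move: l1 l2 v0; rewrite /b; move: ((V / mk) ^+ 2) (M `^ _) (ln (2 + M) `^ _) (ln _ ^+ 2) => v a l q.
lra.
Qed.
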